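(* For all integers $n\geq 1$ and $k\geq 2n-1$, $$\Sigma_{k,2n}=-\frac{1}{k}\,[t^{k+1-2n}]\sum_{\lambda\vdash 2n}\hat{m}_{\lambda}\,\frac{P_{\lambda}(t)}{C(t)}.$$
   Context: Kerov's character polynomials. For $k\ge1$, $\Sigma_k$ denotes Kerov's character polynomial: the universal polynomial with integer coefficients in indeterminates $R_2,R_3,\ldots,R_{k+1}$ such that $\widehat{\chi}_\omega(k1^{n-k})=\Sigma_k(R_2(\omega),\ldots,R_{k+1}(\omega))$ for all partitions $\omega\vdash n$ and all $n\geq k$. Here $\widehat{\chi}_\omega(k1^{n-k})=n(n-1)\cdots(n-k+1)\,\chi_\omega(k1^{n-k})/\chi_\omega(1^n)$, where $\chi_\omega(\lambda)$ is the character of the irreducible representation of the symmetric group $\mathfrak{S}_n$ indexed by $\omega$ on the class of cycle type $\lambda$. The free cumulants $R_i(\omega)$ are defined by $z^{-1}+\sum_{i\ge1}R_i(\omega)z^{i-1}=H_\omega^{\langle -1\rangle}(z)$ (compositional inverse, $H_\omega$ being expanded in powers of $1/z$ at infinity), where $H_\omega(z)=\prod_{i=1}^{m-1}(z-y_i)/\prod_{i=1}^{m}(z-x_i)$, with $x_1,\ldots,x_m$ the local minima and $y_1,\ldots,y_{m-1}$ the local maxima of the boundary curve of the Young diagram of $\omega$ (French convention) rotated counterclockwise by $45^\circ$, scaled so that these are integers (i.e. the $x_i$ are the contents, column minus row, of the addable boxes of $\omega$, and the $y_i$ the contents of the removable boxes). Equivalently, by a known theorem (Okounkov, Biane, Stanley):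 with $R(x)=1+\sum_{i\ge2}R_ix^i$, $F(x)=x/R(x)$, $G(x)=1/F^{\langle-1\rangle}(x^{-1})$, where $\langle -1\rangle$ is compositional inverse, one has $\Sigma_k=-\frac1k[x^{-1}]_\infty\prod_{j=0}^{k-1}G(x-j)$, where $[x^{-1}]_\infty$ is the coefficient of $x^{-1}$ in the expansion at $x=\infty$ (in descending powers of $x$). Graded pieces: $\Sigma_{k,2n}=[u^{k+1-2n}]\,\Sigma_k(R_2u^2,R_3u^3,\ldots,R_{k+1}u^{k+1})$, i.e. the sum of all terms of weight $k+1-2n$ in $\Sigma_k$, where $R_{j_1}\cdots R_{j_i}$ has weight $j_1+\cdots+j_i$. $[t^r]$ denotes coefficient extraction. Series: $C(t)=\sum_{m\ge0}C_mt^m=\dfrac{1}{1-\sum_{i\geq 2}(i-1)R_it^i}$ (so $C_0=1$, $C_1=0$). With $D=t\frac{d}{dt}$ and $I$ the identity operator, for $m\ge1$ $$P_m(t)=-\frac{1}{m!}C(t)(D+(m-2)I)C(t)\cdots(D+I)C(t)\,D\,C(t),$$ where each operator acts on everything to its right; e.g. $P_1=-C$, $P_2=-\frac12C\,DC$, $P_3=-\frac16 C(D+I)(C\,DC)$. For a partition $\lambda=\lambda_1\cdots\lambda_{l(\lambda)}$ with $l(\lambda)$ parts, $P_\lambda(t)=\prod_{j=1}^{l(\lambda)}P_{\lambda_j}(t)$. $\hat m_\lambda$ denotes the monomial symmetric function $m_\lambda(x_1,x_2,\ldots)$ evaluated at $x_i=i$ for $1\le i\le k-1$ and $x_i=0$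 for $i\ge k$ (so it depends on $k$). *)

(* Defs.v *)
(* Mathematical Components, with multinomials for multivariate polynomials *)
From HB Require Import structures.
From mathcomp Require Import all_boot all_order all_algebra.
From mathcomp Require Import all_fingroup all_solvable all_field all_character.
From mathcomp Require Import mpoly.

Set Implicit Arguments.
Unset Strict Implicit.
Unset Printing Implicit Defensive.

Import GRing.Theory.

Local Open Scope ring_scope.

(** * Formal power series *)

Section Series.
Variable A : comPzRingType.

(* [f n] is the coefficient [t^n] f. *)
Definition series := nat -> A.

Implicit Types f g : series.

Definition sone : series := fun n => (n == 0%N)%:R.
Definition svar : series := fun n => (n == 1%N)%:R.
Definition sadd f g : series := fun n => f n + g n.
Definition ssub f g : series := fun n => f n - g n.
Definition sscale (a : A) f : series := fun n => a * f n.
Definition smul f g : series := fun n => \sum_(i < n.+1) f i * g (n - i)%N.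
Definition sexp f m : series := iter m (smul f) sone.

(* 1 / f = \sum_j (1 - f)^j; this is the inverse of f when [f 0 = 1], the only
   case in which it is used. *)
Definition sinv f : series := fun n => \sum_(j < n.+1) sexp (ssub sone f) j n.
Definition sdiv f g : series := smul f (sinv g).

(* f(g(t)), for [g 0 = 0]. *)
Definition scomp f g : series := fun n => \sum_(j < n.+1) f j * sexp g j n.

(* D = t d/dt *)
Definition sD f : series := fun n => f n *+ n.

End Series.

(** * Partitions: weakly decreasing sequences of positive integers *)

Definition is_part_of (N : nat) (la : seq nat) : bool :=
  [&& sorted geq la, 0%N \notin la & sumn la == N].

Definition conj_part (la : seq nat) : seq nat :=
  mkseq (fun j => count (fun r => j < r)%N la) (head 0%N la).

(* All partitions of N, each obtained exactly once by erasing the zeros of a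
   weakly decreasing N-tuple of sum N. *)
Definition parts_of (N : nat) : seq (seq nat) :=
  [seq [seq r <- [seq val j | j <- tval t] | r != 0%N]
     | t : N.-tuple 'I_N.+1 in [pred t : N.-tuple 'I_N.+1 |
         let s := [seq val j | j <- tval t] in sorted geq s && (sumn s == N)]].

(** * Irreducible characters of the symmetric groups *)

Section Symmetric.
Variable N : nat.

Definition young_set (la : seq nat) : {set 'S_N} :=
  [set s : 'S_N | [forall i : 'I_N,
     reshape_index la (s i) == reshape_index la i]].

Lemma young_group_set la : group_set (young_set la).
Proof.
apply/group_setP; split=> [|s1 s2].
  by rewrite inE; apply/forallP=> i; rewrite perm1.
rewrite !inE => /forallP h1 /forallP h2; apply/forallP=> i.
by rewrite permM (eqP (h2 _)) (eqP (h1 _)).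
Qed.

(* The Young subgroup S_la1 x S_la2 x ... of S_N, for la a partition of N. *)
Canonical young_group la := Group (young_group_set la).

Lemma cfSgn_subproof :
  is_class_fun <<[set: 'S_N]>>%g [ffun s : 'S_N => (-1) ^+ odd_perm s : algC].
Proof.
apply: (@intro_class_fun _ <<[set: 'S_N]>>%G) => [s1 s2 _ _|s].
  by rewrite odd_permJ.
by rewrite mem_gen ?inE.
Qed.

Definition cfSgn : 'CF([set: 'S_N]) := Cfun 0 cfSgn_subproof.

(* [specht_index om i] says that 'chi_i is the character of the irreducible
   representation indexed by the partition om of N: it is the (unique) common
   constituent of the trivial character induced from the Young subgroup of om
   and of the sign character induced from that of the conjugate of om.
   E.g. om = (N) gives the trivial character. *)
Definition specht_index (om : seq nat) (i : Iirr [set: 'S_N]) : bool :=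
  (i \in irr_constt ('Ind[[set: 'S_N], young_group om] 1)) &&
  (i \in irr_constt ('Ind[[set: 'S_N], young_group (conj_part om)]
                       ('Res[young_group (conj_part om)] cfSgn))).

Definition cycle_type (s : 'S_N) : seq nat :=
  sort geq [seq #|B| | B : {set 'I_N} <- enum (porbits s)].

(* N (N - 1) ... (N - k + 1) chi_om(s) / chi_om(1) *)
Definition normalized_char (k : nat) (i : Iirr [set: 'S_N]) (s : 'S_N) : algC :=
  (N ^_ k)%:R * 'chi_i s / 'chi_i 1%g.

End Symmetric.

(** * Free cumulants of a partition *)

(* Contents (column minus row, both counted from 0) of the boxes that can be
   added to, resp. removed from, the diagram whose i-th row has length om_i. *)
Definition addable_contents (om : seq nat) : seq int :=
  [seq (nth 0%N om i)%:Z - i%:Z |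
     i <- iota 0 (size om).+1 &
       (i == 0%N) || (nth 0 om i < nth 0 om i.-1)%N].

Definition removable_contents (om : seq nat) : seq int :=
  [seq (nth 0%N om i)%:Z - 1 - i%:Z |
     i <- iota 0 (size om) & (nth 0 om i.+1 < nth 0 om i)%N].

(* prod_(a in s) (1 - a u) *)
Definition lin_prod (s : seq int) : series int :=
  \big[@smul int/sone int]_(a <- s) ssub (sone int) (sscale a (svar int)).

(* H_om(z) = prod (z - y_i) / prod (z - x_i) in the variable u = 1/z. There is
   one more x_i than y_i, whence the factor u. *)
Definition Hseries (om : seq nat) : series int :=
  smul (svar int)
    (sdiv (lin_prod (removable_contents om)) (lin_prod (addable_contents om))).

(* [R i] is R_i(om) for i >= 1, and [R 0 = 1] stands for the coefficient of the
   leading term z^-1: the Laurent series K(z) = z^-1 + \sum_(i >= 1) R_i z^(i-1)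
   is R(z) / z. The equation H_om(K(z)) = z is stated by substituting
   u = 1/K(z) = z / R(z), which has no constant term, in [Hseries om]. *)
Definition free_cumulants (om : seq nat) (R : series int) : Prop :=
  R 0%N = 1 /\ scomp (Hseries om) (sdiv (svar int) R) =1 svar int.

(** * Kerov's character polynomials *)

(* In {mpoly A[k]} the variable 'X_j, j < k, stands for R_(j+2); thus the
   variables are R_2, ..., R_(k+1). *)

Definition is_kerov_poly (k : nat) (Sigma : {mpoly int[k]}) : Prop :=
  forall (N : nat) (om : seq nat), (k <= N)%N -> is_part_of N om ->
  forall R : series int, free_cumulants om R ->
  forall i : Iirr [set: 'S_N], specht_index om i ->
  forall s : 'S_N, cycle_type s = k :: nseq (N - k) 1%N ->
    normalized_char k i s = (Sigma.@[fun j : 'I_k => R j.+2])%:~R.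

(* Sum of the terms of weight w: [u^w] Sigma(R_2 u^2, ..., R_(k+1) u^(k+1)). *)
Definition weight_part (k w : nat) (Sigma : {mpoly int[k]}) : {mpoly int[k]} :=
  (mmap (fun c : int => (c%:MP_[k])%:P)
        (fun j : 'I_k => 'X_j *: 'X^(j.+2)) Sigma : {poly {mpoly int[k]}})`_w.

(** * The series C(t), P_m(t), P_la(t) over Q[R_2, ..., R_(k+1)] *)

Section KerovSeries.
Variable k : nat.
Local Notation QR := {mpoly rat[k]}.

(* R_i, with R_i = 0 outside 2 <= i <= k+1. Setting R_i = 0 for i > k+1 does not
   affect coefficients [t^r] with r <= k+1, as R_i comes with t^i in C(t). *)
Definition Rvar (i : nat) : QR :=
  if i is j.+2 then (if insub j is Some j' then 'X_(j' : 'I_k) else 0) else 0.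

Definition Cser : series QR :=
  sinv (ssub (sone QR) (fun i => Rvar i *+ i.-1)).

(* [Qser m] is C (D+(m-1)I) C ... (D+I) C D C, with m+1 factors C. *)
Fixpoint Qser (m : nat) : series QR :=
  if m is m'.+1 then
    smul Cser (sadd (sD (Qser m')) (sscale m'%:R (Qser m')))
  else Cser.

(* Meaningful for m >= 1 only. *)
Definition Pser (m : nat) : series QR :=
  sscale (- ((m`!)%:R^-1 : rat)%:MP_[k]) (Qser m.-1).

Definition Ppart (la : seq nat) : series QR :=
  \big[@smul QR/sone QR]_(m <- la) Pser m.

(* m_la(1, 2, ..., k-1, 0, 0, ...): the monomials of m_la in k-1 variables have
   as exponents the vectors whose nonzero entries are the parts of la. *)
Definition mhat (la : seq nat) : nat :=
  (\sum_(e : {ffun 'I_k.-1 -> 'I_(sumn la).+1} |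
          perm_eq [seq r <- [seq val (e j) | j : 'I_k.-1] | r != 0] la)
     \prod_(j < k.-1) j.+1 ^ e j)%N.

Definition kerov_sum (n : nat) : series QR :=
  fun r => \sum_(la <- parts_of (2 * n))
             sscale (mhat la)%:R (sdiv (Ppart la) Cser) r.

End KerovSeries.

(* Main.v *)
Require Import Defs.
From HB Require Import structures.
From mathcomp Require Import all_boot all_order all_algebra.
From mathcomp Require Import all_fingroup all_field all_character.
From mathcomp Require Import mpoly.
From mathcomp Require boolp.
From mathcomp Require Import ring zify.

(** The proof expresses the character of a k-cycle by a residue, writes the
   residue in terms of the free cumulants, and expands.

   Characters.  Let the partition have k distinct rows l_0 < ... < l_(k-1), and let
   nu_i = l_i + i.  For a composition al let theta_al be the permutation character
   of the colourings with content al.  The alternating sum over w in S_k of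
   theta_(nu - w) has norm 1 (frob_char_norm): counting pairs of colourings
   (sum_colourings_power_sum) turns the norm into a coefficient of a product of an
   alternant with det (h_(nu_i - j)), which the Jacobi-Trudi identity evaluates
   (det_Hmx).  The character theta_l of the term w = 1 is induced from the Young
   subgroup of the rows, and has a constituent in common with the sign character
   induced from that of the columns, while the other terms have none
   (shifted_not_injective, a dominance argument).  So the alternating sum is the
   irreducible character of the partition (specht_frob_char).  Its values are
   determinants of inverse factorials, hence Vandermonde products, and
   frob_char_cyc is Frobenius' formula.  By partial fractions
   (frobenius_sum_residue) the normalized character of a k-cycle is - 1/k times the
   coefficient of x^-1 in prod_(j < k) G(x - j), where G = 1 / H.

   Expansion.  Put x = R(t) / t; then G(x) = 1 / t by the definition of the free
   cumulants, and d/dx = - t C D.  Taylor's formula gives t G(x - j) =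
   sum_m (j t)^m P_m (formal_shift), and residues are invariant under the change
   of variable (residue_subst), so the normalized character is - 1/k times the
   coefficient of t^(k+1) in C^-1 prod_(0 < j < k) sum_m (j t)^m P_m.  Sorting the
   exponents of the product into partitions yields sum_la mhat_la P_la / C
   (prod_shift_series).

   From values to polynomials.  The identity is thus known at the free cumulants of
   all partitions with k long distinct rows.  These cumulants are polynomials in the
   row lengths, so the identity persists for row lengths in the algebraic numbers
   (mpoly_density); and every value of R_2, ..., R_(k+1) is attained there
   (cumulant_eqn_onto), so both sides are equal as polynomials
   (kerov_poly_sum).  The coefficient of t^r in P_la / C is homogeneous of
   weight r, so the terms with la a partition of 2n form the part of weight
   k + 1 - 2n. *)

Set Implicit Arguments.
Unset Strict Implicit.
Unset Printing Implicit Defensive.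

Import Order.TTheory GRing.Theory Num.Theory.

Local Open Scope ring_scope.

(** * The ring of formal power series *)

Section SeriesRing.
Variable A : comNzRingType.
Implicit Types f g h : series A.

(* Series are functions, so that equality and choice on them are classical. *)
HB.instance Definition _ := boolp.gen_eqMixin (series A).
HB.instance Definition _ := boolp.gen_choiceMixin (series A).

Lemma seriesP f g : f =1 g -> f = g.
Proof. exact: boolp.funext. Qed.

Definition szero : series A := fun=> 0.
Definition sopp f : series A := fun n => - f n.

Fact saddA : associative (@sadd A).
Proof. by move=> f g h; apply: seriesP => n; rewrite /sadd addrA. Qed.
Fact saddC : commutative (@sadd A).
Proof. by move=> f g; apply: seriesP => n; rewrite /sadd addrC. Qed.
Fact sadd0 : left_id szero (@sadd A).
Proof. by move=> f; apply: seriesP => n; rewrite /sadd add0r. Qed.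
Fact saddN : left_inverse szero sopp (@sadd A).
Proof. by move=> f; apply: seriesP => n; rewrite /sadd /sopp addNr. Qed.

HB.instance Definition _ := GRing.isZmodule.Build (series A) saddA saddC sadd0 saddN.

(** Modulo t^(N+1) a series is a polynomial, from which the ring axioms of the
   convolution product are inherited. *)
Definition strunc N f : {poly A} := \poly_(i < N.+1) f i.

Lemma coef_smul N f g n : (n <= N)%N ->
  smul f g n = (strunc N f * strunc N g)`_n.
Proof.
move=> leN; rewrite coefM /smul; apply: eq_bigr => i _.
have ilen : (i <= n)%N by rewrite -ltnS.
rewrite !coef_poly !ltnS (leq_trans ilen leN).
by rewrite (leq_trans (leq_subr _ _) leN).
Qed.

Fact smulA : associative (@smul A).
Proof.
move=> f g h; apply: seriesP => n.
transitivity ((strunc n f * (strunc n g * strunc n h))`_n).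
  rewrite coefM; apply: eq_bigr => i _.
  have ilen : (i <= n)%N by rewrite -ltnS.
  by rewrite coef_poly ltnS ilen (coef_smul g h (leq_subr i n)).
rewrite mulrA coefM; apply: eq_bigr => i _.
have ilen : (i <= n)%N by rewrite -ltnS.
by rewrite coef_poly ltnS leq_subr (coef_smul f g ilen).
Qed.
Fact smulC : commutative (@smul A).
Proof.
by move=> f g; apply: seriesP => n; rewrite !(coef_smul _ _ (leqnn n)) mulrC.
Qed.
Fact smul1 : left_id (@sone A) (@smul A).
Proof.
move=> f; apply: seriesP => n; rewrite /smul big_ord_recl /sone /= mul1r subn0.
by rewrite big1 ?addr0 // => i _; rewrite mul0r.
Qed.
Fact smulDl : left_distributive (@smul A) (@sadd A).
Proof.
move=> f g h; apply: seriesP => n; rewrite /smul /sadd -big_split /=.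
by apply: eq_bigr => i _; rewrite mulrDl.
Qed.
Fact sone_neq0 : @sone A != szero.
Proof. by apply/eqP => /(congr1 (@^~ 0%N)) /eqP; rewrite oner_eq0. Qed.

HB.instance Definition _ := GRing.Zmodule_isComNzRing.Build (series A)
  smulA smulC smul1 smulDl sone_neq0.

Lemma soneE : sone A = 1 :> series A. Proof. by []. Qed.
Lemma saddE f g : sadd f g = f + g. Proof. by []. Qed.
Lemma ssubE f g : ssub f g = f - g. Proof. by []. Qed.
Lemma smulE f g : smul f g = f * g. Proof. by []. Qed.
Lemma sexpE f n : sexp f n = f ^+ n.
Proof. by elim: n => [|n IH] //=; rewrite exprS -IH. Qed.

Lemma coefs0 n : (0 : series A) n = 0. Proof. by []. Qed.
Lemma coefs1 n : (1 : series A) n = (n == 0%N)%:R. Proof. by []. Qed.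
Lemma coefsD f g n : (f + g) n = f n + g n. Proof. by []. Qed.
Lemma coefsN f n : (- f) n = - f n. Proof. by []. Qed.
Lemma coefsB f g n : (f - g) n = f n - g n. Proof. by []. Qed.
Lemma coefsM f g n : (f * g) n = \sum_(i < n.+1) f i * g (n - i)%N.
Proof. by []. Qed.
Lemma coefs_sum I (r : seq I) (P : pred I) (F : I -> series A) n :
  (\sum_(i <- r | P i) F i) n = \sum_(i <- r | P i) F i n.
Proof. by elim/big_rec2: _ => // i x y _ <-. Qed.
Lemma coefsMn f m n : (f *+ m) n = f n *+ m.
Proof. by elim: m => [|m IH] //; rewrite !mulrS coefsD IH. Qed.
Lemma coefsM0 f g : (f * g) 0%N = f 0%N * g 0%N.
Proof. by rewrite coefsM big_ord1. Qed.
Lemma coefs_prod0 I (r : seq I) (P : pred I) (F : I -> series A) :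
  (\prod_(i <- r | P i) F i) 0%N = \prod_(i <- r | P i) F i 0%N.
Proof. by elim/big_rec2: _ => // i x y _ <-; rewrite coefsM0. Qed.
Lemma coefsX0 f n : (f ^+ n) 0%N = f 0%N ^+ n.
Proof. by elim: n => // n IH; rewrite !exprS coefsM0 IH. Qed.

Definition scst (a : A) : series A := fun n => a *+ (n == 0%N).

Fact scst_is_zmod : zmod_morphism scst.
Proof. by move=> a b; apply: seriesP => n; rewrite /scst mulrnBl. Qed.
Lemma coefs_cstM a f n : (scst a * f) n = a * f n.
Proof.
rewrite coefsM big_ord_recl subn0 big1 ?addr0 // => i _.
by rewrite /scst /= mulr0n mul0r.
Qed.
Fact scst_is_monoid : monoid_morphism scst.
Proof.
split; first by apply: seriesP => n; rewrite /scst.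
by move=> a b; apply: seriesP => n; rewrite coefs_cstM /scst mulrnAr.
Qed.
HB.instance Definition _ := GRing.isZmodMorphism.Build _ _ scst scst_is_zmod.
HB.instance Definition _ := GRing.isMonoidMorphism.Build _ _ scst scst_is_monoid.

Lemma sscaleE a f : sscale a f = scst a * f.
Proof. by apply: seriesP => n; rewrite coefs_cstM. Qed.

Local Notation X := (svar A).

Lemma coefsXM f n : (X * f) n = if n is m.+1 then f m else 0.
Proof.
rewrite coefsM; case: n => [|n].
  by rewrite big_ord1 /svar mul0r.
rewrite big_ord_recl /svar mul0r add0r big_ord_recl /= mul1r /bump subn1.
by rewrite big1 ?addr0 // => i _; rewrite mul0r.
Qed.

Lemma coefsXnM f m n : (X ^+ m * f) n = if (m <= n)%N then f (n - m)%N else 0.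
Proof.
elim: m n => [|m IH] n; first by rewrite mul1r subn0.
by rewrite exprS -mulrA coefsXM; case: n => // n; rewrite IH ltnS subSS.
Qed.

Definition eqmods n f g := forall i, (i < n)%N -> f i = g i.

Lemma eqmodsM n f f' g g' : eqmods n f f' -> eqmods n g g' ->
  eqmods n (f * g) (f' * g').
Proof.
move=> ef eg i lin; rewrite !coefsM; apply: eq_bigr => j _.
rewrite ef ?eg //; first by apply: leq_ltn_trans lin; apply: leq_subr.
by apply: leq_ltn_trans lin; rewrite -ltnS.
Qed.

Lemma eqmods_prod n I (r : seq I) (F G : I -> series A) :
  (forall i, eqmods n (F i) (G i)) ->
  eqmods n (\prod_(i <- r) F i) (\prod_(i <- r) G i).
Proof. by move=> e; elim/big_ind2: _ => // ? ? ? ?; apply: eqmodsM. Qed.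

Lemma eqmodsXn n f g m : eqmods n f g -> eqmods n (f ^+ m) (g ^+ m).
Proof. by move=> e; elim: m => // m IH; rewrite !exprS; apply: eqmodsM. Qed.

Lemma eqmods_divXn n f g : eqmods n f g -> exists h, f - g = X ^+ n * h.
Proof.
move=> e; exists (fun i => (f - g) (n + i)%N); apply: seriesP => i.
rewrite coefsXnM; case: leqP => [le|lt]; first by rewrite subnKC.
by rewrite coefsB e ?subrr.
Qed.

Lemma coefs_expr_lt f m n : f 0%N = 0 -> (n < m)%N -> (f ^+ m) n = 0.
Proof.
move=> f0 lt; have [h ->] : exists h, f = X * h.
  by rewrite -[X]expr1 -[f]subr0; apply: eqmods_divXn => -[].
by rewrite exprMn coefsXnM leqNgt lt.
Qed.

(** Any sufficiently long truncation of the geometric series may be used, which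
   gives a genuine ring element in place of a coefficientwise formula. *)
Lemma sinvE f N n : f 0%N = 1 -> (n <= N)%N ->
  sinv f n = (\sum_(j < N.+1) (1 - f) ^+ j) n.
Proof.
move=> f0 leN; rewrite /sinv coefs_sum.
rewrite (big_ord_widen_cond N.+1 xpredT (fun j => sexp (ssub (sone A) f) j n)) //.
rewrite [RHS](bigID (fun j : 'I_N.+1 => (j < n.+1)%N)) /= [X in _ + X]big1.
  by rewrite addr0; apply: eq_bigr => j _; rewrite sexpE.
move=> j; rewrite -leqNgt => lt; apply: coefs_expr_lt => //.
by rewrite coefsB f0 subrr.
Qed.

Lemma mulsV f : f 0%N = 1 -> f * sinv f = 1.
Proof.
move=> f0; apply: seriesP => n.
have -> : (f * sinv f) n = (f * \sum_(j < n.+1) (1 - f) ^+ j) n.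
  apply: (@eqmodsM n.+1) => // i; rewrite ltnS => lin.
  exact: sinvE.
have e : f * (\sum_(j < n.+1) (1 - f) ^+ j) = 1 - (1 - f) ^+ n.+1.
  have := subrXX 1 (1 - f) n.+1; rewrite expr1n subKr => ->; congr (_ * _).
  by apply: eq_bigr => i _; rewrite expr1n mul1r.
by rewrite e coefsB (@coefs_expr_lt (1 - f)) ?subr0 // coefsB f0 subrr.
Qed.

Lemma mulVs f : f 0%N = 1 -> sinv f * f = 1.
Proof. by rewrite mulrC; apply: mulsV. Qed.

Lemma sinv0 f : f 0%N = 1 -> sinv f 0%N = 1.
Proof. by move=> f0; move/(congr1 (@^~ 0%N)): (mulsV f0); rewrite coefsM0 f0 mul1r. Qed.

Lemma mulsI f g h : f 0%N = 1 -> f * g = f * h -> g = h.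
Proof. by move=> f0 /(congr1 ( *%R (sinv f))); rewrite !mulrA mulVs // !mul1r. Qed.

Lemma sdivE f g : sdiv f g = f * sinv g. Proof. by []. Qed.

Lemma eqmods_cancel n f g h : f 0%N = 1 -> eqmods n (f * g) (f * h) -> eqmods n g h.
Proof.
move=> f0 e; have := @eqmodsM n (sinv f) (sinv f) _ _ (fun _ _ => erefl) e.
by rewrite !mulrA mulVs // !mul1r.
Qed.

Fact sD_is_zmod : zmod_morphism (@sD A).
Proof. by move=> f g; apply: seriesP => n; rewrite /sD mulrnBl. Qed.
HB.instance Definition _ := GRing.isZmodMorphism.Build _ _ (@sD A) sD_is_zmod.

Lemma sDM f g : sD (f * g) = sD f * g + f * sD g.
Proof.
apply: seriesP => n; rewrite coefsD !coefsM /sD -sumrMnl -big_split /=.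
apply: eq_bigr => i _; rewrite mulrnAl mulrnAr -mulrnDr subnKC //.
by rewrite -ltnS.
Qed.

Lemma sD1 : sD (1 : series A) = 0.
Proof. by apply: seriesP => -[|n]; rewrite /sD coefs1 ?mulr0n ?mul0rn. Qed.
Lemma sD_cst a : sD (scst a) = 0.
Proof. by apply: seriesP => -[|n]; rewrite /sD /scst ?mulr0n ?mul0rn. Qed.
Lemma sDX : sD X = X.
Proof. by apply: seriesP => -[|[|n]]; rewrite /sD /svar ?mulr0n ?mul0rn. Qed.

Lemma sD_exp f n : sD (f ^+ n.+1) = f ^+ n * sD f *+ n.+1.
Proof.
elim: n => [|n IH]; first by rewrite mul1r mulr1n expr1.
by rewrite exprS sDM IH !exprS mulrnAr mulrC; ring.
Qed.

Lemma scompE f g N n : g 0%N = 0 -> (n <= N)%N ->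
  scomp f g n = (\sum_(j < N.+1) scst (f j) * g ^+ j) n.
Proof.
move=> g0 leN; rewrite /scomp coefs_sum.
rewrite (big_ord_widen_cond N.+1 xpredT (fun j => f j * sexp g j n)) //.
rewrite [RHS](bigID (fun j : 'I_N.+1 => (j < n.+1)%N)) /= [X in _ + X]big1.
  by rewrite addr0; apply: eq_bigr => j _; rewrite sexpE coefs_cstM.
move=> j; rewrite -leqNgt => lt; rewrite coefs_cstM coefs_expr_lt ?mulr0 //.
Qed.

End SeriesRing.

(** * Substitution and residues *)

Section Substitution.
Variable A : comNzRingType.
Implicit Types f g h : series A.

Lemma coefs_horner (p : {poly A}) g n : g 0%N = 0 ->
  (map_poly (@scst A) p).[g] n = \sum_(j < n.+1) p`_j * (g ^+ j) n.
Proof.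
move=> g0; rewrite (@horner_coef_wide _ (size p + n.+1)); last first.
  exact: leq_trans (size_poly _ _) (leq_addr _ _).
rewrite coefs_sum (big_ord_widen_cond (size p + n.+1) xpredT
  (fun j => p`_j * (g ^+ j) n)) ?leq_addl //.
rewrite (bigID (fun j : 'I_(size p + n.+1) => (j < n.+1)%N)) /= [X in _ + X]big1.
  by rewrite addr0; apply: eq_bigr => j _; rewrite coef_map coefs_cstM.
move=> j; rewrite -leqNgt => lt.
by rewrite coef_map coefs_cstM coefs_expr_lt ?mulr0.
Qed.

(** Up to order n substitution is the evaluation of any polynomial that agrees
   with f to that order: multiplicativity of substitution follows from it. *)
Lemma scomp_horner f g (p : {poly A}) n : g 0%N = 0 ->
  (forall i, (i <= n)%N -> p`_i = f i) ->
  scomp f g n = (map_poly (@scst A) p).[g] n.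
Proof.
move=> g0 e; rewrite coefs_horner // /scomp; apply: eq_bigr => j _.
by rewrite sexpE e // -ltnS.
Qed.

Lemma coef_strunc N f i : (i <= N)%N -> (strunc N f)`_i = f i.
Proof. by move=> le; rewrite coef_poly ltnS le. Qed.

Lemma scompM f h g : g 0%N = 0 -> scomp (f * h) g = scomp f g * scomp h g.
Proof.
move=> g0; apply: seriesP => n.
rewrite (@scomp_horner _ _ (strunc n f * strunc n h)) //; last first.
  by move=> i le; rewrite -(coef_smul _ _ le).
rewrite rmorphM hornerM; apply/esym.
by apply: (@eqmodsM _ n.+1) => // i; rewrite ltnS => le;
  apply: scomp_horner => // j lej; rewrite coef_strunc ?(leq_trans lej).
Qed.

Lemma scompB f h g : scomp (f - h) g = scomp f g - scomp h g.
Proof.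
apply: seriesP => n; rewrite /scomp coefsB -sumrB.
by apply: eq_bigr => j _; rewrite -mulrBl.
Qed.

Lemma scomp_cst a g : scomp (scst a) g = scst a.
Proof.
apply: seriesP => n; rewrite /scomp big_ord_recl big1 ?addr0.
  by rewrite sexpE /scst mulr1n expr0 coefs1 mulr_natr.
by move=> i _; rewrite /scst mulr0n mul0r.
Qed.

Lemma scomp1 g : scomp 1 g = 1.
Proof. by rewrite -[1 in LHS](rmorph1 (@scst A)) scomp_cst rmorph1. Qed.

Lemma scompX g : g 0%N = 0 -> scomp (svar A) g = g.
Proof.
move=> g0; apply: seriesP => -[|n]; rewrite /scomp.
  by rewrite big_ord1 /svar mul0r.
rewrite big_ord_recl /svar mul0r add0r big_ord_recl /= mul1r big1 ?addr0.
  by rewrite smulE soneE mulr1.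
by move=> i _; rewrite mul0r.
Qed.

Lemma scomp_prod I (r : seq I) (F : I -> series A) g : g 0%N = 0 ->
  scomp (\prod_(i <- r) F i) g = \prod_(i <- r) scomp (F i) g.
Proof.
move=> g0; elim/big_rec2: _ => [|i x y _ <-]; first exact: scomp1.
by rewrite scompM.
Qed.

Lemma scomp0 f g : scomp f g 0%N = f 0%N.
Proof. by rewrite /scomp big_ord1 /= mulr1. Qed.

Lemma scompV f g : g 0%N = 0 -> f 0%N = 1 -> scomp (sinv f) g = sinv (scomp f g).
Proof.
move=> g0 f0; apply: (@mulsI _ (scomp f g)); first by rewrite scomp0.
by rewrite -scompM // mulsV // scomp1 mulsV // scomp0.
Qed.

(** Invariance of residues under a change of variable.  With w = t / y and
   x = 1 / y(t), the left side is, up to sign, the residue in t of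
   V(1/x) x^n dx, and the right side is the residue of the same form in x.  By
   linearity V = u^j.  For j <= n and m = n + 1 - j what remains is that
   w^(m-1) (w - D w) has no term in t^m, because m w^(m-1) D w = D (w^m); for
   j = n + 1 it is the residue 1 of dt / t. *)
Lemma residue_subst (torsA : forall (x : A) m, x *+ m.+1 = 0 -> x = 0)
    n (V v w : series A) : w 0%N = 1 -> v * w = 1 ->
  (scomp V (svar A * v) * (w - sD w) * w ^+ n) n.+1 = V n.+1.
Proof.
move=> w0 vw; set y := _ * v.
have y0 : y 0%N = 0 by rewrite /y coefsXM.
have -> : (scomp V y * (w - sD w) * w ^+ n) n.+1 =
  ((\sum_(j < n.+2) scst (V j) * y ^+ j) * (w - sD w) * w ^+ n) n.+1.
  apply: (@eqmodsM _ n.+2) => //; apply: eqmodsM => // i; rewrite ltnS => le.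
  exact: scompE.
rewrite !mulr_suml coefs_sum big_ord_recr /= big1 ?add0r.
  rewrite -mulrA -mulrA coefs_cstM mulrA.
  have -> : y ^+ n.+1 * (w - sD w) * w ^+ n = svar A ^+ n.+1 * (v * (w - sD w)).
    have e : v ^+ n * w ^+ n = 1 by rewrite -exprMn vw expr1n.
    by rewrite exprMn -[RHS]mulr1 -e ![_ ^+ n.+1]exprS; ring.
  rewrite coefsXnM leqnn subnn coefsM0 coefsB /sD mulr0n subr0 -coefsM0 vw.
  by rewrite coefs1 mulr1.
move=> j _; rewrite -mulrA -mulrA coefs_cstM mulrA.
have lejn : (j <= n)%N by rewrite -ltnS.
set m := (n - j)%N.
have -> : y ^+ j * (w - sD w) * w ^+ n =
    svar A ^+ j * (w ^+ m.+1 - w ^+ m * sD w).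
  have -> : w ^+ n = w ^+ j * w ^+ m by rewrite -exprD subnKC.
  have e : v ^+ j * w ^+ j = 1 by rewrite -exprMn vw expr1n.
  rewrite exprMn -[RHS]mulr1 -e exprS; ring.
rewrite coefsXnM leqW // subSn // -/m.
have -> : (w ^+ m.+1 - w ^+ m * sD w) m.+1 = 0.
  apply: (torsA _ m); rewrite -coefsMn mulrnBl -sD_exp coefsB coefsMn /sD.
  exact: subrr.
by rewrite mulr0.
Qed.

(** A contraction for the t-adic metric has a fixed point: its n-th
   coefficient is stationary from the iterate n + 1 on. *)
Lemma series_fixpoint (Psi : series A -> series A) :
  (forall n f g, eqmods n f g -> eqmods n.+1 (Psi f) (Psi g)) ->
  exists f, Psi f = f.
Proof.
move=> contr.
have step n : eqmods n (iter n Psi 0) (iter n.+1 Psi 0).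
  by elim: n => [//|n IH]; apply: contr.
have mono n m : (n <= m)%N -> eqmods n (iter n Psi 0) (iter m Psi 0).
  elim: m => [|m IH]; first by rewrite leqn0 => /eqP ->.
  rewrite leq_eqVlt => /orP[/eqP -> //|le] i lin.
  by rewrite (IH le) //; apply: step; apply: leq_trans lin le.
exists (fun n => iter n.+1 Psi 0 n); apply: seriesP => n.
apply: (contr n) => // i lin.
by apply: mono lin i (ltnSn i).
Qed.

End Substitution.

Section MapSeries.
Variables (A B : comNzRingType) (phi : {rmorphism A -> B}).
Implicit Types f g : series A.

Definition smap f : series B := fun n => phi (f n).

Fact smap_is_zmod : zmod_morphism smap.
Proof. by move=> f g; apply: seriesP => n; rewrite /smap rmorphB. Qed.
Fact smap_is_monoid : monoid_morphism smap.
Proof.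
split; first by apply: seriesP => n; rewrite /smap coefs1 rmorph_nat.
move=> f g; apply: seriesP => n; rewrite /smap !coefsM rmorph_sum.
by apply: eq_bigr => i _; rewrite rmorphM.
Qed.
HB.instance Definition _ := GRing.isZmodMorphism.Build _ _ smap smap_is_zmod.
HB.instance Definition _ := GRing.isMonoidMorphism.Build _ _ smap smap_is_monoid.

Lemma smapX : smap (svar A) = svar B.
Proof. by apply: seriesP => n; rewrite /smap /svar rmorph_nat. Qed.
Lemma smap_cst a : smap (scst a) = scst (phi a).
Proof. by apply: seriesP => n; rewrite /smap /scst rmorphMn. Qed.
Lemma smapV f : f 0%N = 1 -> smap (sinv f) = sinv (smap f).
Proof.
move=> f0; have e : smap f 0%N = 1 by rewrite /smap f0 rmorph1.
by apply: (mulsI e); rewrite -rmorphM !mulsV // rmorph1.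
Qed.
Lemma smapD f : smap (sD f) = sD (smap f).
Proof. by apply: seriesP => n; rewrite /smap /sD rmorphMn. Qed.
Lemma smap_comp f g : smap (scomp f g) = scomp (smap f) (smap g).
Proof.
apply: seriesP => n; rewrite /smap /scomp rmorph_sum; apply: eq_bigr => j _.
by rewrite !sexpE rmorphM -[phi (_ n)]/(smap _ n) rmorphXn.
Qed.
End MapSeries.

(** * Taylor expansion of the shifts of G *)

(** This is sum_m (j t)^m P_m; it will be t G(x - j) for x = R(t) / t. *)
Definition shift_series (A : comNzRingType) (P : nat -> series A) (j : A) :
  series A := fun n => \sum_(m < n.+1) j ^+ m * P m (n - m)%N.

Section FormalShift.

Local Notation Qs := {poly rat}.
Local Notation t := (svar Qs).

Definition sderiv (f : series Qs) : series Qs := fun n => (f n)^`().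

Fact sderiv_is_zmod : zmod_morphism sderiv.
Proof. by move=> f g; apply: seriesP => n; rewrite /sderiv coefsB derivB. Qed.
HB.instance Definition _ := GRing.isZmodMorphism.Build _ _ sderiv sderiv_is_zmod.

Lemma sderivM (f g : series Qs) : sderiv (f * g) = sderiv f * g + f * sderiv g.
Proof.
apply: seriesP => n; rewrite /sderiv coefsD !coefsM raddf_sum -big_split /=.
by apply: eq_bigr => i _; rewrite derivM.
Qed.

Lemma sderiv_map (f : series rat) : sderiv (smap polyC f) = 0.
Proof. by apply: seriesP => n; rewrite /sderiv derivC. Qed.

Lemma poly_deriv0 (p : Qs) : p^`() = 0 -> p.[0] = 0 -> p = 0.
Proof.
move=> dp p0; apply/polyP => -[|i]; first by rewrite -horner_coef0 p0 coef0.
move/polyP/(_ i): dp; rewrite coef_deriv coef0 => /eqP.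
by rewrite coef0 -mulr_natr mulf_eq0 pnatr_eq0 orbF => /eqP.
Qed.

Variables (R : series rat) (P : nat -> series rat).
Hypothesis R0 : R 0%N = 1.

Let C := sinv (R - sD R).
Hypothesis P0 : P 0%N = 1.
Hypothesis PS : forall m, P m.+1 *+ m.+1 = C * (sD (P m) + P m *+ m - P m).

Let RR : series Qs := smap polyC R.
Let CC : series Qs := smap polyC C.
Let L (c : rat) : series Qs := RR + scst (c%:P - 'X) * t.
Let EE : series Qs :=
  fun n => \sum_(m < n.+1) 'X^m * (P m (n - m)%N)%:P.

(** The derivation d/ds - t C D annihilates every function of R(t)/t - s;
   eig a f says that f is an eigenvector of it with eigenvalue a. *)
Let eig (a f : series Qs) := sderiv f - t * CC * sD f = a * f.

Let eigM a b f g : eig a f -> eig b g -> eig (a + b) (f * g).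
Proof.
rewrite /eig => ef eg; rewrite sderivM sDM.
transitivity ((sderiv f - t * CC * sD f) * g + f * (sderiv g - t * CC * sD g)).
  by ring.
by rewrite ef eg; ring.
Qed.

Let eig1 : eig 0 1.
Proof.
rewrite /eig sD1 !mulr0 subr0 mul0r; apply: seriesP => -[|n];
by rewrite /sderiv coefs1 ?derivC // raddf0.
Qed.

Let eig_prod n (F : 'I_n -> series Qs) a : (forall i, eig a (F i)) ->
  eig (a *+ n) (\prod_i F i).
Proof.
move=> e; rewrite -[n in _ *+ n]card_ord -sumr_const.
by elim/big_rec2: _ => // i x y _; apply: eigM.
Qed.

Let CCK : CC * (RR - sD RR) = 1.
Proof.
rewrite /CC /RR -smapD -!rmorphB -rmorphM mulVs ?rmorph1 //.
by rewrite coefsB /sD mulr0n subr0.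
Qed.

(** L c = t (x + c - s), where the second factor is annihilated and t has
   eigenvalue - t C. *)
Let eigL c : eig (- (t * CC)) (L c).
Proof.
rewrite /eig /L [sderiv (_ + _)]raddfD [sD (_ + _)]raddfD /= sderivM sderiv_map sDM sDX sD_cst.
have -> : sderiv (scst (c%:P - 'X)) = -1.
  apply: seriesP => -[|n]; rewrite /sderiv /scst coefsN coefs1 /=.
    by rewrite !mulr1n raddfB /= derivC derivX sub0r.
  by rewrite !mulr0n raddf0 oppr0.
have -> : sderiv t = 0.
  apply: seriesP => n; rewrite /sderiv /svar.
  by case: (n == 1%N); rewrite ?derivC // raddf0.
rewrite add0r mulr0 mul0r add0r addr0 mulN1r.
transitivity (- t * (CC * (RR - sD RR)) - t * CC * (sD RR + scst (c%:P - 'X) * t)).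
  by rewrite CCK mulr1.
by ring.
Qed.

Let eigE : eig (- (t * CC)) EE.
Proof.
apply: (@addrI _ (t * CC * sD EE)); rewrite addrCA subrr addr0.
rewrite mulNr -mulrBr -mulrA; apply: seriesP => -[|n].
  by rewrite coefsXM /sderiv /EE big_ord1 expr0 mul1r derivC.
rewrite coefsXM /sderiv /EE raddf_sum big_ord_recl /=.
rewrite expr0 mul1r derivC add0r.
transitivity (\sum_(m < n.+1)
    'X^m * (CC * (smap polyC (sD (P m) + P m *+ m - P m))) (n - m)%N).
  apply: eq_bigr => m _; rewrite /CC -rmorphM /smap -PS /= /bump /= add1n subSS.
  by rewrite coefsMn derivM derivXn /= derivC mulr0 addr0 mulrnAl polyCMn mulrnAr.
transitivity (\sum_(m < n.+1) \sum_(i < n.+1 | (m + i <= n)%N)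
   CC i * ('X^m * (smap polyC (sD (P m) + P m *+ m - P m)) (n - (m + i))%N)).
  apply: eq_bigr => m _; rewrite coefsM mulr_sumr.
  rewrite (big_ord_widen_cond n.+1 xpredT (fun i => 'X^m * (CC i *
    smap polyC (sD (P m) + P m *+ m - P m) (n - m - i)%N))) ?ltnS ?leq_subr //.
  apply: eq_big => [i|i _]; last by rewrite mulrCA subnDA.
  by rewrite ltnS leq_subRL // -ltnS.
rewrite (exchange_big_dep xpredT) //= coefsM; apply: eq_bigr => i _.
rewrite -mulr_sumr; congr (_ * _); rewrite coefsB /sD /EE.
have leni : (n - i < n.+1)%N by rewrite ltnS leq_subr.
rewrite -sumrMnl -sumrB (big_ord_widen_cond n.+1 xpredT (fun m =>
  ('X^m * (P m (n - i - m)%N)%:P) *+ (n - i) - 'X^m * (P m (n - i - m)%N)%:P)) //.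
apply: eq_big => [m|m].
  by rewrite ltnS leq_subRL 1?addnC // -ltnS.
move=> lemi; rewrite subnDA subnAC /smap coefsB coefsD coefsMn /sD.
rewrite -mulrnDr subnK; last by rewrite leq_subRL // -1?ltnS // addnC.
by rewrite polyCB polyCMn mulrBr mulrnAr.
Qed.

(** Taylor's formula for G(x - s), where x = R(t)/t and d/dx = - t C D.  Each
   linear factor L = R + (c - s) t satisfies d/ds L - t C D L = - t C L, and so
   does sum_m s^m t^m P_m: the numerator and the product of the latter with the
   denominator obey the same first order equation in s, and they agree at
   s = 0. *)
Lemma formal_shift l (b : 'I_l -> rat) n :
  eqmods n ((R + scst l%:R * svar rat) * \prod_i (R - scst (b i + 1) * svar rat))
    (\prod_i (R - scst (b i) * svar rat)) ->
  forall j : rat,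
  eqmods n ((R + scst (l%:R - j) * svar rat) *
              \prod_i (R - scst (b i + 1 + j) * svar rat))
    (shift_series P j * \prod_i (R - scst (b i + j) * svar rat)).
Proof.
move=> init j.
pose d := L l%:R * \prod_i L (- (b i + 1)) - EE * \prod_i L (- b i).
have mapL c s : smap (horner_eval s) (L c) = R + scst (c - s) * svar rat.
  rewrite /L rmorphD rmorphM /= smapX smap_cst /=.
  have -> : horner_eval s (c%:P - 'X) = c - s.
    by rewrite /horner_eval hornerD hornerN hornerC hornerX.
  congr (_ + _); apply: seriesP => i.
  exact: hornerC.
have mapLN c s : smap (horner_eval s) (L (- c)) = R - scst (c + s) * svar rat.
  by rewrite mapL -mulNr -rmorphN opprD.
have mapE s : smap (horner_eval s) EE = shift_series P s.
  apply: seriesP => i; rewrite -[LHS]/((EE i).[s]) /EE horner_sum.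
  by apply: eq_bigr => m _; rewrite hornerM hornerXn hornerC.
have mapd s : smap (horner_eval s) d =
    (R + scst (l%:R - s) * svar rat) * \prod_i (R - scst (b i + 1 + s) * svar rat)
    - shift_series P s * \prod_i (R - scst (b i + s) * svar rat).
  rewrite /d rmorphB !rmorphM /= mapL mapE !rmorph_prod.
  by congr (_ * _ - _ * _); apply: eq_bigr => i _; rewrite -mapLN.
have d0 i : (i < n)%N -> (d i).[0] = 0.
  move=> lin; rewrite -[LHS]/(smap (horner_eval 0) d i) mapd coefsB.
  have -> : shift_series P 0 = 1.
    apply: seriesP => m; rewrite /shift_series big_ord_recl subn0 P0 big1 ?addr0.
      by rewrite mul1r.
    by move=> o _; rewrite exprS !mul0r.
  rewrite subr0 mul1r; apply/eqP; rewrite subr_eq0; apply/eqP.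
  under eq_bigr do rewrite addr0; under [in RHS]eq_bigr do rewrite addr0.
  exact: init.
have eigd : eig (- (t * CC) *+ l.+1) d.
  have e1 := eigM (eigL l%:R) (eig_prod (fun i => eigL (- (b i + 1)))).
  have e2 := eigM eigE (eig_prod (fun i => eigL (- b i))).
  rewrite /eig in e1 e2.
  by rewrite /eig /d [sderiv (_ - _)]raddfB [sD (_ - _)]raddfB [RHS]mulrBr mulrS -e1 -e2; ring.
have dz i : (i < n)%N -> d i = 0.
  elim/ltn_ind: i => i IH lin; apply: poly_deriv0; last exact: d0.
  have := congr1 (@^~ i) eigd; rewrite /= coefsB mulrnAl mulNr -!mulrA coefsMn coefsN.
  have z f : (forall m, (m < i)%N -> f m = 0) -> (t * (CC * f)) i = 0.
    move=> f0; rewrite coefsXM; case: i f0 {IH lin} => // i f0; rewrite coefsM.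
    by rewrite big1 // => m _; rewrite f0 ?mulr0 // ltnS leq_subr.
  rewrite z => [|m lt]; last by rewrite /sD IH ?mul0rn // (ltn_trans lt).
  by rewrite subr0 z ?oppr0 ?mul0rn // => m lt; rewrite IH // (ltn_trans lt).
move=> i lin; apply/eqP; rewrite -subr_eq0 -coefsB -mapd /smap dz //.
by rewrite rmorph0.
Qed.

End FormalShift.

(** * Residues of products of shifts *)

Lemma rat_torsion_free (x : rat) m : x *+ m.+1 = 0 -> x = 0.
Proof. by move/eqP; rewrite mulrn_eq0 => /eqP. Qed.

Section ShiftResidue.
Variables (R : series rat) (P : nat -> series rat).
Hypothesis R0 : R 0%N = 1.
Let C := sinv (R - sD R).
Hypothesis P0 : P 0%N = 1.
Hypothesis PS : forall m, P m.+1 *+ m.+1 = C * (sD (P m) + P m *+ m - P m).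
Local Notation t := (svar rat).

(** The substitution x = z + l, z = R(t) / t, is performed in the residue of
   prod_(j < k) G(z - j), for G(z) = (z + l) prod (z - b_i - 1) / (z - b_i).
   The product telescopes to prod_(j < k) (x - j) prod (x - nu_i - k) / (x -
   nu_i), with nu_i = b_i + l, which is the left side in the variable u = 1 /
   x; on the right each factor has been replaced by its Taylor expansion. *)
Lemma shift_residue l (b : 'I_l -> rat) k :
  eqmods k.+2 ((R + scst l%:R * t) * \prod_i (R - scst (b i + 1) * t))
    (\prod_i (R - scst (b i) * t)) ->
  (\prod_(j < k) (1 - scst j%:R * t)
   * \prod_i ((1 - scst (b i + l%:R + k%:R) * t)
              * sinv (1 - scst (b i + l%:R) * t))) k.+1
  = ((R - sD R) * \prod_(j < k) shift_series P j%:R) k.+1.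
Proof.
move=> init; pose w : series rat := R + scst l%:R * t.
have cX0 a : (scst a * t) 0%N = 0 by rewrite coefs_cstM mulr0.
have w0 : w 0%N = 1 by rewrite /w coefsD R0 cX0 addr0.
pose v := sinv w; have vw : v * w = 1 by apply: mulVs.
rewrite -(@residue_subst _ rat_torsion_free k _ v w) //.
have y0 : (t * v) 0%N = 0 by rewrite coefsM0 mul0r.
have -> : w - sD w = R - sD R.
  rewrite /w [sD (_ + _)]raddfD /= sDM sD_cst sDX; ring.
rewrite mulrAC mulrC; apply: (@eqmodsM _ k.+2) => //.
pose M (j : rat) := \prod_i (R - scst (b i + j) * t).
have M00 : M 0 0%N = 1.
  by rewrite /M coefs_prod0 big1 // => i _; rewrite coefsB R0 cX0 subr0.
apply: (eqmods_cancel M00).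
have tel n : eqmods k.+2 (\prod_(j < n) (R + scst (l%:R - j%:R) * t) * M n%:R)
    (\prod_(j < n) shift_series P j%:R * M 0).
  elim: n => [|n IH]; first by rewrite !big_ord0.
  rewrite !big_ord_recr /=.
  have := formal_shift R0 P0 PS init n%:R.
  have -> : \prod_i (R - scst (b i + 1 + n%:R) * t) = M n.+1%:R.
    by apply: eq_bigr => i _; rewrite -addrA nat1r.
  rewrite -[X in shift_series P _ * X]/(M n%:R) => e i lin.
  set p := \prod_(j < n) _; set q := \prod_(j < n) _.
  transitivity ((p * (shift_series P n%:R * M n%:R)) i).
    by rewrite -mulrA; apply: (@eqmodsM _ k.+2).
  rewrite mulrCA [in RHS]mulrAC [in RHS]mulrC.
  exact: (@eqmodsM _ k.+2).
move=> i lin; rewrite [in RHS]mulrC -(tel k i lin); congr ((_ : series rat) i) => {i lin}.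
rewrite scompM // !scomp_prod //.
have sc1 a : (scomp (1 - scst a * t) (t * v)) * w = w - scst a * t.
  rewrite scompB scomp1 scompM // scomp_cst scompX // mulrBl mul1r.
  by rewrite -!mulrA vw mulr1.
have -> : \prod_(j < k) scomp (1 - scst j%:R * t) (t * v) =
    v ^+ k * \prod_(j < k) (R + scst (l%:R - j%:R) * t).
  rewrite -[k in v ^+ k]card_ord -prodr_const -big_split /=; apply: eq_bigr => j _.
  apply: (mulsI w0); rewrite mulrC sc1 mulrA [w * v]mulrC vw mul1r /w.
  by rewrite rmorphB; ring.
have -> : M 0 = w ^+ l * \prod_i scomp (1 - scst (b i + l%:R) * t) (t * v).
  rewrite -[l in w ^+ l]card_ord -prodr_const -big_split /=; apply: eq_bigr => j _.
  by rewrite [RHS]mulrC sc1 /w !rmorphD rmorph0 addr0; ring.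
have -> : M k%:R = w ^+ l * \prod_i scomp (1 - scst (b i + l%:R + k%:R) * t) (t * v).
  rewrite -[l in w ^+ l]card_ord -prodr_const -big_split /=; apply: eq_bigr => j _.
  by rewrite [RHS]mulrC sc1 /w !rmorphD; ring.
have vwk : v ^+ k * w ^+ k = 1 by rewrite -exprMn vw expr1n.
have -> : \prod_i scomp ((1 - scst (b i + l%:R + k%:R) * t) *
     sinv (1 - scst (b i + l%:R) * t)) (t * v) =
  (\prod_i scomp (1 - scst (b i + l%:R + k%:R) * t) (t * v)) *
  (\prod_i sinv (scomp (1 - scst (b i + l%:R) * t) (t * v))).
  rewrite -big_split /=; apply: eq_bigr => i _.
  by rewrite scompM // scompV // coefsB cX0 subr0.
have inv : (\prod_i scomp (1 - scst (b i + l%:R) * t) (t * v)) *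
  (\prod_i sinv (scomp (1 - scst (b i + l%:R) * t) (t * v))) = 1.
  rewrite -big_split /= big1 // => i _; apply: mulsV.
  by rewrite scomp0 coefsB cX0 subr0.
move: inv; set d := \prod_i scomp _ _; set e := \prod_i sinv _ => inv.
set c := \prod_i scomp _ _; set a := \prod_(j < k) _.
transitivity (w ^+ l * (d * e) * (v ^+ k * w ^+ k) * a * c); first ring.
by rewrite inv vwk; ring.
Qed.

End ShiftResidue.

Section FrobeniusSum.
Local Notation u := (svar rat).

(** Beyond the degree of the numerator the quotient behaves as a geometric
   series whose coefficient is the value of the reversed numerator. *)
Lemma coefs_lin_prod_geom (s : seq rat) (x : rat) m : (size s <= m)%N ->
  ((\prod_(a <- s) (1 - scst a * u)) * sinv (1 - scst x * u)) m
  = x ^+ (m - size s) * \prod_(a <- s) (x - a).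
Proof.
have c0 : (1 - scst x * u) 0%N = 1 by rewrite coefsB coefs_cstM mulr0 subr0.
elim: s m => [|a s IH] m /=.
  rewrite !big_nil mul1r mulr1 subn0 => _; elim: m => [|m IH].
    exact: sinv0.
  have := congr1 (@^~ m.+1) (mulsV c0); rewrite mulrBl mul1r -mulrA coefsB /=.
  rewrite coefs_cstM coefsXM IH coefs1 => /eqP.
  by rewrite subr_eq0 exprS => /eqP ->.
case: m => // m; rewrite ltnS => le; rewrite !big_cons.
rewrite -mulrA mulrBl mul1r coefsB -mulrA coefs_cstM coefsXM !IH ?leqW //.
by rewrite subSS subSn // exprS; ring.
Qed.

Variables (l : nat) (nu : 'I_l -> rat).
Hypothesis nu_inj : injective nu.
Hypothesis nu_neq0 : forall i, nu i != 0.

Let phi' i := \prod_(j < l | j != i) (nu i - nu j).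

Let phi'_neq0 i : phi' i != 0.
Proof.
apply/prodf_neq0 => j ji; rewrite subr_eq0; apply: contra ji => /eqP e.
by rewrite (nu_inj e).
Qed.

(** Lagrange interpolation of u^(l-1) at the points 1 / nu_i. *)
Lemma lagrange_reversed : (0 < l)%N ->
  'X^(l.-1) = \sum_i (phi' i)^-1 *: \prod_(j < l | j != i) (1 - (nu j) *: 'X)
  :> {poly rat}.
Proof.
move=> l0; apply/eqP; rewrite -subr_eq0; set q := _ - _; apply/negPn/negP => q0.
have szlin (c : rat) : (size (1 - c *: 'X)%R <= 2)%N.
  rewrite (leq_trans (size_polyD _ _)) // geq_max size_poly1 size_polyN.
  by rewrite (leq_trans (size_scale_leq _ _)) ?size_polyX.
have szprod i : (size (\prod_(j < l | j != i) (1 - nu j *: 'X))%R <= l)%N.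
  apply: (leq_trans (size_poly_prod_leq _ _)).
  have : (\sum_(j < l | j != i) size (1 - nu j *: 'X)%R <= \sum_(j < l | j != i) 2)%N.
    by apply: leq_sum.
  rewrite sum_nat_const; move: (cardC1 i) => /= ; rewrite card_ord => ->.
  by lia.
have szq : (size q <= l)%N.
  rewrite (leq_trans (size_polyD _ _)) // geq_max size_polyXn prednK // leqnn /=.
  rewrite size_polyN (leq_trans (size_sum _ _ _)) //; apply/bigmax_leqP => i _.
  by rewrite (leq_trans (size_scale_leq _ _)).
have roots : all (root q) [seq (nu i)^-1 | i <- enum 'I_l].
  apply/allP => _ /mapP[i _ ->]; rewrite /root /q hornerD hornerN hornerXn.
  rewrite horner_sum (bigD1 i) //= [X in _ - (_ + X)]big1 ?addr0.
    rewrite hornerZ horner_prod subr_eq0 exprVn.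
    have -> : phi' i = nu i ^+ l.-1 *
       \prod_(j < l | j != i) (1 - nu j *: 'X).[(nu i)^-1].
      move: (cardC1 i) => /=; rewrite card_ord => <-; rewrite -prodr_const.
      rewrite -big_split /=; apply: eq_big => j //; rewrite ?inE // => ji.
      rewrite !hornerE mulrBr mulr1 mulrCA divff ?mulr1 //.
    rewrite invfM mulfVK //; apply/prodf_neq0 => j ji.
    rewrite !hornerE subr_eq0 eq_sym; apply: contra ji => /eqP e.
    by apply/eqP/nu_inj; rewrite -[LHS](mulfVK (nu_neq0 i)) e mul1r.
  move=> j ji; rewrite hornerZ horner_prod (bigD1 i) 1?eq_sym //=.
  have -> : (1 - nu i *: 'X).[(nu i)^-1] = 0 by rewrite !hornerE divff ?subrr.
  by rewrite mul0r mulr0.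
have uq : uniq [seq (nu i)^-1 | i <- enum 'I_l].
  by rewrite map_inj_uniq ?enum_uniq // => i j /invr_inj /nu_inj.
have := max_poly_roots q0 roots uq; rewrite size_map size_enum_ord.
by rewrite ltnNge szq.
Qed.

(** Partial fractions: the sum of T(nu_i) / phi'(nu_i), for a polynomial T with
   roots s and phi with roots nu, is the coefficient of x^-1 in T / phi. *)
Lemma frobenius_sum_residue (s : seq rat) k : (0 < l)%N -> size s = (k + l)%N ->
  \sum_i (\prod_(a <- s) (nu i - a)) / \prod_(j < l | j != i) (nu i - nu j) =
  ((\prod_(a <- s) (1 - scst a * u)) * \prod_i sinv (1 - scst (nu i) * u)) k.+1.
Proof.
move=> l0 szs.
have c0 x : (1 - scst x * u) 0%N = 1 by rewrite coefsB coefs_cstM mulr0 subr0.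
have pf : u ^+ l.-1 * \prod_i sinv (1 - scst (nu i) * u) =
    \sum_i scst (phi' i)^-1 * sinv (1 - scst (nu i) * u).
  have invp : (\prod_i (1 - scst (nu i) * u)) * (\prod_i sinv (1 - scst (nu i) * u)) = 1.
    by rewrite -big_split /= big1 // => i _; apply: mulsV.
  have -> : u ^+ l.-1 =
      \sum_i scst (phi' i)^-1 * \prod_(j < l | j != i) (1 - scst (nu j) * u).
    pose f : {rmorphism {poly rat} -> series rat} := horner_morph (fun x => mulrC u (scst x)).
    have fX : f 'X = u by rewrite /f /= horner_morphX.
    have fC c : f c%:P = scst c by rewrite /f /= horner_morphC.
    rewrite -fX -rmorphXn (lagrange_reversed l0) rmorph_sum; apply: eq_bigr => i _.
    rewrite -mul_polyC rmorphM /= fC rmorph_prod; congr (_ * _).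
    by apply: eq_bigr => j _; rewrite rmorphB rmorph1 -mul_polyC rmorphM /= fC fX.
  rewrite mulr_suml; apply: eq_bigr => i _.
  rewrite -mulrA; congr (_ * _); rewrite [X in _ * X](bigD1 i) //= mulrCA.
  rewrite -big_split /= big1 ?mulr1 // => j _; exact: mulsV.
transitivity ((\prod_(a <- s) (1 - scst a * u) *
   (u ^+ l.-1 * \prod_i sinv (1 - scst (nu i) * u))) (k + l)%N).
  rewrite pf mulr_sumr coefs_sum; apply: eq_bigr => i _.
  by rewrite mulrCA coefs_cstM coefs_lin_prod_geom ?szs // subnn mul1r mulrC.
rewrite mulrCA coefsXnM; case: leqP => h; last by lia.
by congr (_ _); lia.
Qed.

End FrobeniusSum.

(** * Expansion over exponent vectors and partitions *)

Section SeriesProducts.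
Variable A : comNzRingType.

Lemma coefs_prod (I : finType) (F : I -> series A) d N : (d <= N)%N ->
  (\prod_i F i) d =
  \sum_(e : {ffun I -> 'I_N.+1} | (\sum_i e i == d)%N) \prod_i F i (e i).
Proof.
move=> ledN; have -> : (\prod_i F i) d =
    (\prod_i \sum_(m < N.+1) scst (F i m) * svar A ^+ m) d.
  apply: (@eqmods_prod _ N.+1) => // i n led; rewrite coefs_sum.
  rewrite (bigD1 (Ordinal led)) //= coefs_cstM -[_ ^+ n]mulr1 coefsXnM leqnn subnn.
  rewrite mulr1 big1 ?addr0 // => m; rewrite -val_eqE /= => nm.
  rewrite coefs_cstM -[_ ^+ m]mulr1 coefsXnM; case: leqP => h; last by rewrite mulr0.
  by rewrite coefs1 subn_eq0 leqNgt ltn_neqAle nm h mulr0.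
rewrite bigA_distr_bigA coefs_sum [RHS]big_mkcond; apply: eq_bigr => e _.
rewrite big_split /= -rmorph_prod coefs_cstM -expr_sum.
rewrite -[_ ^+ _]mulr1 coefsXnM coefs1.
have [lt|le|->] := ltngtP (\sum_i e i)%N d; rewrite ?mulr0 ?subnn ?mulr1 //.
by rewrite -leqn0 leqNgt subn_gt0 lt mulr0.
Qed.

(** The substitution u := t in a series in u with coefficients in A[[t]]. *)
Definition sdiag (f : series (series A)) : series A :=
  fun n => \sum_(m < n.+1) f m (n - m)%N.

(** Evaluation of a polynomial over A[[t]] at t only involves, in degree n, the
   coefficients up to n: so it extends to all series. *)
Lemma coefs_hornerX (p : {poly (series A)}) n :
  p.[svar A] n = \sum_(j < n.+1) p`_j (n - j)%N.
Proof.
rewrite (@horner_coef_wide _ (size p + n.+1)) ?leq_addr // coefs_sum.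
rewrite (big_ord_widen_cond (size p + n.+1) xpredT
  (fun j => p`_j (n - j)%N)) ?leq_addl // [RHS]big_mkcond /=.
by apply: eq_bigr => j _; rewrite mulrC coefsXnM ltnS.
Qed.

Lemma sdiag_horner f (p : {poly (series A)}) n :
  (forall i, (i <= n)%N -> p`_i = f i) -> sdiag f n = p.[svar A] n.
Proof.
move=> e; rewrite coefs_hornerX; apply: eq_bigr => j _.
by rewrite e // -ltnS.
Qed.

Lemma sdiagM f g : sdiag (f * g) = sdiag f * sdiag g.
Proof.
apply: seriesP => n.
rewrite (@sdiag_horner _ (strunc n f * strunc n g)); last first.
  by move=> i le; rewrite -(coef_smul _ _ le).
rewrite hornerM; apply/esym.
by apply: (@eqmodsM _ n.+1) => // i; rewrite ltnS => le;
  apply: sdiag_horner => j lej; rewrite coef_strunc ?(leq_trans lej).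
Qed.

Lemma sdiag_cst a : sdiag (scst a) = a.
Proof.
apply: seriesP => n; rewrite /sdiag big_ord_recl big1 ?addr0 ?subn0 //.
Qed.

Lemma sdiag1 : sdiag 1 = 1.
Proof. by rewrite -(rmorph1 (@scst (series A))) sdiag_cst. Qed.

Lemma sdiag_prod I (r : seq I) (F : I -> series (series A)) :
  sdiag (\prod_(i <- r) F i) = \prod_(i <- r) sdiag (F i).
Proof.
elim/big_rec2: _ => [|i x y _ <-]; [exact: sdiag1 | exact: sdiagM].
Qed.

Lemma coefs_mul_sdiag (g : series A) f n :
  (g * sdiag f) n = \sum_(d < n.+1) (g * f d) (n - d)%N.
Proof.
rewrite -[g in LHS](sdiag_cst g) -sdiagM; apply: eq_bigr => d _.
by rewrite coefs_cstM.
Qed.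

End SeriesProducts.

Section Partitions.

Local Notation nz s := [seq r <- s | r != 0%N].

Lemma geq_trans : transitive geq.
Proof. by move=> y x z /= yx zy; apply: leq_trans yx. Qed.

(** Erasing the zeros of a weakly decreasing sequence of known length loses
   nothing; hence a partition occurs only once in parts_of. *)
Lemma sorted_geq_nz s : sorted geq s -> s = nz s ++ nseq (size s - size (nz s)) 0%N.
Proof.
elim: s => //= a s IH ps; case: eqP => [a0|_] /=; last first.
  by rewrite subSS -IH // (path_sorted ps).
have z : all (pred1 0%N) s.
  move: ps; rewrite a0 (path_sortedE geq_trans) => /andP[/allP h _].
  by apply/allP => x /h /=; rewrite leqn0.
have -> : nz s = [::].
  by apply/eqP; rewrite -[_ == _]negbK -has_filter; apply/hasPn => x /(allP z) /= ->.
by rewrite subn0 /= a0; congr cons; apply/all_pred1P.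
Qed.

Lemma sumn_nz s : sumn (nz s) = sumn s.
Proof. by elim: s => //= a s IH; case: eqP => [->|_] /=; rewrite IH. Qed.

Lemma sorted_geq_sort s : sorted geq (sort geq s).
Proof. by apply: sort_sorted => x y; exact: leq_total. Qed.

Lemma sorted_geq_eq s1 s2 : sorted geq s1 -> sorted geq s2 -> perm_eq s1 s2 -> s1 = s2.
Proof.
apply: sorted_eq; first exact: geq_trans.
by move=> x y; rewrite andbC => /anti_leq.
Qed.

Lemma size_le_sumn s : 0%N \notin s -> (size s <= sumn s)%N.
Proof.
elim: s => //= a s IH; rewrite inE negb_or eq_sym -lt0n => /andP[a0 /IH].
by move=> h; rewrite -add1n leq_add.
Qed.

Lemma mem_parts_of N la : (la \in parts_of N) = is_part_of N la.
Proof.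
apply/imageP/and3P => [[t]|[sla nla /eqP sumla]].
  rewrite inE => /andP[st /eqP sumt] ->; split.
  - by apply: sorted_filter => //; exact: geq_trans.
  - by rewrite mem_filter.
  - by rewrite sumn_nz sumt.
pose s := la ++ nseq (N - size la) 0%N.
have szs : size s == N.
  by rewrite size_cat size_nseq subnKC // -sumla size_le_sumn.
have sums : sumn s = N by rewrite sumn_cat sumn_nseq mul0n addn0.
have les x : x \in s -> (x < N.+1)%N.
  rewrite ltnS -sums; elim: (s) => //= a r IH; rewrite inE => /orP[/eqP ->|/IH].
    exact: leq_addr.
  by move/leq_trans; apply; apply: leq_addl.
pose t : seq 'I_N.+1 := [seq inord x | x <- s].
have szt : size t == N by rewrite size_map.
have tE : [seq val j | j <- t] = s.
  by rewrite -map_comp map_id_in // => x /les lt /=; rewrite inordK.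
have nzs : nz s = la.
  rewrite filter_cat (_ : nz (nseq _ _) = [::]) ?cats0.
    by apply/all_filterP/allP => x xla; apply: contraNneq nla => <-.
  by apply/eqP; rewrite -[_ == _]negbK -has_filter; apply/hasPn => x /nseqP[-> _].
exists (Tuple szt); rewrite ?inE /= tE ?nzs // sums eqxx andbT.
move: sla; rewrite !(sorted_pairwise geq_trans) pairwise_cat => ->.
apply/andP; split; first by apply/allrelP => x y _ /nseqP[->].
by rewrite -(sorted_pairwise geq_trans); elim: (N - _)%N => //= -[|m].
Qed.

Lemma parts_of_uniq N : uniq (parts_of N).
Proof.
rewrite map_inj_in_uniq ?enum_uniq // => t1 t2.
rewrite !mem_enum !inE => /andP[s1 _] /andP[s2 _] e.
have szt (t : N.-tuple 'I_N.+1) : size [seq val j | j <- tval t] = N.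
  by rewrite size_map size_tuple.
apply/val_inj/(inj_map val_inj).
by rewrite (sorted_geq_nz s1) (sorted_geq_nz s2) !szt e.
Qed.

Section PartitionSum.
Variables (A : comNzRingType) (d : nat).

Lemma sum_parts_of (I : finType) (e : I -> seq nat) (F : I -> A) :
  \sum_(i | sumn (e i) == d) F i =
  \sum_(la <- parts_of d) \sum_(i | perm_eq (nz (e i)) la) F i.
Proof.
transitivity (\sum_(la <- parts_of d)
    \sum_(i | (sumn (e i) == d) && perm_eq (nz (e i)) la) F i); last first.
  apply: eq_big_seq => la; rewrite mem_parts_of => /and3P[_ _ /eqP <-].
  apply: eq_bigl => i; case: (boolP (perm_eq _ _)) => [p|]; rewrite ?andbF //.
  by rewrite -(perm_sumn p) sumn_nz eqxx.
rewrite (exchange_big_dep (fun i => sumn (e i) == d)) /= => [|la i _ /andP[] //].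
apply: eq_bigr => i sume; rewrite sume /=.
have mem : sort geq (nz (e i)) \in parts_of d.
  rewrite mem_parts_of; apply/and3P; split; first exact: sorted_geq_sort.
    by rewrite mem_sort mem_filter.
  by rewrite (perm_sumn (permEl (perm_sort _ _))) sumn_nz.
rewrite [RHS]big_mkcond (bigD1_seq _ mem (parts_of_uniq d)) /=.
rewrite perm_sym perm_sort perm_refl big1_seq ?addr0 // => la.
move=> /andP[nla]; rewrite mem_parts_of => /and3P[sla _ _]; case: ifP => // p.
case/eqP: nla; apply: sorted_geq_eq => //; first exact: sorted_geq_sort.
by rewrite perm_sym perm_sort.
Qed.
End PartitionSum.

Lemma mhatE k la d : sumn la = d ->
  mhat k la = (\sum_(e : {ffun 'I_k.-1 -> 'I_d.+1} |
    perm_eq (nz [seq val (e j) | j : 'I_k.-1]) la) \prod_(j < k.-1) j.+1 ^ e j)%N.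
Proof. by move=> <-. Qed.

(** The product of the E_j = sum_m j^m t^m P_m over j < k is expanded over the
   exponent vectors e of t; those with the same nonzero entries, up to order,
   contribute the same product of P_m's, and their coefficients add up to the
   monomial symmetric function. *)
Lemma prod_shift_series (A : comNzRingType) (P : nat -> series A) (g : series A)
    k d' : (0 < k)%N -> P 0%N = 1 ->
  (g * \prod_(j < k) shift_series P j%:R) d' =
  \sum_(d < d'.+1) \sum_(la <- parts_of d)
     (mhat k la)%:R * (g * \prod_(m <- la) P m) (d' - d)%N.
Proof.
case: k => // k _ P0; rewrite big_ord_recl.
have -> : shift_series P (0%N%:R) = 1.
  apply: seriesP => m; rewrite /shift_series big_ord_recl subn0 P0 big1 ?addr0.
    by rewrite mul1r.
  by move=> o _; rewrite exprS !mul0r.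
rewrite mul1r.
pose F (j : 'I_k) : series (series A) := fun m => scst (j.+1%:R ^+ m) * P m.
have -> : \prod_(j < k) shift_series P (lift ord0 j)%:R = sdiag (\prod_j F j).
  rewrite sdiag_prod; apply: eq_bigr => j _; apply: seriesP => m.
  by apply: eq_bigr => o _; rewrite /F coefs_cstM.
rewrite coefs_mul_sdiag; apply: eq_bigr => d _.
rewrite (coefs_prod _ (leqnn d)) mulr_sumr coefs_sum big_mkcond /=.
pose e' (e : {ffun 'I_k -> 'I_d.+1}) := [seq val (e j) | j : 'I_k].
have sume e : sumn (e' e) = (\sum_i e i)%N.
  by rewrite sumnE big_image.
rewrite -big_mkcond /=.
transitivity (\sum_(e | sumn (e' e) == val d) (g * \prod_i F i (e i)) (d' - d)%N).
  by apply: eq_bigl => e; rewrite sume.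
rewrite sum_parts_of; apply: eq_big_seq => la.
rewrite mem_parts_of => /and3P[_ _ /eqP sumla].
rewrite (mhatE k.+1 sumla) natr_sum mulr_suml; apply: eq_bigr => e p.
rewrite natr_prod /F big_split /= -rmorph_prod mulrCA coefs_cstM.
congr (_ * _); first by apply: eq_bigr => i _; rewrite natrX.
congr ((g * _) _); rewrite -(perm_big _ p) big_filter /e' big_image_cond /= [RHS]big_mkcond.
by apply: eq_bigr => i _; case: eqP => // ->.
Qed.
End Partitions.

(** * Free cumulants as functions of the corners *)

Section CompositionalInverse.
Variable A : comNzRingType.

Lemma eqmods_sinv n (f g : series A) : eqmods n f g -> eqmods n (sinv f) (sinv g).
Proof.
move=> e i lin; apply: eq_bigr => j _; rewrite !sexpE.
apply: (@eqmodsXn _ n) => // m lm.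
by rewrite !ssubE !coefsB e.
Qed.

Lemma eqmods_scomp n (h f g : series A) :
  eqmods n f g -> eqmods n (scomp h f) (scomp h g).
Proof.
by move=> e i lin; apply: eq_bigr => j _; rewrite !sexpE (eqmodsXn j e).
Qed.

(** With u = t / R(t), the equation H(K(z)) = z for H = u h reads R = h(t /
   R), and the right side is contracting in R. *)
Lemma exists_cumulants (h : series A) : h 0%N = 1 ->
  exists R : series A, [/\ R 0%N = 1, scomp h (svar A * sinv R) = R
    & scomp (svar A * h) (svar A * sinv R) = svar A].
Proof.
move=> h0.
have [|R fixR] := @series_fixpoint _ (fun R => scomp h (svar A * sinv R)).
  move=> n f g e; apply: eqmods_scomp => -[|i]; rewrite ?coefsM0 ?mul0r //.
  by rewrite ltnS => lin; rewrite !coefsXM; apply: eqmods_sinv lin.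
have R0 : R 0%N = 1 by rewrite -fixR scomp0.
have y0 : (svar A * sinv R) 0%N = 0 by rewrite coefsM0 mul0r.
exists R; split=> //.
by rewrite scompM // scompX // fixR -mulrA mulVs // mulr1.
Qed.

Variables (l : nat) (x : 'I_l -> A).

(** H(z) z in the variable u = 1 / z, for a diagram with l rows: the row with
   addable content x_i ends with a box of content x_i - 1, which cancels the
   next x_j if the next row has the same length; the last factor is the corner
   - l past the last row. *)
Definition corner_ratio : series A :=
  (\prod_i (1 - scst (x i - 1) * svar A)) *
  sinv ((1 + scst l%:R * svar A) * \prod_i (1 - scst (x i) * svar A)).

Let cX0 (a : A) : (scst a * svar A) 0%N = 0.
Proof. by rewrite coefs_cstM mulr0. Qed.

Let prod0 (y : 'I_l -> A) : (\prod_i (1 - scst (y i) * svar A)) 0%N = 1.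
Proof. by rewrite coefs_prod0 big1 // => i _; rewrite coefsB cX0 subr0. Qed.

Lemma corner_ratio0 : corner_ratio 0%N = 1.
Proof.
by rewrite /corner_ratio coefsM0 prod0 sinv0 ?mulr1 // coefsM0 prod0 coefsD cX0 addr0 mul1r.
Qed.

(** The equation H(K(z)) = z, cleared of denominators. Unlike the composition
   it only involves ring operations, and it makes sense for truncated R. *)
Definition cumulant_eqn (R : series A) :=
  (R + scst l%:R * svar A) * \prod_i (R - scst (x i) * svar A) -
  \prod_i (R - scst (x i - 1) * svar A).

Lemma cumulant_eqnP (R : series A) : R 0%N = 1 ->
  scomp corner_ratio (svar A * sinv R) = R -> cumulant_eqn R = 0.
Proof.
move=> R0 fixR; set y := svar A * sinv R in fixR.
have y0 : y 0%N = 0 by rewrite /y coefsM0 mul0r.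
have yR : y * R = svar A by rewrite /y -mulrA mulVs // mulr1.
have sc1 a : scomp (1 - scst a * svar A) y * R = R - scst a * svar A.
  rewrite scompB scomp1 scompM // scomp_cst scompX // mulrBl mul1r.
  by rewrite -mulrA yR.
have scl : scomp (1 + scst l%:R * svar A) y * R = R + scst l%:R * svar A.
  by have := sc1 (- l%:R); rewrite rmorphN mulNr !opprK.
have prodE (z : 'I_l -> A) : \prod_i (R - scst (z i) * svar A) =
    R ^+ l * scomp (\prod_i (1 - scst (z i) * svar A)) y.
  rewrite scomp_prod // -[l in R ^+ l]card_ord -prodr_const -big_split /=.
  by apply: eq_bigr => i _; rewrite [RHS]mulrC sc1.
have d0 : ((1 + scst l%:R * svar A) * \prod_i (1 - scst (x i) * svar A)) 0%N = 1.
  by rewrite coefsM0 prod0 coefsD cX0 addr0 mul1r.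
have := mulsV d0; move/(congr1 (fun f : series A => scomp f y)).
rewrite scompM // scomp1 => inv.
move: fixR; rewrite /corner_ratio scompM //; set s := scomp (sinv _) y in inv *.
set p := scomp _ _ => fixR.
apply/eqP; rewrite subr_eq0; apply/eqP; rewrite -scl !prodE -/p.
move: inv; rewrite scompM //; set a := scomp _ _; set b := scomp _ _ => inv.
transitivity (R ^+ l * a * b * R); first ring.
rewrite -[X in _ * X]fixR.
transitivity (R ^+ l * p * (a * b * s)); first ring.
by rewrite inv mulr1.
Qed.

(** The difference of the two sides is (R - R') q, where q has constant term
   (l + 1) - l = 1. *)
Lemma cumulant_eqn_uniq n (R R' : series A) : R 0%N = 1 -> R' 0%N = 1 ->
  eqmods n (cumulant_eqn R) (cumulant_eqn R') -> eqmods n R R'.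
Proof.
move=> R0 R0'.
have prodB m (z : 'I_m -> A) : exists q : series A, q 0%N = m%:R /\
    \prod_i (R - scst (z i) * svar A) - \prod_i (R' - scst (z i) * svar A) = (R - R') * q.
  elim: m z => [|m IH] z; first by exists 0; rewrite !big_ord0 subrr mulr0.
  have [q [q0 e]] := IH (fun i => z (widen_ord (leqnSn m) i)).
  rewrite !big_ord_recr /=.
  set p := \prod_i _ in e *; set p' := \prod_i _ in e *.
  exists (p + q * (R' - scst (z ord_max) * svar A)); split.
    rewrite coefsD coefsM0 coefsB cX0 R0' q0 subr0 mulr1 /p coefs_prod0 big1.
      by rewrite nat1r.
    by move=> i _; rewrite coefsB cX0 subr0.
  have -> : p' = p - (R - R') * q by rewrite -e; ring.
  ring.
have [q [q0 eq]] := prodB l (fun i => x i - 1).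
have [q' [q0' eq']] := prodB l x.
set p := \prod_i _ in eq'; set p' := \prod_i _ in eq'.
have p0 : p 0%N = 1 by rewrite /p coefs_prod0 big1 // => i _; rewrite coefsB cX0 R0 subr0.
pose q1 := p + (R' + scst l%:R * svar A) * q' - q.
have e : cumulant_eqn R - cumulant_eqn R' = q1 * R - q1 * R'.
  rewrite -mulrBr /cumulant_eqn /q1 -/p -/p'.
  have -> : p' = p - (R - R') * q' by rewrite -eq'; ring.
  set c := \prod_i _ in eq *; set c' := \prod_i _ in eq *.
  have -> : c' = c - (R - R') * q by rewrite -eq; ring.
  ring.
move=> h; apply: (@eqmods_cancel _ _ q1).
  by rewrite /q1 coefsB coefsD coefsM0 p0 coefsD R0' cX0 q0 q0' addr0 mul1r addrK.
by move=> i lin; apply/eqP; rewrite -subr_eq0 -coefsB -e coefsB h // subrr.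
Qed.

End CompositionalInverse.

Section Density.

Lemma rmorph_mmap n (R : nzRingType) (S T : comNzRingType) (phi : {rmorphism S -> T})
    (f : {rmorphism R -> S}) (h : 'I_n -> S) (p : {mpoly R[n]}) :
  phi (mmap f h p) = mmap (phi \o f) (phi \o h) p.
Proof.
rewrite /mmap rmorph_sum; apply: eq_bigr => m _; rewrite rmorphM; congr (_ * _).
by rewrite /mmap1 rmorph_prod; apply: eq_bigr => i _; rewrite rmorphXn.
Qed.

Lemma eq_mmap n (R S : nzRingType) (f f' : R -> S) (h h' : 'I_n -> S)
  (p : {mpoly R[n]}) : f =1 f' -> h =1 h' -> mmap f h p = mmap f' h' p.
Proof.
move=> ef eh; apply: eq_bigr => m _; rewrite ef; congr (_ * _).
by apply: eq_bigr => i _; rewrite eh.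
Qed.

Variables (n : nat) (S : idomainType) (f : {rmorphism rat -> S}).

Let natr_inj (a b : nat) : a%:R = b%:R :> S -> a = b.
Proof.
move=> e; apply/eqP; rewrite -(eqr_nat rat); apply/eqP/(fmorph_inj f).
by rewrite !rmorph_nat.
Qed.

(** The coordinates are released one at a time, starting with the largest: the
   others being fixed, the polynomial in that coordinate vanishes at all large
   natural numbers. *)
Lemma mpoly_density M (Q : {mpoly rat[n]}) :
  (forall l : 'I_n -> nat, (forall i j : 'I_n, (i < j)%N -> (l i < l j)%N) ->
     (forall i : 'I_n, (M <= l i)%N) -> mmap f (fun i => (l i)%:R) Q = 0) ->
  forall v : 'I_n -> S, mmap f v Q = 0.
Proof.
move=> hQ.
suff claim d : (d <= n)%N -> forall (v : 'I_n -> S) (l : 'I_n -> nat),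
    (forall i j : 'I_n, (i < j)%N -> (j < n - d)%N -> (l i < l j)%N) ->
    (forall i : 'I_n, (i < n - d)%N -> (M <= l i)%N /\ v i = (l i)%:R) -> mmap f v Q = 0.
  by move=> v; apply: (claim n (leqnn n) v (fun=> 0%N)) => i; rewrite subnn.
elim: d => [|d IH] ledn v l lincr lv.
  rewrite -(hQ l) => [|i j ij|i]; last by case: (lv i); rewrite ?subn0.
    by apply: eq_mmap => // i; case: (lv i) => //; rewrite subn0.
  by apply: lincr; rewrite ?subn0.
have ltm : (n - d.+1 < n)%N by rewrite ltn_subrL ltnS; lia.
pose m := Ordinal ltm.
pose p : {poly S} := mmap (polyC \o f) (fun j => if j == m then 'X else (v j)%:P) Q.
have pE x : p.[x] = mmap f (fun j => if j == m then x else v j) Q.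
  rewrite -[LHS]/(horner_eval x p) /p rmorph_mmap; apply: eq_mmap => [c|j] /=.
    exact: hornerC.
  by case: eqP => _; [exact: hornerX | exact: hornerC].
have -> : mmap f v Q = p.[v m].
  by rewrite pE; apply: eq_mmap => // j; case: eqP => // ->.
suff -> : p = 0 by rewrite horner0.
apply/eqP/negPn/negP => p0.
pose N0 := (M + (\sum_i l i).+1)%N.
pose rs : seq S := [seq (N0 + i)%:R | i <- iota 0 (size p)].
have urs : uniq rs.
  by rewrite map_inj_uniq ?iota_uniq // => i j /natr_inj /addnI.
have rrs : all (root p) rs.
  apply/allP => _ /mapP[i _ ->]; apply/eqP; rewrite pE.
  pose l' j := if j == m then (N0 + i)%N else l j.
  have lej j : (l j < N0)%N by rewrite /N0 (bigD1 j) //=; lia.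
  apply: (IH (ltnW ledn) _ l') => [i1 j ij ltj|j ltj].
    rewrite /l'; have [e|ne] := eqVneq j m.
      case: eqP => [e1|_]; last by have := lej i1; lia.
      by move: ij; rewrite e1 e ltnn.
    have {}ltj : (j < n - d.+1)%N.
      by have : (j != n - d.+1 :> nat)%N by []; lia.
    case: eqP => [e1|_]; last exact: lincr.
    by move: ij; rewrite e1 /=; lia.
  rewrite /l'; have [e|ne] := eqVneq j m; first by split=> //; rewrite /N0; lia.
  by apply: lv; have : (j != n - d.+1 :> nat)%N by []; lia.
by have := max_poly_roots p0 rrs urs; rewrite size_map size_iota ltnn.
Qed.

End Density.

Section Surjectivity.
Variable F : closedFieldType.
Hypothesis natF : forall m, (m.+1%:R : F) != 0.
Local Notation t := (svar F).

(** The roots of a polynomial are only used through this expansion of the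
   homogenized product. *)
Lemma homogenize (r : seq F) (p q : series F) :
  \prod_(z <- r) (p - scst z * q) =
  \sum_(i < (size r).+1) scst (\prod_(z <- r) ('X - z%:P))`_i * (p ^+ i * q ^+ (size r - i)).
Proof.
elim: r => [|z r IH]; first by rewrite !big_nil big_ord1 coef1 rmorph1 !mul1r.
rewrite !big_cons IH; set P := \prod_(z <- r) ('X - z%:P).
have szP : size P = (size r).+1 by rewrite size_prod_XsubC.
transitivity (\sum_(i < (size r).+2) scst ('X * P)`_i * (p ^+ i * q ^+ ((size r).+1 - i)) -
   scst z * \sum_(i < (size r).+2) scst P`_i * (p ^+ i * q ^+ ((size r).+1 - i))).
  rewrite [X in _ = X - _]big_ord_recl coefXM /= rmorph0 mul0r add0r.
  rewrite [X in _ = _ - _ * X]big_ord_recr /= nth_default ?szP // rmorph0 mul0r addr0.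
  rewrite mulrBl; congr (_ - _).
    rewrite mulr_sumr; apply: eq_bigr => i _; rewrite coefXM /= /bump /= add1n subSS exprS.
    ring.
  rewrite -mulrA; congr (_ * _); rewrite mulr_sumr; apply: eq_bigr => i _.
  by rewrite subSn ?exprS -1?ltnS //; ring.
rewrite mulr_sumr -sumrB; apply: eq_bigr => i _.
by rewrite mulrBl coefB mul_polyC coefZ rmorphB rmorphM /=; ring.
Qed.

(** Every truncated series R solves the cumulant equation of some corners x_i,
   not necessarily integers: writing prod (1 - x_i u) = sum_m A_m u^m, the
   equation becomes sum_m A_m t^m D_m = 0 modulo t^(l+2), where D_m starts
   with m t. This is a triangular system for A_1, ..., A_l with diagonal 1,
   ..., l. *)
Lemma cumulant_eqn_onto l (R : series F) : R 0%N = 1 -> R 1%N = 0 ->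
  exists x : 'I_l -> F, eqmods l.+2 (cumulant_eqn x R) 0.
Proof.
move=> R0 R1.
pose Dm m : series F := (R + scst l%:R * t) * R ^+ (l - m) - (R + t) ^+ (l - m).
have t0 : t 0%N = 0 by [].
have R0t : (R + t) 0%N = 1 by rewrite coefsD R0 t0 addr0.
have c1X (g : series F) m : g 0%N = 1 -> (g ^+ m) 1%N = g 1%N *+ m.
  move=> g0; elim: m => [|m IH]; first by rewrite mulr0n.
  rewrite exprS coefsM big_ord_recl big_ord1 /= /bump /= IH coefsX0 g0 expr1n.
  by rewrite mul1r mulr1 mulrSr.
have Dm0 m : Dm m 0%N = 0.
  rewrite /Dm coefsB coefsM0 !coefsX0 R0t coefsD coefs_cstM mulr0 addr0 R0.
  by rewrite !expr1n mul1r subrr.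
have Dm1 m : (m <= l)%N -> Dm m 1%N = m%:R.
  move=> le; rewrite /Dm coefsB c1X // coefsM big_ord_recl big_ord1 /= /bump /=.
  rewrite c1X // R1 mul0rn mulr0 add0r coefsX0 R0 expr1n mulr1 !coefsD R1 !add0r.
  by rewrite coefs_cstM /svar /= mulr1 natrB // subKr.
have [|A fixA] := @series_fixpoint F (fun A n => if n is m.+1 then
   - (m.+1%:R)^-1 * \sum_(i < m.+1) A i * Dm i (m.+2 - i)%N else 1).
  move=> n g g' e [|m] // lem; congr (_ * _); apply: eq_bigr => i _; congr (_ * _).
  by apply: e; apply: leq_trans (ltn_ord i) lem.
have A0 : A 0%N = 1 by rewrite -fixA.
have AS m : (m.+1 <= l)%N -> \sum_(i < m.+2) A i * Dm i (m.+2 - i)%N = 0.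
  have AE : A m.+1 = - (m.+1%:R)^-1 * \sum_(i < m.+1) A i * Dm i (m.+2 - i)%N.
    by rewrite -[in LHS]fixA.
  move=> le; rewrite big_ord_recr /= AE subSnn Dm1 //.
  by rewrite mulrAC mulNr mulVf ?mulN1r ?subrr // natF.
pose p : {poly F} := \poly_(i < l.+1) A (l - i)%N.
have pl : p`_l = 1 by rewrite coef_poly ltnSn subnn.
have szp : size p = l.+1 by apply: size_poly_eq; rewrite subnn A0 oner_eq0.
have lcp : lead_coef p = 1 by rewrite lead_coefE szp.
have [r pr] := closed_field_poly_normal p.
rewrite lcp scale1r in pr.
have szr : size r = l by apply: succn_inj; rewrite -szp pr size_prod_XsubC.
exists (fun i => r`_i).
have prodE (g h : series F) : \prod_(i < l) (g - scst r`_i * h) =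
    \sum_(i < l.+1) scst (A i) * (g ^+ (l - i) * h ^+ i).
  transitivity (\prod_(z <- r) (g - scst z * h)).
    by rewrite (big_nth 0) szr big_mkord.
  rewrite homogenize szr -pr [LHS](reindex_inj rev_ord_inj) /=.
  apply: eq_bigr => i _; rewrite subSS coef_poly ltnS leq_subr subKn //.
  by rewrite -ltnS.
have -> : cumulant_eqn (fun i : 'I_l => r`_i) R = \sum_(m < l.+1) scst (A m) * (t ^+ m * Dm m).
  rewrite /cumulant_eqn.
  rewrite [X in _ - X](eq_bigr (fun i : 'I_l => (R + t) - scst r`_i * t)); last first.
    by move=> i _; rewrite rmorphB rmorph1; ring.
  rewrite !prodE mulr_sumr -sumrB; apply: eq_bigr => m _; rewrite /Dm; ring.
move=> i; rewrite coefs_sum coefs0 => lti.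
case: i lti => [|i] lti.
  by rewrite big1 // => m _; rewrite coefs_cstM coefsM0 Dm0 !mulr0.
transitivity (\sum_(m < i.+1) A m * Dm m (i.+1 - m)%N).
  rewrite (big_ord_widen_cond l.+1 xpredT (fun m => A m * Dm m (i.+1 - m)%N)) //.
  rewrite [RHS]big_mkcond; apply: eq_bigr => m _.
  rewrite coefs_cstM coefsXnM ltnS; case: (ltngtP m i.+1) => h.
  - by rewrite -ltnS h.
  - by rewrite leqNgt (ltnW h) mulr0.
  - by rewrite h subnn Dm0 mulr0 ltnn.
case: i lti => [|i] lti; last exact: AS.
by rewrite big_ord1 subn0 Dm1 // mulr0.
Qed.

End Surjectivity.

(** * Colourings and permutation characters *)

Section Colourings.
Variable N : nat.

Section Stabiliser.
Variables (T : eqType) (f : 'I_N -> T).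

Definition stab_set : {set 'S_N} := [set s : 'S_N | [forall i : 'I_N, f (s i) == f i]].

Lemma stab_group_set : group_set stab_set.
Proof.
apply/group_setP; split=> [|s1 s2].
  by rewrite inE; apply/forallP=> i; rewrite perm1.
rewrite !inE => /forallP h1 /forallP h2; apply/forallP=> i.
by rewrite permM (eqP (h2 _)) (eqP (h1 _)).
Qed.
Canonical stab := Group stab_group_set.

Lemma stabP (s : 'S_N) : reflect (forall i, f (s i) = f i) (s \in stab).
Proof. by rewrite inE; apply: (iffP forallP) => h i; apply/eqP. Qed.
End Stabiliser.

Section Content.
Variable T : finType.
Implicit Types f g : {ffun 'I_N -> T}.

Definition content f : {ffun T -> nat} := [ffun c => #|[set i | f i == c]|].

(** Colourings of equal content are in the same orbit of the symmetric group. *)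
Lemma content_perm f g : content f = content g ->
  exists y : 'S_N, forall i, f i = g (y i).
Proof.
move=> e; have p : perm_eq (mktuple f) (mktuple g).
  apply/allP => c _ /=; rewrite !count_map; apply/eqP.
  move/ffunP/(_ c): e; rewrite !ffunE !cardsE !cardE !size_filter /=.
  by rewrite -!enumT.
have [y ey] := tuple_permP p.
by exists y => i; have := congr1 (fun t => tnth t i) (val_inj ey); rewrite !tnth_mktuple.
Qed.

Lemma content_act f (y : 'S_N) : content [ffun i => f (y i)] = content f.
Proof.
apply/ffunP => c; rewrite !ffunE -[RHS](card_preimset _ (@perm_inj _ y)).
by congr #|pred_of_set _|; apply/setP => i; rewrite !inE ffunE.
Qed.

Lemma card_transporter f g : content f = content g ->
  #|[set y : 'S_N | [forall i, g (y i) == f i]]| = #|stab f| /\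
  #|[set y : 'S_N | [forall i, g (y i) == f i]]| = #|stab g|.
Proof.
move=> /content_perm[y0 e]; split.
  rewrite -(card_rcoset (stab f) y0); congr #|pred_of_set _|; apply/setP => y.
  rewrite mem_rcoset !inE; apply/forallP/forallP => h i.
    by rewrite permM; move/eqP: (h i) => <-; rewrite e permKV.
  have := h i; rewrite permM e permKV => /eqP ->; exact: eqxx.
rewrite -(card_lcoset (stab g) y0); congr #|pred_of_set _|; apply/setP => y.
rewrite mem_lcoset !inE; apply/forallP/forallP => h i.
  by rewrite permM (eqP (h _)) e permKV.
by have := h (y0 i); rewrite permM permK e.
Qed.

(** The permutations y are sorted by the colouring g o y. *)
Lemma sum_card_stab g : (\sum_(f | content f == content g) #|stab f| = N`!)%N.
Proof.
have cG : #|[set: 'S_N]| = N`! by rewrite cardsT card_Sn.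
rewrite -cG -sum1_card (partition_big (fun y : 'S_N => [ffun i => g (y i)])
   (fun f => content f == content g)) /=.
  apply: eq_bigr => f /eqP e; have [<- _] := card_transporter e.
  rewrite -sum1_card; apply: eq_bigl => y; rewrite !inE /=.
  apply/forallP/eqP => [h|<- i]; last by rewrite ffunE.
  by apply/ffunP => i; rewrite ffunE; apply/eqP.
by move=> y _; rewrite content_act.
Qed.

(** A permutation fixes f when f is constant on its cycles; this is the
   permutation character of the colourings of content al. *)
Definition fixed_colourings (al : {ffun T -> nat}) (s : 'S_N) : nat :=
  #|[set f | (content f == al) && (s \in stab f)]|.

(** The colourings of the same content as g correspond to the cosets of its
   stabiliser. *)
Lemma cfInd_stab g (s : 'S_N) :
  'Ind[[set: 'S_N], stab g] 1 s = (fixed_colourings (content g) s)%:R.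
Proof.
rewrite cfIndE ?subsetT //.
have stn0 : #|stab g|%:R != 0 :> algC by rewrite pnatr_eq0 -lt0n cardG_gt0.
apply: (mulfI stn0); rewrite mulrA divff // mul1r.
transitivity (\sum_(y : 'S_N) (s \in stab [ffun i => g (y i)])%:R : algC).
  rewrite big_mkcond /=; apply: eq_bigr => y _; rewrite in_setT cfun1E.
  congr (_%:R); congr nat_of_bool; apply/stabP/stabP => h i.
    by rewrite !ffunE; have := h (y i); rewrite conjgE !permM permK.
  by have := h (y^-1%g i); rewrite !ffunE conjgE !permM permKV.
rewrite (partition_big (fun y : 'S_N => [ffun i => g (y i)])
   (fun f => content f == content g)) /=; last first.
  by move=> y _; rewrite content_act.
transitivity (\sum_(f | content f == content g) (s \in stab f)%:R * #|stab g|%:R : algC).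
  apply: eq_bigr => f /eqP e; have [_ <-] := card_transporter e.
  rewrite -sum1_card natr_sum mulr_sumr; apply: eq_big => y.
    rewrite !inE; apply/eqP/forallP => [<- i|h]; first by rewrite ffunE.
    by apply/ffunP => i; rewrite ffunE; apply/eqP.
  by move=> /eqP <-; rewrite mulr1.
rewrite -mulr_suml mulrC; congr (_ * _); rewrite /fixed_colourings -sum1_card natr_sum.
rewrite [LHS]big_mkcond [RHS]big_mkcond; apply: eq_bigr => f _; rewrite inE.
by case: (_ == _) => //=; case: (_ \in _).
Qed.

Definition colouring_char (al : {ffun T -> nat}) : 'CF([set: 'S_N]) :=
  if [pick g | content g == al] is Some g
  then 'Ind[[set: 'S_N], stab g] 1 else 0.

Lemma colouring_charE al s : colouring_char al s = (fixed_colourings al s)%:R.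
Proof.
rewrite /colouring_char; case: pickP => [g /eqP <-|none]; first exact: cfInd_stab.
rewrite cfunE /fixed_colourings (_ : [set f | _] = set0) ?cards0 //.
by apply/setP => f; rewrite !inE none.
Qed.

Lemma colouring_char_char al : colouring_char al \is a character.
Proof.
rewrite /colouring_char; case: pickP => [g _|_]; last exact: cfun0_char.
by apply: cfInd_char; apply: cfun1_char.
Qed.

Lemma colouring_char_content g : colouring_char (content g) = 'Ind[[set: 'S_N], stab g] 1.
Proof. by apply/cfunP => s; rewrite colouring_charE cfInd_stab. Qed.

End Content.
End Colourings.
Arguments colouring_char {N T} al.

(** * Induced sign characters *)

Section SignCharacter.
Variable N : nat.

Lemma cfSgnE (s : 'S_N) : cfSgn N s = (-1) ^+ (s : bool).
Proof. by rewrite cfunElock. Qed.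

Lemma cfSgn_char : cfSgn N \is a character.
Proof.
pose r (s : 'S_N) : 'M[algC]_1 := ((-1) ^+ (s : bool))%:M.
have rr : mx_repr [set: 'S_N] r.
  split=> [|s1 s2 _ _]; first by rewrite /r odd_perm1.
  by rewrite /r odd_permM signr_addb scalar_mxM.
apply/char_reprP; exists (Representation (MxRepresentation rr)).
apply/cfunP => s; rewrite [RHS]cfunE in_setT mulr1n /= /r mxtrace_scalar mulr1n.
exact: cfSgnE.
Qed.

Definition sgn_char (U : eqType) (col : 'I_N -> U) : 'CF([set: 'S_N]) :=
  'Ind[[set: 'S_N], stab col] ('Res[stab col] (cfSgn N)).

Lemma sgn_char_char (U : eqType) (col : 'I_N -> U) : sgn_char col \is a character.
Proof. exact/cfInd_char/cfRes_char/cfSgn_char. Qed.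

Variables (T : finType) (U : eqType) (col : 'I_N -> U).

(** Frobenius reciprocity and exchange of the sums: each colouring contributes
   the sum of the signs over the subgroup preserving it and the columns. *)
Lemma dot_sgn_char (al : {ffun T -> nat}) :
  '[colouring_char al, sgn_char col] = #|stab col|%:R^-1 *
    \sum_(f : {ffun 'I_N -> T} | content f == al)
       \sum_(b in stab f :&: stab col) (-1) ^+ (b : bool).
Proof.
rewrite -cfdot_Res_l cfdotE; congr (_ * _).
transitivity (\sum_(b in stab col) \sum_(f : {ffun 'I_N -> T} | content f == al)
    if b \in stab f then (-1) ^+ (b : bool) : algC else 0).
  apply: eq_bigr => b bH; rewrite !cfResE ?subsetT // colouring_charE cfSgnE.
  rewrite rmorphXn rmorphN1 -big_mkcondr /= /fixed_colourings -sum1_card natr_sum mulr_suml.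
  by apply: eq_big => [f|f _]; rewrite ?inE ?mul1r.
rewrite exchange_big; apply: eq_bigr => f _; rewrite -big_mkcondr.
by apply: eq_bigl => b; rewrite in_setI andbC.
Qed.

Lemma sum_sgn_odd (H : {group 'S_N}) (a : 'S_N) : a \in H -> odd_perm a ->
  \sum_(b in H) (-1) ^+ (b : bool) = 0 :> algC.
Proof.
move=> aH oa; set S := \sum_(b in H) _.
have e : S = - S.
  rewrite {1}/S (reindex_inj (mulgI a)) /= -sumrN.
  apply: eq_big => [b|b _]; first by rewrite groupMl.
  by rewrite odd_permM oa addTb signrN.
by apply/eqP; have := eqNr S; rewrite -e eqxx => <-.
Qed.

(** If two points share colour and column, their transposition makes the sum of
   signs vanish. *)
Lemma dot_sgn_char0 (al : {ffun T -> nat}) :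
  (forall f : {ffun 'I_N -> T}, content f = al ->
     exists x y, [/\ x != y, f x = f y & col x = col y]) ->
  '[colouring_char al, sgn_char col] = 0.
Proof.
move=> h; rewrite dot_sgn_char big1 ?mulr0 // => f /eqP /h[x [y [xy fxy cxy]]].
apply: (@sum_sgn_odd _ (tperm x y)); last by rewrite odd_tperm.
by rewrite in_setI; apply/andP; split; apply/stabP => i; case: tpermP => [->|->|].
Qed.

Lemma sum_sgn_ge0 (H : {group 'S_N}) : 0 <= \sum_(b in H) (-1) ^+ (b : bool) :> algC.
Proof.
case: (boolP [exists b in H, odd_perm b]) => [/exists_inP[a aH oa]|].
  by rewrite (sum_sgn_odd aH oa).
rewrite negb_exists_in => /forall_inP h; apply: sumr_ge0 => b /h.
by case: odd_perm => // _; rewrite expr0.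
Qed.

(** All contributions are nonnegative, and a colouring separating the points of
   each column contributes 1. *)
Lemma dot_sgn_char_neq0 (f0 : {ffun 'I_N -> T}) :
  (forall x y, f0 x = f0 y -> col x = col y -> x = y) ->
  '[colouring_char (content f0), sgn_char col] != 0.
Proof.
move=> inj; rewrite dot_sgn_char mulf_neq0 //.
  by rewrite invr_eq0 pnatr_eq0 -lt0n cardG_gt0.
rewrite (bigD1 f0) //= lt0r_neq0 // ltr_pwDl ?sumr_ge0 // => [|f _]; last first.
  exact: sum_sgn_ge0.
have -> : (stab f0 :&: stab col = 1)%g.
  apply/trivgP/subsetP => b; rewrite in_setI => /andP[/stabP h1 /stabP h2].
  by apply/set1P/permP => i; rewrite perm1; apply: inj.
by rewrite big_set1 odd_perm1 expr0 ltr01.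
Qed.

End SignCharacter.

(** * Counting pairs of colourings *)

Section Content.
Variables (N : nat) (T : finType).

Lemma exists_content (al : {ffun T -> nat}) : (\sum_c al c = N)%N ->
  exists f : {ffun 'I_N -> T}, content f = al.
Proof.
move=> sumal; pose s := flatten [seq nseq (al c) c | c <- enum T].
have szs : size s == N.
  rewrite size_flatten /shape -map_comp (eq_map (g := al)) => [|c] /=; last exact: size_nseq.
  by rewrite sumnE big_map big_enum sumal.
exists [ffun i => tnth (Tuple szs) i]; apply/ffunP => c; rewrite ffunE.
transitivity (count_mem c (Tuple szs)).
  rewrite -[in RHS](map_tnth_enum (Tuple szs)) count_map cardsE cardE size_filter.
  by rewrite -enumT; apply: eq_count => i /=; rewrite unfold_in ffunE.
rewrite /= count_flatten sumnE !big_map -enumT big_enum /= (bigD1 c) //=.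
rewrite count_nseq /= eqxx mul1n.
by rewrite big1 ?addn0 // => d /negbTE dc; rewrite count_nseq /= dc.
Qed.

End Content.

Section PowerSums.
Variables (N l : nat).
Local Notation MP := {mpoly algC[l]}.

Definition geom (d : 'I_l) : series MP := fun m => 'X_d ^+ m.
(** The generating series of the complete homogeneous polynomials. *)
Definition Hgen : series MP := \prod_d geom d.

(** This is the product of the power sums p_r, over the lengths r of the cycles
   of s: a colouring constant on the cycles chooses one variable for each. *)
Definition power_sum (s : 'S_N) : MP :=
  \sum_(g : {ffun 'I_N -> 'I_l} | s \in stab g) \prod_i 'X_(g i).

(** All pairs of colourings with given joint content M form one orbit. *)
Lemma sum_stab_content (T : finType) (M : {ffun T * 'I_l -> nat}) :
  (\sum_p M p = N)%N ->
  \sum_(F : {ffun 'I_N -> T * 'I_l} | content F == M)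
     #|stab F|%:R *: (\prod_i 'X_((F i).2) : MP) =
  N`!%:R *: \prod_c \prod_d 'X_d ^+ M (c, d).
Proof.
move=> /exists_content[F0 <-]; rewrite -(sum_card_stab F0) natr_sum scaler_suml.
apply: eq_bigr => F /eqP e; congr (_ *: _).
rewrite pair_big /= (partition_big F xpredT) //=; apply: eq_bigr => -[c d] _ /=.
transitivity (\prod_(i < N | F i == (c, d)) 'X_d : MP).
  by apply: eq_bigr => i /eqP ->.
rewrite prodr_const -e ffunE; congr (_ ^+ _).
by apply: eq_card => i; rewrite inE.
Qed.

(** Burnside counting of pairs of colourings: the orbits of the pairs with first
   content al are given by the joint contents, so the average of
   fixed_colourings al s times p_s is the product of the h_(al_c). *)
Lemma sum_colourings_power_sum (T : finType) (al : {ffun T -> nat}) : (\sum_c al c = N)%N ->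
  \sum_(s : 'S_N) (fixed_colourings al s)%:R *: power_sum s = N`!%:R *: \prod_c Hgen (al c).
Proof.
move=> sumal.
have leal c : (al c <= N)%N by rewrite -sumal (bigD1 c) //= leq_addr.
transitivity (\sum_(F : {ffun 'I_N -> T * 'I_l} | content [ffun i => (F i).1] == al)
   #|stab F|%:R *: (\prod_i 'X_((F i).2) : MP)).
  transitivity (\sum_(p : {ffun 'I_N -> T} * {ffun 'I_N -> 'I_l} | content p.1 == al)
     (\sum_(s : 'S_N) ((s \in stab p.1) && (s \in stab p.2))%:R) *: (\prod_i 'X_(p.2 i) : MP)).
    under [RHS]eq_bigr do rewrite scaler_suml.
    rewrite exchange_big; apply: eq_bigr => s _.
    rewrite /fixed_colourings -sum1_card natr_sum scaler_suml /power_sum.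
    rewrite [RHS](eq_bigl (fun p : {ffun 'I_N -> T} * {ffun 'I_N -> 'I_l} =>
      (content p.1 == al) && true)) => [|p]; last by rewrite andbT.
    rewrite -(pair_big_dep (fun f : {ffun 'I_N -> T} => content f == al) (fun _ => xpredT)
       (fun f (g : {ffun 'I_N -> 'I_l}) =>
          ((s \in stab f) && (s \in stab g))%:R *: (\prod_i 'X_(g i) : MP))) /=.
    rewrite [LHS]big_mkcond [RHS]big_mkcond; apply: eq_bigr => f _; rewrite in_set.
    case: (_ == _) => //=; case: (s \in _) => /=; last first.
      by rewrite big1 // => g _; rewrite scale0r.
    rewrite scale1r big_mkcond /=; apply: eq_bigr => g _.
    by case: (s \in _); rewrite ?scale1r ?scale0r.
  pose h (F : {ffun 'I_N -> T * 'I_l}) : {ffun 'I_N -> T} * {ffun 'I_N -> 'I_l} :=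
    ([ffun i => (F i).1], [ffun i => (F i).2]).
  have hbij : bijective h.
    exists (fun p : {ffun 'I_N -> T} * {ffun 'I_N -> 'I_l} => [ffun i => (p.1 i, p.2 i)]).
      by move=> F; apply/ffunP => i; rewrite ffunE /= !ffunE -surjective_pairing.
    by move=> [f g]; congr (_, _); apply/ffunP => i; rewrite !ffunE.
  rewrite (reindex h) /=; last exact: onW_bij.
  apply: eq_bigr => F _; congr (_ *: _); last by apply: eq_bigr => i _; rewrite ffunE.
  rewrite -natr_sum -sum1_card [in RHS]big_mkcond /=; congr (_%:R); apply: eq_bigr => s _.
  rewrite -[LHS]/(nat_of_bool _); have -> : (s \in stab [ffun i => (F i).1]) &&
      (s \in stab [ffun i => (F i).2]) = (s \in stab F).
    apply/andP/stabP => [[/stabP h1 /stabP h2] i|e]; last first.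
      by split; apply/stabP => i; rewrite !ffunE e.
    have := h1 i; have := h2 i; rewrite !ffunE => e2 e1.
    by rewrite [LHS]surjective_pairing e1 e2 -surjective_pairing.
  by case: (s \in _).
pose cM (F : {ffun 'I_N -> T * 'I_l}) : {ffun T -> {ffun 'I_l -> 'I_N.+1}} :=
  [ffun c => [ffun d => inord (content F (c, d))]].
have cME F c d : cM F c d = content F (c, d) :> nat.
  by rewrite !ffunE inordK // ltnS (leq_trans (max_card _)) ?card_ord.
have row F c : (\sum_d cM F c d = content [ffun i => (F i).1] c)%N.
  rewrite [RHS]ffunE -sum1_card (partition_big (fun i => (F i).2) xpredT) //=.
  apply: eq_bigr => d _; rewrite cME ffunE -sum1_card; apply: eq_bigl => i.
  by rewrite !inE ffunE -pair_eqE.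
rewrite (partition_big cM (fun M => M \in family (fun c =>
   [pred m : {ffun 'I_l -> 'I_N.+1} | (\sum_d m d == al c)%N]))) /=; last first.
  by move=> F /eqP e; apply/familyP => c; rewrite inE row e.
transitivity (N`!%:R *: \prod_c \sum_(m : {ffun 'I_l -> 'I_N.+1} | (\sum_d m d == al c)%N)
    (\prod_d 'X_d ^+ m d : MP)); last first.
  by congr (_ *: _); apply: eq_bigr => c _; rewrite /Hgen (coefs_prod _ (leal c)).
rewrite bigA_distr_big_dep scaler_sumr; apply: eq_bigr => M /familyP fM.
pose M' : {ffun T * 'I_l -> nat} := [ffun p => M p.1 p.2 : nat].
have sumM' : (\sum_p M' p = N)%N.
  transitivity (\sum_c \sum_d M' (c, d))%N.
    by rewrite pair_big; apply: eq_bigr => -[].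
  rewrite -sumal; apply: eq_bigr => c _; have := fM c; rewrite inE => /eqP <-.
  by apply: eq_bigr => d _; rewrite ffunE.
transitivity (N`!%:R *: (\prod_c \prod_d 'X_d ^+ M' (c, d)) : MP); last first.
  by congr (_ *: _); apply: eq_bigr => c _; apply: eq_bigr => d _; rewrite ffunE.
rewrite -(sum_stab_content sumM'); apply: eq_bigl => F.
apply/andP/eqP => [[_ /eqP e]|e].
  by apply/ffunP => -[c d]; rewrite [RHS]ffunE -e cME.
have eM : cM F = M.
  by apply/ffunP => c; apply/ffunP => d; apply: val_inj; rewrite /= cME e ffunE.
split; last by rewrite eM.
apply/eqP/ffunP => c; rewrite -row eM; apply/eqP.
by have := fM c; rewrite inE.
Qed.

End PowerSums.

(** * The norm of Frobenius' alternating sum *)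

Section Alternant.
Variable l : nat.
Local Notation MP := {mpoly algC[l]}.
Local Notation t := (svar MP).

Lemma coefs_lin_prod_gt (A : comNzRingType) (I : finType) (P : pred I) (a : I -> A) m :
  (#|P| < m)%N -> (\prod_(i | P i) (1 - scst (a i) * svar A)) m = 0.
Proof.
have -> : \prod_(i | P i) (1 - scst (a i) * svar A) =
    \prod_(i <- enum P) (1 - scst (a i) * svar A) by rewrite big_enum.
rewrite cardE; elim: (enum _) m => [|i r IH] m /= lt.
  by rewrite big_nil coefs1; case: m lt.
case: m lt => // m lt; rewrite big_cons mulrBl mul1r coefsB -mulrA coefs_cstM coefsXM.
by rewrite !IH ?mulr0 ?subr0 //; apply: ltnW.
Qed.

Lemma mul_geom (d : 'I_l) : (1 - scst 'X_d * t) * geom d = 1.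
Proof.
apply: seriesP => -[|n]; rewrite mulrBl mul1r coefsB -mulrA coefs_cstM coefsXM coefs1.
  by rewrite mulr0 subr0.
by rewrite /geom -exprS subrr.
Qed.

(** The entries of Hmx are h_(nu_i - j), those of Emx are, up to sign, the
   elementary symmetric polynomials in all variables but X_k. *)
Definition Hmx (nu : 'I_l -> nat) : 'M[MP]_l := \matrix_(i, j) (t ^+ j * Hgen l) (nu i).
Definition Emx : 'M[MP]_l :=
  \matrix_(j, k) (\prod_(i < l | i != k) (1 - scst 'X_i * t)) j.
Definition Xmx (nu : 'I_l -> nat) : 'M[MP]_l := \matrix_(i, k) 'X_k ^+ nu i.

(** Omitting the k-th variable, H(t) prod_(i <> k) (1 - X_i t) is the geometric
   series of X_k t. *)
Lemma mul_Hmx_Emx nu : Hmx nu *m Emx = Xmx nu.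
Proof.
apply/matrixP => i k; rewrite !mxE.
pose e : series MP := \prod_(i < l | i != k) (1 - scst 'X_i * t).
have l0 : (0 < l)%N by apply: leq_trans (ltn_ord k).
have eE : e = \sum_(j < l) scst (e j) * t ^+ j.
  apply: seriesP => m; rewrite coefs_sum.
  have cf j : (scst (e j) * t ^+ j) m = e m *+ (m == j).
    rewrite coefs_cstM -[t ^+ j]mulr1 coefsXnM coefs1.
    case: (ltngtP m j) => [lt|lt|->]; rewrite ?mulr0 ?subnn ?mulr1 ?mulr1n //.
    by rewrite subn_eq0 leqNgt lt mulr0.
  case: (ltnP m l) => [lt|le].
    rewrite (bigD1 (Ordinal lt)) //= cf eqxx big1 ?addr0 // => j nj.
    by rewrite cf -[m]/(val (Ordinal lt)) eq_sym val_eqE (negbTE nj).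
  rewrite /e coefs_lin_prod_gt; last first.
    by move: (cardC1 k) => /=; rewrite card_ord => ->; lia.
  rewrite big1 // => j _; rewrite cf; case: eqP => // e'; move: (ltn_ord j).
  by rewrite -e' ltnNge le.
have Hg : Hgen l * e = geom k.
  rewrite /Hgen /e (bigD1 k) //= -mulrA -big_split /= big1 ?mulr1 // => j _.
  by rewrite mulrC mul_geom.
rewrite -[RHS]/(geom k (nu i)) -Hg eE mulr_sumr coefs_sum; apply: eq_bigr => j _.
by rewrite !mxE mulrCA coefs_cstM [in RHS]mulrC [Hgen l * _]mulrC.
Qed.

Lemma det_Hmx_id : \det (Hmx id) = 1.
Proof.
rewrite det_trig => [|]; last first.
  by apply/is_trig_mxP => i j ij; rewrite mxE coefsXnM leqNgt ij.
rewrite big1 // => i _; rewrite mxE coefsXnM leqnn subnn.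
by rewrite /Hgen coefs_prod0 big1.
Qed.

(** The Jacobi-Trudi identity; the case nu = id, where Hmx is unitriangular,
   gives the determinant of Emx. *)
Lemma det_Hmx nu : \det (Hmx nu) * \det (Xmx id) = \det (Xmx nu).
Proof.
by rewrite -!mul_Hmx_Emx !det_mulmx det_Hmx_id mul1r.
Qed.

Lemma mcoeff_sign (b : bool) (p : MP) m : ((-1) ^+ b * p)@_m = (-1) ^+ b * p@_m.
Proof. by case: b; rewrite ?mulN1r ?mcoeffN // !mul1r. Qed.

Lemma mcoeff_det_Xmx (nu : 'I_l -> nat) : injective nu ->
  (\det (Xmx nu))@_[multinom nu i | i < l] = 1.
Proof.
move=> inu; rewrite -det_tr /determinant raddf_sum (bigD1 1%g) //= odd_perm1 expr0 mul1r.
have cf (s : 'S_l) : \prod_i (Xmx nu)^T i (s i) = 'X_[[multinom nu (s i) | i < l]].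
  by rewrite mpolyXE_id; apply: eq_bigr => i _; rewrite !mxE mnmE.
rewrite cf mcoeffX; have -> : [multinom nu ((1%g : 'S_l) i) | i < l] = [multinom nu i | i < l].
  by apply/mnmP => i; rewrite !mnmE perm1.
rewrite eqxx big1 ?addr0 // => s ns; rewrite cf mcoeff_sign mcoeffX.
case: eqP => [/mnmP e|_]; rewrite ?mulr0 //; case/eqP: ns.
by apply/permP => i; rewrite perm1; apply: inu; have := e i; rewrite !mnmE.
Qed.

End Alternant.

Section VirtualCharacter.
Variables (N l : nat) (nu : 'I_l -> nat).

Definition shifted (w : 'S_l) : {ffun 'I_l -> nat} := [ffun i => (nu i - w i)%N].

(** Frobenius' alternating sum of permutation characters, a determinant in the
   sense of Jacobi and Trudi. *)
Definition frob_char : 'CF([set: 'S_N]) :=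
  \sum_(w : 'S_l) (-1) ^+ (w : bool) *: colouring_char (shifted w).

Hypothesis nu_inj : injective nu.
Hypothesis nu_ge : forall i, (l <= nu i)%N.
Hypothesis sum_nu : (\sum_i nu i = N + \sum_(i < l) i)%N.

Lemma sum_shifted w : (\sum_c shifted w c = N)%N.
Proof.
apply/eqP; rewrite -(eqn_add2r (\sum_(i < l) i)) -sum_nu.
rewrite [X in (_ + X)%N](reindex_inj (@perm_inj _ w)) /= -big_split /=.
apply/eqP; apply: eq_bigr => i _; rewrite ffunE subnK //.
by apply: leq_trans (nu_ge i); apply: ltnW.
Qed.

Lemma frob_char_vchar : frob_char \in 'Z[irr [set: 'S_N]]%g.
Proof.
apply: rpred_sum => w _; rewrite rpredZsign; exact/char_vchar/colouring_char_char.
Qed.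

Lemma mcoeff_power_sum (be : {ffun 'I_l -> nat}) (s : 'S_N) :
  (power_sum l s)@_[multinom be i | i < l] = (fixed_colourings be s)%:R.
Proof.
rewrite /power_sum raddf_sum /fixed_colourings -sum1_card natr_sum /=.
rewrite [LHS]big_mkcond [RHS]big_mkcond; apply: eq_bigr => g _.
rewrite [in RHS]in_set [in RHS]andbC; case: (s \in _) => //=.
have -> : \prod_i 'X_(g i) = 'X_[[multinom content g i | i < l]] :> {mpoly algC[l]}.
  rewrite mpolyXE_id (partition_big g xpredT) //=; apply: eq_bigr => c _.
  transitivity (\prod_(i | g i == c) 'X_c : {mpoly algC[l]}).
    by apply: eq_bigr => i /eqP ->.
  rewrite prodr_const mnmE ffunE; congr (_ ^+ _).
  by apply: eq_card => i; rewrite inE.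
rewrite mcoeffX; case: eqP => [/mnmP e|ne].
  suff -> : content g == be by [].
  by apply/eqP/ffunP => c; have := e c; rewrite !mnmE.
by case: eqP => // e; case: ne; rewrite e.
Qed.

Lemma colouring_char_dot (al be : {ffun 'I_l -> nat}) : (\sum_c al c = N)%N ->
  '[colouring_char al, colouring_char be : 'CF([set: 'S_N])] =
  (\prod_c Hgen l (al c))@_[multinom be i | i < l].
Proof.
move=> sumal; rewrite cfdotE cardsT card_Sn.
have fN : (N`!%:R : algC) != 0 by rewrite pnatr_eq0 -lt0n fact_gt0.
apply: (mulfI fN); rewrite mulrA divff // mul1r -mcoeffZ -sum_colourings_power_sum //.
rewrite raddf_sum /= big_mkcond /=; apply: eq_bigr => s _.
by rewrite in_setT !colouring_charE mcoeffZ mcoeff_power_sum rmorph_nat.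
Qed.

(** Since sum_w (-1)^w prod_i h_(nu_i - w i) is the determinant of Hmx nu, and
   the alternant sum_v (-1)^v prod_i X_i^(v i) is the determinant of Xmx id, the
   norm is the coefficient of X^nu in their product, the alternant of nu. *)
Lemma frob_char_norm : '[frob_char] = 1.
Proof.
have -> : '[frob_char] =
    \sum_(v : 'S_l) '[frob_char, (-1) ^+ (v : bool) *: colouring_char (shifted v)].
  by rewrite {2}/frob_char cfdot_sumr.
rewrite -[RHS](mcoeff_det_Xmx nu_inj) -det_Hmx -[\det (@Xmx l id)]det_tr.
rewrite {2}/determinant mulr_sumr [RHS]raddf_sum /=; apply: eq_bigr => v _.
rewrite cfdotZr rmorph_sign [X in _ = X@__]mulrCA.
have -> : \prod_i (@Xmx l id)^T i (v i) = 'X_[[multinom v i : nat | i < l]].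
  by rewrite mpolyXE_id; apply: eq_bigr => i _; rewrite !mxE mnmE.
have -> : [multinom nu i | i < l] =
    ([multinom v i : nat | i < l] + [multinom shifted v i | i < l])%MM.
  apply/mnmP => i; rewrite mnmDE !mnmE ffunE subnKC //.
  by apply: leq_trans (nu_ge i); apply: ltnW.
rewrite mcoeff_sign mcoeffMX; congr (_ * _).
rewrite /frob_char /determinant cfdot_suml [RHS]raddf_sum /=; apply: eq_bigr => w _.
rewrite cfdotZl mcoeff_sign colouring_char_dot ?sum_shifted //; congr (_ * _@_ _).
apply: eq_bigr => i _; rewrite mxE coefsXnM ffunE.
by rewrite (leq_trans (ltnW (ltn_ord _)) (nu_ge i)).
Qed.

End VirtualCharacter.

(** * Counting colourings of given content *)

Section Counting.
Variable T : finType.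

Lemma contentE N (f : {ffun 'I_N -> T}) c : content f c = (\sum_i (f i == c))%N.
Proof.
rewrite ffunE -sum1_card big_mkcond /=; apply: eq_bigr => i _.
by rewrite inE; case: (_ == _).
Qed.

Variables (k M : nat).

Definition glue (c : T) (f : {ffun 'I_M -> T}) : {ffun 'I_(k.+1 + M) -> T} :=
  [ffun i => if split i is inr j then f j else c].

Lemma glue_lshift c f i : glue c f (lshift M i) = c.
Proof. by rewrite ffunE (unsplitK (inl i)). Qed.
Lemma glue_rshift c f i : glue c f (rshift k.+1 i) = f i.
Proof. by rewrite ffunE (unsplitK (inr i)). Qed.

Lemma content_glue c f d :
  content (glue c f) d = ((c == d) * k.+1 + content f d)%N.
Proof.
rewrite !contentE big_split_ord /=; congr (_ + _)%N.
  under eq_bigr do rewrite glue_lshift.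
  by rewrite sum_nat_const card_ord mulnC.
by apply: eq_bigr => i _; rewrite glue_rshift.
Qed.

Definition const_first (f : {ffun 'I_(k.+1 + M) -> T}) :=
  [forall i : 'I_k.+1, f (lshift M i) == f (lshift M ord0)].

(** Such a colouring is given by the colour c of the first k + 1 points and a
   colouring of the others. *)
Lemma card_const_first (al : {ffun T -> nat}) :
  #|[set f | (content f == al) && const_first f]| =
  (\sum_(c | (k < al c)%N)
     #|[set f : {ffun 'I_M -> T} | content f == [ffun d => al d - (c == d) * k.+1]%N]|)%N.
Proof.
rewrite -sum1_card (reindex_onto (fun p : T * {ffun 'I_M -> T} => glue p.1 p.2)
   (fun f => (f (lshift M ord0), [ffun j => f (rshift k.+1 j)]))) /=; last first.
  move=> f; rewrite inE => /andP[_ /forallP cf]; apply/ffunP => i.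
  by case: (split_ordP i) => j ->; rewrite ?glue_lshift ?glue_rshift ?ffunE // (eqP (cf j)).
rewrite (eq_bigl (fun p : T * {ffun 'I_M -> T} => (k < al p.1)%N &&
  (content p.2 == [ffun d => al d - (p.1 == d) * k.+1]%N))); last first.
  move=> [c f] /=.
  have -> : (glue c f (lshift M ord0), [ffun j => glue c f (rshift k.+1 j)]) == (c, f).
    rewrite glue_lshift; apply/eqP; congr (_, _).
    by apply/ffunP => i; rewrite ffunE glue_rshift.
  rewrite andbT inE.
  have -> : const_first (glue c f) by apply/forallP => i; rewrite !glue_lshift.
  rewrite andbT; apply/eqP/andP => [<-|[lt /eqP e]].
    rewrite content_glue eqxx mul1n leq_addr; split=> //.
    by apply/eqP/ffunP => d; rewrite [RHS]ffunE content_glue addKn.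
  apply/ffunP => d; rewrite content_glue e ffunE; case: eqP => [<-|_].
    by rewrite mul1n subnKC.
  by rewrite !mul0n subn0.
rewrite -(pair_big_dep (fun c => (k < al c)%N) (fun c (f : {ffun 'I_M -> T}) =>
  content f == [ffun d => al d - (c == d) * k.+1]%N) (fun _ _ => 1%N)) /=.
by apply: eq_bigr => c _; rewrite -sum1_card; apply: eq_bigl => f; rewrite inE.
Qed.
End Counting.

Section Multinomial.
Variable T : finType.

(** The multinomial formula, by removal of the first point. *)
Lemma card_content M (al : {ffun T -> nat}) : (\sum_c al c = M)%N ->
  (#|[set f : {ffun 'I_M -> T} | content f == al]| * \prod_c (al c)`! = M`!)%N.
Proof.
elim: M al => [|M IH] al sumal.
  have al0 c : al c = 0%N.
    by apply/eqP; rewrite -leqn0 -sumal (bigD1 c) //= leq_addr.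
  rewrite big1 => [|c _]; last by rewrite al0.
  rewrite muln1 [X in #|pred_of_set X|](_ : _ = setT) ?cardsT ?card_ffun ?card_ord //.
  apply/setP => f; rewrite !inE; apply/eqP/ffunP => c.
  by rewrite contentE big_ord0 al0.
have -> : [set f : {ffun 'I_M.+1 -> T} | content f == al] =
    [set f : {ffun 'I_(1 + M) -> T} | (content f == al) && const_first f].
  apply/setP => f; rewrite !inE andbC.
  by have -> : @const_first T 0 M f by apply/forallP => i; rewrite [i]ord1.
have ec := @card_const_first T 0 M al.
rewrite -[#|_|]/(#|[set f : {ffun 'I_(0.+1 + M) -> T} |
  (content f == al) && const_first f]|) ec {ec}.
rewrite big_distrl /= factS -sumal big_distrl /=.
rewrite [RHS](bigID (fun c => (0 < al c)%N)) /= [X in (_ + X)%N]big1 ?addn0; last first.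
  by move=> c; rewrite -eqn0Ngt => /eqP ->; rewrite mul0n.
apply: eq_bigr => c alc; rewrite -(IH [ffun d => al d - (c == d) * 1]%N); last first.
  apply/eqP; rewrite -(eqn_add2l 1) (add1n M) -sumal (bigD1 c) //= [X in _ == X](bigD1 c) //=.
  rewrite ffunE eqxx mul1n addnA subnKC // eqn_add2l; apply/eqP.
  by apply: eq_bigr => d; rewrite ffunE eq_sym => /negbTE ->; rewrite mul0n subn0.
rewrite mulnCA; congr (_ * _)%N.
rewrite (bigD1 c) //= [in RHS](bigD1 c) //= ffunE eqxx mul1n mulnA; congr (_ * _)%N.
  by rewrite -[in LHS](prednK alc) factS prednK // subn1.
by apply: eq_bigr => d; rewrite ffunE eq_sym => /negbTE ->; rewrite mul0n subn0.
Qed.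
End Multinomial.

Section FallingVandermonde.
Variables (A : comNzRingType) (l : nat).

(** Monic polynomials of degrees 0, 1, 2, ... differ from the powers by a
   unitriangular change of basis. *)
Lemma det_monic_poly (p : nat -> {poly A}) (x : 'I_l -> A) :
  (forall j, p j \is monic) -> (forall j, size (p j) = j.+1) ->
  \det (\matrix_(i < l, j < l) (p j).[x i]) =
  \prod_(i < l) \prod_(j < l | (i < j)%N) (x j - x i).
Proof.
move=> pm szp; pose U : 'M[A]_l := \matrix_(m, j) (p j)`_m.
have -> : \matrix_(i < l, j < l) (p j).[x i] = (Vandermonde l (\row_i x i))^T *m U.
  apply/matrixP => i j; rewrite !mxE (@horner_coef_wide _ l) ?szp //.
  by apply: eq_bigr => m _; rewrite !mxE mulrC.
rewrite det_mulmx det_tr det_Vandermonde.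
have -> : \det U = 1.
  rewrite -det_tr det_trig.
    rewrite big1 // => i _; rewrite !mxE; have := pm i.
    by rewrite monicE lead_coefE szp => /eqP.
  by apply/is_trig_mxP => i j ij; rewrite !mxE nth_default // szp.
rewrite mulr1; apply: eq_bigr => i _; apply: eq_bigr => j _; by rewrite !mxE.
Qed.

Lemma det_ffact (nu : 'I_l -> nat) :
  \det (\matrix_(i < l, j < l) ((nu i ^_ j)%:R : A)) =
  \prod_(i < l) \prod_(j < l | (i < j)%N) ((nu j)%:R - (nu i)%:R).
Proof.
pose p j : {poly A} := \prod_(m < j) ('X - (m%:R)%:P).
have pm j : p j \is monic by apply: monic_prod => i _; apply: monicXsubC.
have szp j : size (p j) = j.+1.
  rewrite /p -(big_mkord xpredT (fun m => 'X - (m%:R)%:P)).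
  rewrite -(big_map _ xpredT (fun z => 'X - z%:P)).
  by rewrite size_prod_XsubC size_map size_iota subn0.
rewrite -(det_monic_poly _ pm szp); congr (\det _); apply/matrixP => i j.
rewrite !mxE horner_prod ffact_prod natr_prod.
have [le|lt] := leqP j (nu i).
  apply: eq_bigr => m _; rewrite !hornerE natrB //.
  by apply: leq_trans le; apply: ltnW.
rewrite (bigD1 (Ordinal lt)) //= subnn mul0r.
by rewrite [RHS](bigD1 (Ordinal lt)) //= !hornerE subrr mul0r.
Qed.

End FallingVandermonde.

(** * Frobenius' formula for long cycles *)

Section VandermondeRatio.
Variables (A : comNzRingType) (l : nat).

Definition vandermonde (x : 'I_l -> A) :=
  \prod_(i < l) \prod_(j < l | (i < j)%N) (x j - x i).

(** Both products contain the factors of the Vandermonde product that do not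
   involve the index c, and the signs of the others agree. *)
Lemma vandermonde_change (x x' : 'I_l -> A) (c : 'I_l) :
  (forall j, j != c -> x' j = x j) ->
  vandermonde x' * \prod_(j < l | j != c) (x c - x j) =
  vandermonde x * \prod_(j < l | j != c) (x' c - x j).
Proof.
move=> e.
pose r (y : 'I_l -> A) (j : 'I_l) := if (c < j)%N then y j - y c else y c - y j.
have split_c y : vandermonde y = (\prod_(j < l | j != c) r y j) *
    \prod_(i < l | i != c) \prod_(j < l | (i < j)%N && (j != c)) (y j - y i).
  rewrite /vandermonde (bigD1 c) //=.
  have -> : \prod_(j < l | (c < j)%N) (y j - y c) =
      \prod_(j < l | j != c) (if (c < j)%N then y j - y c else 1).
    rewrite -big_mkcondr; apply: eq_bigl => j; case: ltnP => //=; rewrite ?andbF //.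
    by rewrite andbT -val_eqE /= => h; rewrite gtn_eqF.
  rewrite -big_split -big_split /=; apply: eq_bigr => i ic.
  rewrite /r; case: (ltnP c i) => [lt|le].
    congr (_ * _); apply: eq_bigl => j; case: (eqVneq j c) => [->|]; rewrite ?andbT //.
    by rewrite ltnNge (ltnW lt).
  have {le}lt : (i < c)%N by rewrite ltn_neqAle le andbT.
  by rewrite (bigD1 c) //= mul1r.
rewrite (split_c x) (split_c x').
have -> : \prod_(i < l | i != c) \prod_(j < l | (i < j)%N && (j != c)) (x' j - x' i) =
    \prod_(i < l | i != c) \prod_(j < l | (i < j)%N && (j != c)) (x j - x i).
  by apply: eq_bigr => i ic; apply: eq_bigr => j /andP[_ jc]; rewrite !e.
rewrite mulrAC [RHS]mulrAC; congr (_ * _); rewrite -!big_split /=.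
by apply: eq_bigr => j jc; rewrite /r e //; case: ifP => _; ring.
Qed.

End VandermondeRatio.

Section LongCycle.
Variables (k M : nat).
Local Notation N := (k.+1 + M)%N.

Definition cyc_fun (i : 'I_N) : 'I_N :=
  match split i with inl a => lshift M (ordS a) | inr b => rshift k.+1 b end.

Lemma cyc_funl a : cyc_fun (lshift M a) = lshift M (ordS a).
Proof. by rewrite /cyc_fun (unsplitK (inl a)). Qed.
Lemma cyc_funr b : cyc_fun (rshift k.+1 b) = rshift k.+1 b.
Proof. by rewrite /cyc_fun (unsplitK (inr b)). Qed.

Lemma cyc_fun_inj : injective cyc_fun.
Proof.
move=> i j; case: (split_ordP i) => a ->; case: (split_ordP j) => b ->;
  rewrite ?cyc_funl ?cyc_funr => /eqP.
- by rewrite eq_lshift => /eqP /(can_inj (@ordSK _)) ->.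
- by rewrite eq_lrshift.
- by rewrite eq_rlshift.
- by rewrite eq_rshift => /eqP ->.
Qed.

Definition cyc : 'S_N := perm cyc_fun_inj.

Lemma cycl a : cyc (lshift M a) = lshift M (ordS a).
Proof. by rewrite permE cyc_funl. Qed.
Lemma cycr b : cyc (rshift k.+1 b) = rshift k.+1 b.
Proof. by rewrite permE cyc_funr. Qed.

Lemma stab_cyc (T : finType) (f : {ffun 'I_N -> T}) :
  (cyc \in stab f) = const_first f.
Proof.
apply/stabP/forallP => [h i|h i].
  apply/eqP; case: i => m; elim: m => [|m IH] lt; first by congr (f _); apply: val_inj.
  rewrite -(IH (ltnW lt)) -(h (lshift M (Ordinal (ltnW lt)))) cycl; congr (f _).
  by apply: val_inj; rewrite /= modn_small.
case: (split_ordP i) => a ->; last by rewrite cycr.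
by rewrite cycl (eqP (h _)) (eqP (h a)).
Qed.

Lemma cyc_expr m : (m < k.+1)%N -> (cyc ^+ m)%g (lshift M ord0) = lshift M (inord m).
Proof.
elim: m => [|m IH] lt.
  by rewrite expg0 perm1; congr lshift; apply: val_inj; rewrite /= inordK.
rewrite expgSr permM IH 1?ltnW // cycl; congr lshift; apply: val_inj.
by rewrite /= !inordK ?modn_small // ltnW.
Qed.

Lemma cycle_type_cyc : cycle_type cyc = k.+1 :: nseq M 1%N.
Proof.
pose L : {set 'I_N} := [set lshift M i | i : 'I_k.+1].
have orbr b : porbit cyc (rshift k.+1 b) = [set rshift k.+1 b].
  apply/setP => x; rewrite inE; apply/porbitP/eqP => [[m ->]|->]; last by exists 0%N; rewrite perm1.
  by elim: m => [|m IH]; rewrite ?expg0 ?perm1 // expgSr permM IH cycr.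
have orbl a : porbit cyc (lshift M a) = L.
  have e0 : porbit cyc (lshift M a) = porbit cyc (lshift M ord0).
    apply/eqP; rewrite eq_porbit_mem; apply/porbitP; exists a.
    by rewrite cyc_expr // inord_val.
  rewrite e0; apply/setP => x; apply/porbitP/imsetP => [[m ->]|[i _ ->]].
    elim: m => [|m [i _ IH]]; first by exists ord0 => //; rewrite perm1.
    by exists (ordS i) => //; rewrite expgSr permM IH cycl.
  by exists i; rewrite cyc_expr // inord_val.
pose S : {set {set 'I_N}} := [set [set rshift k.+1 b] | b : 'I_M].
have orbs : porbits cyc = L |: S.
  apply/setP => B; rewrite in_setU1; apply/imsetP/orP => [[x _ ->]|[/eqP ->|/imsetP[b _ ->]]].
  - case: (split_ordP x) => a ->; rewrite ?orbl ?orbr; [by left | right].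
    by apply/imsetP; exists a.
  - by exists (lshift M ord0) => //; rewrite -/(porbit _ _) orbl.
  - by exists (rshift k.+1 b) => //; rewrite -/(porbit _ _) orbr.
have LS : L \notin S.
  apply/imsetP => -[b _ e]; have : lshift M ord0 \in L by apply/imsetP; exists ord0.
  by rewrite e inE eq_lrshift.
have cL : #|L| = k.+1 by rewrite card_imset ?card_ord //; apply: lshift_inj.
have cS : #|S| = M.
  rewrite card_imset ?card_ord // => a b /set1_inj; exact: rshift_inj.
apply: sorted_geq_eq; first exact: sorted_geq_sort.
  by rewrite /= path_min_sorted ?all_nseq ?orbT //; elim: (M) => //= -[|m].
rewrite perm_sort.
have pe : perm_eq (enum (porbits cyc)) (L :: enum S).
  apply: uniq_perm; rewrite ?enum_uniq //= ?mem_enum ?LS ?enum_uniq // => B.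
  by rewrite mem_enum orbs in_setU1 inE mem_enum.
rewrite (perm_trans (perm_map _ pe)) //= cL perm_cons.
have -> : [seq #|B| | B : {set 'I_N} <- enum S] = nseq M 1%N.
  transitivity (nseq (size (enum S)) 1%N); last by rewrite -cardE cS.
  rewrite -(size_map (fun B : {set 'I_N} => #|B|)); apply/all_pred1P/allP => x.
  by move=> /mapP[B]; rewrite mem_enum => /imsetP[b _ ->] ->; rewrite cards1 /=.
exact: perm_refl.
Qed.

Lemma fixed_colourings_cyc (T : finType) (al : {ffun T -> nat}) :
  fixed_colourings al cyc = (\sum_(c | (k < al c)%N)
     #|[set f : {ffun 'I_M -> T} | content f == [ffun d => al d - (c == d) * k.+1]%N]|)%N.
Proof.
rewrite -card_const_first; congr #|pred_of_set _|; apply/setP => f.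
by rewrite [LHS]in_set [RHS]in_set stab_cyc.
Qed.

End LongCycle.

Lemma fixed_colourings1 N (T : finType) (al : {ffun T -> nat}) :
  fixed_colourings al (1%g : 'S_N) = #|[set f : {ffun 'I_N -> T} | content f == al]|.
Proof.
congr #|pred_of_set _|; apply/setP => f.
by rewrite [LHS]in_set [RHS]in_set group1 andbT.
Qed.

Section FrobeniusFormula.
Variables (l : nat).

(** Since 1 / (nu_i - j)! = nu_i (nu_i - 1) ... (nu_i - j + 1) / nu_i!, the
   alternating sum of multinomial coefficients is a determinant of falling
   factorials. *)
Lemma sum_sign_card_content m (nu : 'I_l -> nat) :
  (forall i, (l <= nu i)%N) -> (\sum_i nu i = m + \sum_(i < l) i)%N ->
  \sum_(w : 'S_l) (-1) ^+ (w : bool) *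
     #|[set f : {ffun 'I_m -> 'I_l} | content f == shifted nu w]|%:R =
  m`!%:R * vandermonde (fun i => (nu i)%:R) / \prod_i (nu i)`!%:R :> algC.
Proof.
move=> nu_ge sum_nu; rewrite /vandermonde -det_ffact /determinant mulr_sumr mulr_suml.
have fn0 (a : nat) : a`!%:R != 0 :> algC by rewrite pnatr_eq0 -lt0n fact_gt0.
have pn0 (h : 'I_l -> nat) : \prod_i (h i)`!%:R != 0 :> algC.
  by apply/prodf_neq0 => i _; apply: fn0.
apply: eq_bigr => w _; rewrite [m`!%:R * _]mulrCA -mulrA; congr (_ * _).
apply: (mulIf (pn0 (shifted nu w))).
rewrite -[X in _ * X = _]natr_prod -natrM card_content; last exact: sum_shifted.
rewrite mulrAC -mulrA -mulrA -[LHS]mulr1; congr (_ * _).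
apply: (mulIf (pn0 nu)); rewrite mul1r -!mulrA mulVf // mulr1 mulrC -big_split /=.
apply: eq_bigr => i _; rewrite mxE ffunE -natrM mulnC ffact_fact //.
by apply: leq_trans (nu_ge i); apply: ltnW.
Qed.

(** Frobenius' formula. A colouring fixed by a cycle of length k + 1 gives it
   one colour c, and restricts to a colouring of the other M points with nu_c
   lowered by k + 1; both values of the character are then Vandermonde
   products. *)
Lemma frob_char_cyc k M (nu : 'I_l -> nat) : injective nu ->
  (forall i, (k.+1 + l <= nu i)%N) ->
  (\sum_i nu i = (k.+1 + M) + \sum_(i < l) i)%N ->
  ((k.+1 + M) ^_ k.+1)%:R * frob_char (k.+1 + M) nu (cyc k M)
    / frob_char (k.+1 + M) nu 1%g =
  \sum_c (nu c ^_ k.+1)%:R * (\prod_(j < l | j != c) ((nu c)%:R - k.+1%:R - (nu j)%:R))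
    / \prod_(j < l | j != c) ((nu c)%:R - (nu j)%:R) :> algC.
Proof.
move=> nu_inj nu_ge sum_nu.
have nu_ge' i : (l <= nu i)%N by apply: leq_trans (nu_ge i); apply: leq_addl.
have fn0 (a : nat) : a`!%:R != 0 :> algC by rewrite pnatr_eq0 -lt0n fact_gt0.
have pn0 (h : 'I_l -> nat) : \prod_i (h i)`!%:R != 0 :> algC.
  by apply/prodf_neq0 => i _; apply: fn0.
have f1 : frob_char (k.+1 + M) nu 1%g =
    (k.+1 + M)`!%:R * vandermonde (fun i => (nu i)%:R) / \prod_i (nu i)`!%:R.
  rewrite -sum_sign_card_content // /frob_char sum_cfunE; apply: eq_bigr => w _.
  by rewrite cfunE colouring_charE fixed_colourings1.
pose nuc c d := (nu d - (c == d) * k.+1)%N.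
have fc : frob_char (k.+1 + M) nu (cyc k M) =
    \sum_c M`!%:R * vandermonde (fun i => (nuc c i)%:R) / \prod_i (nuc c i)`!%:R.
  have sum_nuc c : (\sum_i nuc c i = M + \sum_(i < l) i)%N.
    apply/eqP; rewrite -(eqn_add2l k.+1) addnA -sum_nu (bigD1 c) //= [X in _ == X](bigD1 c) //=.
    rewrite /nuc eqxx mul1n addnA subnKC; last by apply: leq_trans (nu_ge c); apply: leq_addr.
    rewrite eqn_add2l; apply/eqP; apply: eq_bigr => d.
    by rewrite eq_sym => /negbTE ->; rewrite mul0n subn0.
  have nuc_ge c i : (l <= nuc c i)%N.
    by rewrite /nuc; have := nu_ge i; case: (_ == _); lia.
  under eq_bigr do rewrite -sum_sign_card_content //.
  rewrite exchange_big /frob_char sum_cfunE; apply: eq_bigr => w _.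
  rewrite cfunE colouring_charE fixed_colourings_cyc -mulr_sumr natr_sum; congr (_ * _).
  apply: eq_big => [c|c _].
    by rewrite ffunE; have := nu_ge c; have := ltn_ord (w c); lia.
  congr (_%:R); congr #|pred_of_set _|; apply/setP => f; rewrite !inE; congr (_ == _).
  by apply/ffunP => d; rewrite !ffunE subnAC.
have dn0 c : \prod_(j < l | j != c) ((nu c)%:R - (nu j)%:R) != 0 :> algC.
  apply/prodf_neq0 => j jc; rewrite subr_eq0 eqr_nat; apply: contra jc => /eqP e.
  by apply/eqP/nu_inj.
have vn0 : vandermonde (fun i => (nu i)%:R) != 0 :> algC.
  apply/prodf_neq0 => i _; apply/prodf_neq0 => j ij; rewrite subr_eq0 eqr_nat.
  by apply: contraTneq ij => /nu_inj ->; rewrite ltnn.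
rewrite f1 fc mulr_sumr mulr_suml; apply: eq_bigr => c _.
have := @vandermonde_change algC l (fun i => (nu i)%:R) (fun i => (nuc c i)%:R) c.
have -> : (nuc c c)%:R = (nu c)%:R - k.+1%:R :> algC.
  rewrite /nuc eqxx mul1n natrB //; apply: leq_trans (nu_ge c); exact: leq_addr.
have h j : j != c -> (nuc c j)%:R = (nu j)%:R :> algC.
  by rewrite /nuc eq_sym => /negbTE ->; rewrite mul0n subn0.
move=> /(_ h) vc.
have ff : (\prod_i (nu i)`!)%:R = (nu c ^_ k.+1)%:R * \prod_i (nuc c i)`!%:R :> algC.
  rewrite natr_prod (bigD1 c) //= [in RHS](bigD1 c) //= mulrA; congr (_ * _).
    rewrite -natrM /nuc eqxx mul1n ffact_fact //.
    by apply: leq_trans (nu_ge c); apply: leq_addr.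
  by apply: eq_bigr => j jc; rewrite /nuc eq_sym (negbTE jc) mul0n subn0.
rewrite natr_prod in ff.
have fN : (k.+1 + M)`!%:R = ((k.+1 + M) ^_ k.+1)%:R * M`!%:R :> algC.
  by rewrite -natrM -{3}(addKn k.+1 M) ffact_fact // leq_addr.
rewrite fN ff.
move: vc (dn0 c) vn0 (pn0 (nuc c)) (pn0 nu) (fn0 M) (fn0 (k.+1 + M)%N); rewrite ff fN.
set V' := vandermonde _; set V := vandermonde _; set D := \prod_(j < l | _) _.
set D' := \prod_(j < l | _) _; set pr := \prod_i _.
set a := (nu c ^_ k.+1)%:R; set b := (_ ^_ _)%:R; set m := M`!%:R.
rewrite !mulf_eq0 !negb_or => vc D0 V0 pr0 /andP[a0 _] m0 /andP[b0 _].
apply: (mulIf D0); rewrite mulfVK //.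
transitivity ((V' * D) * (a / V)); last first.
  by rewrite vc; field.
by field; rewrite ?a0 ?b0 ?m0 ?pr0 ?V0.
Qed.

End FrobeniusFormula.

(** * Rows and columns of Young diagrams *)

Lemma sum_reshape sh N (F : nat -> nat -> nat) : sumn sh = N ->
  (\sum_(x < N) F (reshape_index sh x) (reshape_offset sh x) =
   \sum_(c < size sh) \sum_(j < nth 0 sh c) F c j)%N.
Proof.
move=> <-; elim: sh F => [|n sh IH] F /=; first by rewrite !big_ord0.
rewrite big_split_ord big_ord_recl /=; congr (_ + _)%N.
  apply: eq_bigr => x _; have h : (x < nth 0 (n :: sh) 0)%N by [].
  have e1 : reshape_index (n :: sh) x = 0%N := flatten_indexKl h.
  have e2 : reshape_offset (n :: sh) x = x := flatten_indexKr h.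
  by rewrite /= e1 e2.
rewrite -(IH (fun c j => F c.+1 j)); apply: eq_bigr => x _.
have h := reshape_offsetP (ltn_ord x).
have e : (n + x)%N = flatten_index (n :: sh) (reshape_index sh x).+1 (reshape_offset sh x).
  by rewrite -{1}(reshape_indexK sh x) /flatten_index /= addnA.
by rewrite e flatten_indexKl ?flatten_indexKr.
Qed.

Lemma sum_ord_geq n i : (i <= n)%N -> (\sum_(j < n | (i <= j)%N) 1 = n - i)%N.
Proof.
move=> le; apply/eqP; rewrite -(eqn_add2l i) subnKC // -[X in _ == X]card_ord -sum1_card.
rewrite [X in _ == X](bigID (fun j : 'I_n => (i <= j)%N)) /= addnC eqn_add2l.
rewrite (eq_bigl (fun j : 'I_n => (j < i)%N)); last by move=> j; rewrite ltnNge.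
by rewrite -(big_ord_widen _ (fun=> 1%N) le) sum1_card card_ord.
Qed.

Section YoungDiagram.
Variables (k : nat) (l : 'I_k.+1 -> nat).
Hypothesis l_incr : forall i j : 'I_k.+1, (i < j)%N -> (l i < l j)%N.
Hypothesis l_gt0 : forall i, (0 < l i)%N.

(** The rows are indexed from the shortest one, so that nu_i = l_i + i is
   increasing, while the parts of a partition decrease. *)
Definition rows_part : seq nat := [seq l (rev_ord i) | i <- enum 'I_k.+1].

Lemma size_rows_part : size rows_part = k.+1.
Proof. by rewrite size_map size_enum_ord. Qed.

Lemma nth_rows_part (i : 'I_k.+1) : nth 0%N rows_part i = l (rev_ord i).
Proof. by rewrite (nth_map ord0) ?size_enum_ord // nth_ord_enum. Qed.

Lemma sumn_rows_part : sumn rows_part = (\sum_i l i)%N.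
Proof.
by rewrite sumnE big_map big_enum /= [RHS](reindex_inj rev_ord_inj).
Qed.

Lemma rows_part_is_part : is_part_of (\sum_i l i) rows_part.
Proof.
apply/and3P; split; last by rewrite sumn_rows_part.
  rewrite (sorted_pairwise geq_trans); apply/(pairwiseP 0%N) => i j.
  rewrite !inE size_rows_part => li lj ij.
  rewrite (nth_rows_part (Ordinal li)) (nth_rows_part (Ordinal lj)) /=; apply/ltnW/l_incr => /=.
  by rewrite subSS; lia.
by apply/mapP => -[i _ e]; have := l_gt0 (rev_ord i); rewrite -e.
Qed.

Lemma head_rows_part : head 0%N rows_part = l ord_max.
Proof.
rewrite -nth0 -[0%N]/(val (ord0 : 'I_k.+1)) nth_rows_part; congr l; apply: val_inj.
by rewrite /= subn1.
Qed.

Lemma l_mono (i j : 'I_k.+1) : (i <= j)%N -> (l i <= l j)%N.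
Proof.
by rewrite leq_eqVlt => /orP[/eqP/val_inj -> //|/l_incr/ltnW].
Qed.

Lemma nth_conj c : nth 0%N (conj_part rows_part) c = (\sum_(i < k.+1) (c < l i))%N.
Proof.
have e : count (fun r => c < r)%N rows_part = (\sum_(i < k.+1) (c < l i))%N.
  rewrite count_map -sum1_count big_mkcond big_enum /= [RHS](reindex_inj rev_ord_inj).
  by apply: eq_bigr => i _; case: (_ < _)%N.
have [lt|le] := ltnP c (l ord_max).
  by rewrite /conj_part nth_mkseq ?head_rows_part.
rewrite nth_default; last by rewrite size_mkseq head_rows_part.
rewrite big1 // => i _; rewrite ltnNge (leq_trans _ le) //.
by apply: l_mono; rewrite -ltnS.
Qed.

Lemma size_conj : size (conj_part rows_part) = l ord_max.
Proof. by rewrite size_mkseq head_rows_part. Qed.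

(** The rows that meet a column are the longest ones. *)
Lemma conj_gt c (i : 'I_k.+1) :
  (k - i < nth 0%N (conj_part rows_part) c)%N = (c < l i)%N.
Proof.
have lti := ltn_ord i.
rewrite nth_conj; case: (ltnP c (l i)) => [lt|le].
  have : (\sum_(j < k.+1 | (i <= j)%N) 1 <= \sum_(j < k.+1) (c < l j))%N.
    rewrite big_mkcond; apply: leq_sum => j _; case: (leqP i j) => // ij.
    by rewrite (leq_trans lt) // l_mono.
  by rewrite sum_ord_geq ?subSn // ltnW.
apply/negbTE; rewrite -leqNgt.
have : (\sum_(j < k.+1) (c < l j) <= \sum_(j < k.+1 | (i < j)%N) 1)%N.
  rewrite [X in (_ <= X)%N]big_mkcond; apply: leq_sum => j _.
  case: (ltnP i j) => ji; first exact: leq_b1.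
  by rewrite ltnNge (leq_trans _ le) // l_mono.
by move/leq_trans; apply; rewrite sum_ord_geq.
Qed.

Variable N : nat.
Hypothesis sum_l : (\sum_i l i = N)%N.

Let l' : {ffun 'I_k.+1 -> nat} := [ffun i => l i].

Let sumn_conj : sumn (conj_part rows_part) = N.
Proof.
rewrite -sum_l sumnE (big_nth 0%N) big_mkord size_conj.
transitivity (\sum_(c < l ord_max) \sum_(i < k.+1) (c < l i))%N.
  by apply: eq_bigr => c _; rewrite nth_conj.
rewrite exchange_big; apply: eq_bigr => i _ /=.
have le : (l i <= l ord_max)%N by apply: l_mono; rewrite -ltnS.
rewrite -[RHS]card_ord -sum1_card (big_ord_widen _ (fun=> 1%N) le) [RHS]big_mkcond.
by apply: eq_bigr => j _; case: (_ < _)%N.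
Qed.

Definition col_of (x : 'I_N) : nat := reshape_index (conj_part rows_part) x.

(** Points are numbered row by row; the colour is the row. *)
Lemma young_group_rows : exists f : {ffun 'I_N -> 'I_k.+1},
  content f = l' /\ young_group N rows_part = stab f.
Proof.
have sumom : sumn rows_part = N by rewrite sumn_rows_part.
have ltr (x : 'I_N) : (reshape_index rows_part x < k.+1)%N.
  by rewrite -size_rows_part reshape_indexP // sumom.
exists [ffun x => rev_ord (Ordinal (ltr x))]; split; last first.
  apply/val_inj/setP => s; rewrite !inE; apply: eq_forallb => x.
  by rewrite !ffunE (inj_eq rev_ord_inj).
apply/ffunP => i; rewrite contentE ffunE.
rewrite -[i]rev_ordK -nth_rows_part.
transitivity (\sum_(x < N) (reshape_index rows_part x == rev_ord i :> nat))%N.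
  by apply: eq_bigr => x _; rewrite ffunE (inj_eq rev_ord_inj) -val_eqE.
rewrite (sum_reshape (fun r _ => (r == rev_ord i :> nat) : nat) sumom) size_rows_part.
rewrite (bigD1 (rev_ord i)) //= eqxx sum_nat_const card_ord muln1 big1 ?addn0 // => j.
by rewrite -val_eqE /= => /negbTE ->; rewrite sum_nat_const muln0.
Qed.

(** Points are numbered column by column; the colour of the m-th point of a
   column is the m-th longest row. *)
Lemma exists_row_colouring : exists f : {ffun 'I_N -> 'I_k.+1},
  content f = l' /\ (forall x y, f x = f y -> col_of x = col_of y -> x = y).
Proof.
pose off (x : 'I_N) := reshape_offset (conj_part rows_part) x.
have lto (x : 'I_N) : (off x < k.+1)%N.
  have h : (x < sumn (conj_part rows_part))%N by rewrite sumn_conj.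
  rewrite ltnS -ltnS; apply: leq_trans (reshape_offsetP h) _.
  rewrite nth_conj -[X in (_ <= X)%N]card_ord -sum1_card; apply: leq_sum => i _.
  by case: (_ < _)%N.
exists [ffun x => rev_ord (Ordinal (lto x))]; split; last first.
  move=> x y; rewrite !ffunE => /rev_ord_inj /(congr1 val) /= oxy cxy.
  by apply: val_inj; rewrite /= -(reshape_indexK (conj_part rows_part) x)
    -(reshape_indexK (conj_part rows_part) y) -/(off x) oxy -/(col_of x) cxy.
apply/ffunP => i; rewrite contentE ffunE.
transitivity (\sum_(x < N) (off x == k - i :> nat))%N.
  apply: eq_bigr => x _; rewrite ffunE -{1}[i]rev_ordK (inj_eq rev_ord_inj) -val_eqE.
  by rewrite /= subSS.
rewrite (sum_reshape (fun _ j => (j == (k - i)%N :> nat) : nat) sumn_conj) size_conj.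
transitivity (\sum_(c < l ord_max) (c < l i))%N.
  apply: eq_bigr => c _; rewrite -conj_gt; case: ltnP => [lt|le].
    rewrite (bigD1 (Ordinal lt)) //= eqxx big1 // => j.
    by rewrite -val_eqE /= => /negbTE ->.
  by rewrite big1 // => j _; rewrite ltn_eqF // (leq_trans (ltn_ord j)).
have le : (l i <= l ord_max)%N by apply: l_mono; rewrite -ltnS.
rewrite -[RHS]card_ord -sum1_card (big_ord_widen _ (fun=> 1%N) le) [RHS]big_mkcond.
by apply: eq_bigr => j _; case: (_ < _)%N.
Qed.

Let nu (i : 'I_k.+1) := (l i + i)%N.

Let nu_shift (w : 'S_k.+1) i : (w i <= k)%N. Proof. by rewrite -ltnS. Qed.

(** Suppose that colours and columns separate the points. Then a column has at
   most one point of each colour, hence at most as many points of colour at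
   least j as it has boxes in the rows j, ..., k, and there are at most l_j +
   ... + l_k points of colour at least j in all. For the content nu - w this
   says that w_j + ... + w_k is at least j + ... + k for all j, whence w = 1.
   *)
Lemma shifted_not_injective (w : 'S_k.+1) (f : {ffun 'I_N -> 'I_k.+1}) :
  (forall i, (k < l i)%N) -> w != 1%g -> content f = shifted nu w ->
  exists x y, [/\ x != y, f x = f y & col_of x = col_of y].
Proof.
move=> lk w1 cf.
case: (boolP [exists x, exists y, [&& x != y, f x == f y & col_of x == col_of y]]).
  move=> /existsP[x /existsP[y /and3P[xy /eqP fxy /eqP cxy]]]; by exists x, y.
move=> no; have inj x y : f x = f y -> col_of x = col_of y -> x = y.
  move=> fxy cxy; apply/eqP; apply: contraNT no => xy; apply/existsP; exists x.
  by apply/existsP; exists y; rewrite xy fxy cxy !eqxx.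
have colc c : (\sum_(x < N) (col_of x == c) = nth 0 (conj_part rows_part) c)%N.
  rewrite (sum_reshape (fun d _ => (d == c) : nat) sumn_conj).
  have [lt|le] := ltnP c (size (conj_part rows_part)).
    rewrite (bigD1 (Ordinal lt)) //= eqxx sum_nat_const card_ord muln1 big1 ?addn0 // => j.
    by rewrite -val_eqE /= => /negbTE ->; rewrite sum_nat_const muln0.
  rewrite nth_default // big1 // => j _; rewrite ltn_eqF ?(leq_trans (ltn_ord j)) //.
  by rewrite sum_nat_const muln0.
have ltc x : (col_of x < l ord_max)%N.
  by rewrite -size_conj reshape_indexP // sumn_conj.
have bound (j : 'I_k.+1) : (\sum_(i < k.+1 | (j <= i)%N) content f i <=
    \sum_(i < k.+1 | (j <= i)%N) l i)%N.
  have -> : (\sum_(i < k.+1 | (j <= i)%N) content f i =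
      \sum_(c < l ord_max) \sum_(x < N | (j <= f x)%N) (col_of x == c))%N.
    rewrite exchange_big /= (eq_bigr (fun i => \sum_(x < N) (f x == i))%N); last first.
      by move=> i _; rewrite contentE.
    rewrite exchange_big /= [RHS]big_mkcond; apply: eq_bigr => x _ /=.
    case: (leqP j (f x)) => [le|lt].
      rewrite (bigD1 (f x)) //= eqxx big1 ?addn0 => [|i /andP[_ /negbTE]]; last first.
        by rewrite eq_sym => ->.
      rewrite (bigD1 (Ordinal (ltc x))) //= eqxx big1 // => c.
      by rewrite -val_eqE /= eq_sym => /negbTE ->.
    by rewrite big1 // => i; case: eqP => // <-; rewrite leqNgt lt.
  have -> : (\sum_(i < k.+1 | (j <= i)%N) l i =
      \sum_(c < l ord_max) \sum_(i < k.+1 | (j <= i)%N) (c < l i))%N.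
    rewrite exchange_big /=; apply: eq_bigr => i _.
    have le : (l i <= l ord_max)%N by apply: l_mono; rewrite -ltnS.
    rewrite -[LHS]card_ord -sum1_card (big_ord_widen _ (fun=> 1%N) le) [LHS]big_mkcond.
    by apply: eq_bigr => c _; case: (_ < _)%N.
  apply: leq_sum => c _; have [lt|le] := ltnP c (l j).
    rewrite [X in (_ <= X)%N](eq_bigr (fun=> 1%N)); last first.
      by move=> i ji; rewrite (leq_trans lt) // l_mono.
    rewrite sum_ord_geq; last by apply: ltnW.
    have -> : (\sum_(x < N | (j <= f x)%N) (col_of x == c) =
        #|[set x | (j <= f x)%N & col_of x == c]|)%N.
      rewrite -sum1_card big_mkcond [RHS]big_mkcond /=; apply: eq_bigr => x _.
      by rewrite inE; case: (_ <= _)%N => //; case: (_ == _).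
    rewrite -(card_in_imset (f := f)); last first.
      by move=> x y; rewrite !inE => /andP[_ /eqP cx] /andP[_ /eqP cy] /inj; apply; rewrite cx.
    rewrite -(sum_ord_geq (n := k.+1) (i := j)) ?(ltnW (ltn_ord j)) // sum1_card.
    apply/subset_leq_card/subsetP => y /imsetP[x]; rewrite inE => /andP[jx _] ->.
    exact: jx.
  apply: (@leq_trans (\sum_(x < N) (col_of x == c))).
    by rewrite [X in (X <= _)%N]big_mkcond; apply: leq_sum => x _; case: ifP.
  rewrite colc nth_conj [X in (_ <= X)%N]big_mkcond; apply: leq_sum => i _.
  case: (leqP j i) => // ij; rewrite ltnNge (leq_trans _ le) //.
  by apply: l_mono; apply: ltnW.
have wge (j : 'I_k.+1) :
    (\sum_(i < k.+1 | (j <= i)%N) i <= \sum_(i < k.+1 | (j <= i)%N) w i)%N.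
  rewrite -(leq_add2l (\sum_(i < k.+1 | (j <= i)%N) l i)) -big_split /=.
  rewrite (eq_bigr (fun i => content f i + w i)%N) ?big_split /= ?leq_add2r //.
  move=> i _; rewrite cf ffunE subnK // /nu.
  by apply: leq_trans (nu_shift w i) _; apply: leq_trans (leq_addr _ _); apply: ltnW.
case/eqP: w1; apply/permP => i; rewrite perm1.
have [m] := ubnP (k - i)%N; elim: m i => // m IH i lt.
have fixgt (j : 'I_k.+1) : (i < j)%N -> w j = j.
  by move=> ij; apply: IH; have := ltn_ord j; lia.
have le : (w i <= i)%N.
  rewrite leqNgt; apply/negP => gt; have := fixgt _ gt => /perm_inj e.
  by move: gt; rewrite e ltnn.
apply/val_inj/eqP; rewrite eqn_leq le /=; have := wge i.
rewrite (bigD1 i) //= [X in (_ <= X)%N](bigD1 i) //=.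
rewrite [X in (_ <= _ + X)%N](eq_bigr (fun j : 'I_k.+1 => j : nat)) ?leq_add2r //.
move=> j /andP[ij ji]; rewrite fixgt // ltn_neqAle ij andbT eq_sym.
by move: ji; rewrite -val_eqE.
Qed.

End YoungDiagram.

(** * The irreducible character of a partition *)

Section Specht.
Variables (k N : nat) (l : 'I_k.+1 -> nat).
Hypothesis l_incr : forall i j : 'I_k.+1, (i < j)%N -> (l i < l j)%N.
Hypothesis l_gt : forall i, (k < l i)%N.
Hypothesis sum_l : (\sum_i l i = N)%N.

Let nu (i : 'I_k.+1) := (l i + i)%N.
Let l' : {ffun 'I_k.+1 -> nat} := [ffun i => l i].

Lemma shifted_row_inj : injective nu.
Proof.
move=> i j; rewrite /nu => e; apply/val_inj.
by case: (ltngtP (i : nat) (j : nat)) => // h; have := l_incr h; move: e h; clear; lia.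
Qed.

Lemma cfInd_young (H : {group 'S_N}) (T : finType) (f : {ffun 'I_N -> T}) :
  H = stab f -> 'Ind[[set: 'S_N], H] 1 = colouring_char (content f).
Proof. by move=> ->; rewrite colouring_char_content. Qed.

Lemma cfInd_young_sgn (H : {group 'S_N}) (U : eqType) (col : 'I_N -> U) :
  H = stab col -> 'Ind[[set: 'S_N], H] ('Res[H] (cfSgn N)) = sgn_char col.
Proof. by move=> ->. Qed.

(** The common constituent chi of the two induced characters occurs in
   frob_char with positive multiplicity, since the terms with w <> 1 have no
   constituent in common with the sign character of the columns. As frob_char
   is a virtual character of norm 1, it is chi. *)
Lemma specht_frob_char : exists i : Iirr [set: 'S_N],
  specht_index (rows_part l) i /\ 'chi_i = frob_char N nu.
Proof.
have l_gt0 i : (0 < l i)%N by apply: leq_ltn_trans (l_gt i).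
have [f [cf yf]] := young_group_rows sum_l.
have [f0 [cf0 inj0]] := exists_row_colouring l_incr sum_l.
pose eps := sgn_char (@col_of k l N).
have eE : 'Ind[[set: 'S_N], young_group N (conj_part (rows_part l))]
    ('Res[young_group N (conj_part (rows_part l))] (cfSgn N)) = eps.
  by apply: cfInd_young_sgn; apply/val_inj.
have tE : 'Ind[[set: 'S_N], young_group N (rows_part l)] 1 = colouring_char l'.
  by rewrite (cfInd_young yf) cf.
have : '[colouring_char l', eps] != 0 by rewrite /l' -cf0; apply: dot_sgn_char_neq0.
rewrite cfdot_sum_irr => dn0.
have [i ti ei] : exists2 i, i \in irr_constt (colouring_char l') & i \in irr_constt eps.
  apply/exists_inP; apply: contraNT dn0; rewrite negb_exists_in => /forall_inP h.
  rewrite big1 // => i _; have := h i; rewrite !irr_consttE.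
  by case: eqP => [->|_ /(_ isT)]; rewrite ?mul0r // negbK => /eqP ->; rewrite rmorph0 mulr0.
exists i; split; first by rewrite /specht_index tE eE ti.
have sum_nu : (\sum_i nu i = N + \sum_(i < k.+1) i)%N by rewrite big_split /= sum_l.
have nu_ge j : (k.+1 <= nu j)%N by apply: leq_trans (l_gt j) (leq_addr _ _).
have dw w : w != 1%g -> '[colouring_char (shifted nu w) : 'CF([set: 'S_N]), 'chi_i] = 0.
  move=> w1; apply/eqP; apply/negPn/negP; rewrite -irr_consttE => wi.
  have := constt_ortho_char (colouring_char_char N (shifted nu w)) (sgn_char_char _) wi ei.
  rewrite cfnorm_irr => /(_ _)/eqP; rewrite oner_eq0 => /(_ _)/negP; apply=> //.
  apply: dot_sgn_char0 => g; exact: shifted_not_injective.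
have l'E : shifted nu 1%g = l'.
  by apply/ffunP => j; rewrite !ffunE perm1 /nu addnK.
have psi_i : '[frob_char N nu, 'chi_i] = '[colouring_char l', 'chi_i].
  rewrite /frob_char cfdot_suml (bigD1 1%g) //= odd_perm1 expr0 scale1r l'E.
  by rewrite big1 ?addr0 // => w /dw e; rewrite cfdotZl e mulr0.
have pos : 0 < '[frob_char N nu, 'chi_i].
  rewrite psi_i lt_def; apply/andP; split=> //.
  by apply: natr_ge0; apply: Cnat_cfdot_char_irr; apply: colouring_char_char.
have [b [j psiE]] := vchar_norm1P (frob_char_vchar N nu)
  (frob_char_norm shifted_row_inj nu_ge sum_nu).
move: pos; rewrite psiE cfdotZl cfdot_irr; case: eqP => [->|_]; last by rewrite mulr0 ltxx.
rewrite mulr1; case: b {psiE}; rewrite ?expr0 ?scale1r // expr1.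
by rewrite ltr0N1.
Qed.

End Specht.

(** The rows are long enough for nu_c - (k + 1) to exceed the exponents 0,
   ..., k of the determinants. *)
Lemma normalized_char_cycle k (l : 'I_k.+1 -> nat) :
  (forall i j : 'I_k.+1, (i < j)%N -> (l i < l j)%N) ->
  (forall i, (k.+1 + k.+1 <= l i)%N) ->
  exists (N : nat) (i : Iirr [set: 'S_N]) (s : 'S_N),
  [/\ (k.+1 <= N)%N, is_part_of N (rows_part l), specht_index (rows_part l) i,
    cycle_type s = k.+1 :: nseq (N - k.+1) 1%N &
    normalized_char k.+1 i s =
    \sum_c ((l c + c) ^_ k.+1)%:R *
       (\prod_(j < k.+1 | j != c) ((l c + c)%:R - k.+1%:R - (l j + j)%:R))
       / \prod_(j < k.+1 | j != c) ((l c + c)%:R - (l j + j)%:R)].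
Proof.
move=> l_incr l_ge.
have l_gt i : (k < l i)%N by apply: leq_trans (l_ge i); apply: leq_addr.
have [M sum_l] : exists M, (\sum_i l i = k.+1 + M)%N.
  exists (\sum_i l i - k.+1)%N; rewrite subnKC // (bigD1 ord0) //=.
  by apply: leq_trans (leq_addr _ _); apply: leq_trans (l_ge ord0); apply: leq_addr.
have [i [si chi_i]] := specht_frob_char l_incr l_gt sum_l.
exists (k.+1 + M)%N, i, (cyc k M); split=> //.
- exact: leq_addr.
- by rewrite -sum_l; apply: rows_part_is_part => // j; apply: leq_ltn_trans (l_gt j).
- by rewrite addKn cycle_type_cyc.
rewrite /normalized_char chi_i frob_char_cyc //.
- exact: shifted_row_inj.
- by move=> j; apply: leq_trans (l_ge j) (leq_addr _ _).
- by rewrite big_split /= sum_l.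
Qed.

(** * The cumulant equation of a partition *)

Lemma eqmods_cumulant_eqn (A : comNzRingType) l (x : 'I_l -> A) n (R R' : series A) :
  eqmods n R R' -> eqmods n (cumulant_eqn x R) (cumulant_eqn x R').
Proof.
move=> e i lin; rewrite /cumulant_eqn !coefsB; congr (_ - _).
  apply: (@eqmodsM _ n) lin => [j lj|]; first by rewrite !coefsD e.
  by apply: eqmods_prod => a j lj; rewrite !coefsB e.
by apply: (@eqmods_prod _ n) lin => a j lj; rewrite !coefsB e.
Qed.

(** R_1 = 0, since the x_i, y_i of a diagram have equal sums. *)
Lemma cumulant_eqn_coef1 (A : comNzRingType) l (x : 'I_l -> A) (R : series A) :
  R 0%N = 1 -> cumulant_eqn x R = 0 -> R 1%N = 0.
Proof.
move=> R0 e; have := congr1 (fun f : series A => f 1%N) e.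
have c0 (a : A) : (R - scst a * svar A) 0%N = 1.
  by rewrite coefsB coefs_cstM mulr0 subr0.
have c1 (a : A) : (R - scst a * svar A) 1%N = R 1%N - a.
  by rewrite coefsB coefs_cstM mulr1.
have prod1 (y : 'I_l -> A) : (\prod_i (R - scst (y i) * svar A)) 0%N = 1 /\
    (\prod_i (R - scst (y i) * svar A)) 1%N = \sum_i (R 1%N - y i).
  elim/big_rec2: _ => [|i a f _ [f0 f1]]; first by rewrite coefs1.
  rewrite coefsM0 c0 mul1r f0; split=> //.
  by rewrite coefsM big_ord_recl big_ord1 /= /bump /= c0 c1 f0 f1 mul1r mulr1 addrC.
have [p0 p1] := prod1 x; have [q0 q1] := prod1 (fun i => x i - 1).
rewrite /cumulant_eqn coefsB q1 coefsM big_ord_recl big_ord1 /= /bump /=.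
rewrite p0 p1 !coefsD R0 !coefs_cstM mulr0 !mulr1 addr0 mul1r.
have -> : \sum_i (R 1%N - (x i - 1)) = \sum_i (R 1%N - x i) + l%:R.
  have -> : l%:R = \sum_(i < l) 1 :> A by rewrite sumr_const card_ord.
  rewrite -big_split /=.
  by apply: eq_bigr => i _; rewrite opprB addrA addrAC.
by rewrite coefs0 => <-; ring.
Qed.

Lemma smap_cumulant_eqn (A B : comNzRingType) (g : {rmorphism A -> B}) l
    (x : 'I_l -> A) (R : series A) :
  smap g (cumulant_eqn x R) = cumulant_eqn (fun i => g (x i)) (smap g R).
Proof.
rewrite /cumulant_eqn rmorphB rmorphM rmorphD rmorphM /= smap_cst rmorph_nat smapX.
rewrite !rmorph_prod; congr (_ * _ - _); apply: eq_bigr => i _;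
  by rewrite rmorphB rmorphM /= smap_cst smapX ?rmorphB ?rmorph1.
Qed.

Lemma smap_corner_ratio (A B : comNzRingType) (g : {rmorphism A -> B}) l
    (x : 'I_l -> A) :
  smap g (corner_ratio x) = corner_ratio (fun i => g (x i)).
Proof.
have c0 (a : A) : (1 - scst a * svar A) 0%N = 1.
  by rewrite coefsB coefs_cstM mulr0 subr0.
rewrite /corner_ratio rmorphM /= smapV; last first.
  rewrite coefsM0 coefsD coefs_cstM mulr0 addr0 mul1r coefs_prod0 big1 //.
rewrite rmorphM rmorphD rmorph1 rmorphM /= smap_cst rmorph_nat smapX !rmorph_prod.
by congr (_ * sinv (_ * _)); apply: eq_bigr => i _;
  rewrite rmorphB rmorph1 rmorphM /= smap_cst smapX ?rmorphB ?rmorph1.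
Qed.

Section Corners.
Variables (k : nat) (l : 'I_k.+1 -> nat).
Hypothesis l_incr : forall i j : 'I_k.+1, (i < j)%N -> (l i < l j)%N.
Hypothesis l_gt0 : forall i, (0 < l i)%N.

Lemma nth_rows_part_decr i : (i <= k)%N ->
  (nth 0 (rows_part l) i.+1 < nth 0 (rows_part l) i)%N.
Proof.
move=> le; have lti : (i < k.+1)%N by [].
rewrite -[i in X in (_ < X)%N]/(val (Ordinal lti)) nth_rows_part.
have [lt|ge] := ltnP i.+1 k.+1; last by rewrite nth_default ?size_rows_part // l_gt0.
rewrite -[i.+1]/(val (Ordinal lt)) nth_rows_part; apply: l_incr => /=; lia.
Qed.

(** The content of the box that could be added to the row of length l i, which
   has k - i longer rows below it (in the French convention). *)
Definition corner (i : 'I_k.+1) : int := (l i)%:Z - (k - i)%N%:Z.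

Lemma lin_prodE s :
  lin_prod s = \prod_(a <- s) (1 - scst a * svar int).
Proof. by apply: eq_bigr => a _; rewrite sscaleE. Qed.

(** As the rows are distinct, each of them ends with an addable and a removable
   box. *)
Lemma Hseries_rows_part : Hseries (rows_part l) = svar int * corner_ratio corner.
Proof.
rewrite /Hseries smulE sdivE; congr (_ * _); rewrite /corner_ratio !lin_prodE.
have -> : removable_contents (rows_part l) =
    [seq (nth 0%N (rows_part l) i)%:Z - 1 - i%:Z | i <- iota 0 k.+1].
  rewrite /removable_contents size_rows_part; congr map; apply/all_filterP/allP => i.
  by rewrite mem_iota /= add0n ltnS => /nth_rows_part_decr.
have -> : addable_contents (rows_part l) =
    [seq (nth 0%N (rows_part l) i)%:Z - i%:Z | i <- iota 0 k.+2].
  rewrite /addable_contents size_rows_part; congr map; apply/all_filterP/allP => i.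
  rewrite mem_iota /= add0n ltnS; case: i => // i.
  by rewrite ltnS => /nth_rows_part_decr.
rewrite !big_map -!/(index_iota 0 _) ?subn0.
have -> : iota 0 k.+1 = index_iota 0 k.+1 by rewrite /index_iota subn0.
have -> : iota 0 k.+2 = index_iota 0 k.+2 by rewrite /index_iota subn0.
rewrite !big_mkord [\prod_(i < k.+2) _]big_ord_recr /=.
rewrite nth_default ?size_rows_part // sub0r rmorphN mulNr opprK.
rewrite [X in sinv X]mulrC.
have nthE (i : 'I_k.+1) : (nth 0%N (rows_part l) i)%:Z - i%:Z = corner (rev_ord i).
  by rewrite nth_rows_part /corner /= subSS subKn // -ltnS.
congr (_ * sinv (_ * _)).
- rewrite [RHS](reindex_inj rev_ord_inj) /=; apply: eq_bigr => i _.
  by rewrite addrAC nthE.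
- by rewrite natz.
- rewrite [RHS](reindex_inj rev_ord_inj) /=; apply: eq_bigr => i _.
  by rewrite nthE.
Qed.

End Corners.

(** * Homogeneity *)

Section Weight.
Variable k : nat.
Local Notation QR := {mpoly rat[k]}.

(** The substitution of R_i u^i for R_i. *)
Definition weighted : {rmorphism QR -> {poly QR}} :=
  mmap ((polyC \o (@mpolyC k rat)) : rat -> {poly QR})
       (fun j : 'I_k => 'X_j *: 'X^(j.+2)).

Lemma map_weight_part (Sigma : {mpoly int[k]}) w :
  map_mpoly (intr : int -> rat) (weight_part w Sigma) =
  (weighted (map_mpoly (intr : int -> rat) Sigma))`_w.
Proof.
rewrite /weight_part -[LHS](coef_map (map_mpoly (intr : int -> rat))).
congr ((_ : {poly QR})`_w).
have e : mmap (fun c : int => (c%:MP_[k])%:P)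
        (fun j : 'I_k => 'X_j *: 'X^(j.+2)) Sigma =
   mmap ((polyC \o (@mpolyC k int)) : int -> {poly {mpoly int[k]}})
       (fun j : 'I_k => 'X_j *: 'X^(j.+2)) Sigma by [].
rewrite e [LHS]rmorph_mmap {e}.
have -> : map_mpoly (intr : int -> rat) Sigma =
    mmap ((@mpolyC k rat) \o (intr : int -> rat)) (fun i : 'I_k => 'X_i) Sigma by [].
rewrite [RHS]rmorph_mmap; apply: eq_mmap => [c|j] /=.
  by rewrite map_polyC /= map_mpolyC // mmapC.
by rewrite map_polyZ map_polyXn /= map_mpolyX mmapX mmap1U.
Qed.

(** The coefficient of t^n is homogeneous of weight n.  These series form a ring
   closed under D and inversion. *)
Definition graded (f : series QR) := forall n, weighted (f n) = f n *: 'X^n.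

Lemma graded1 : graded 1.
Proof. by case=> [|n]; rewrite coefs1 ?rmorph1 ?expr0 ?scale1r // rmorph0 scale0r. Qed.

Lemma gradedB f g : graded f -> graded g -> graded (f - g).
Proof. by move=> gf gg n; rewrite coefsB rmorphB gf gg scalerBl. Qed.

Lemma gradedD f g : graded f -> graded g -> graded (f + g).
Proof. by move=> gf gg n; rewrite coefsD rmorphD gf gg scalerDl. Qed.

Lemma gradedM f g : graded f -> graded g -> graded (f * g).
Proof.
move=> gf gg n; rewrite coefsM rmorph_sum scaler_suml; apply: eq_bigr => i _.
rewrite rmorphM gf gg -scalerAl -scalerAr scalerA -exprD subnKC //.
by rewrite -ltnS.
Qed.

Lemma gradedX f n : graded f -> graded (f ^+ n).
Proof.
move=> gf; elim: n => [|n IH]; first exact: graded1.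
by rewrite exprS; apply: gradedM.
Qed.

Lemma graded_cst (a : rat) : graded (scst a%:MP_[k]).
Proof.
case=> [|n]; rewrite /scst ?mulr0n ?rmorph0 ?scale0r // !mulr1n expr0 alg_polyC.
exact: mmapC.
Qed.

Lemma graded_nat m : graded m%:R.
Proof.
elim: m => [|m IH]; first by move=> n; rewrite rmorph0 scale0r.
by rewrite mulrS; apply: gradedD IH; apply: graded1.
Qed.

Lemma graded_sD f : graded f -> graded (sD f).
Proof. by move=> gf n; rewrite /sD rmorphMn gf /= scalerMnl. Qed.

Lemma graded_sinv f : graded f -> graded (sinv f).
Proof.
move=> gf n; rewrite /sinv rmorph_sum scaler_suml; apply: eq_bigr => j _.
by rewrite sexpE; apply/gradedX/gradedB => //; apply: graded1.
Qed.

Lemma graded_prod I (r : seq I) (F : I -> series QR) :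
  (forall i, graded (F i)) -> graded (\prod_(i <- r) F i).
Proof. by move=> gF; elim/big_rec: _ => [|i x _]; [exact: graded1 | apply: gradedM]. Qed.

Lemma graded_Rvar : graded (Rvar k).
Proof.
move=> [|[|j]]; rewrite /Rvar ?rmorph0 ?scale0r //.
case: insubP => [i _ <-|_]; last by rewrite rmorph0 scale0r.
by rewrite [LHS]mmapX mmap1U.
Qed.

Lemma graded_Cser : graded (Cser k).
Proof.
apply: graded_sinv; apply: gradedB; first exact: graded1.
by move=> n; rewrite rmorphMn graded_Rvar /= scalerMnl.
Qed.

Lemma graded_Qser m : graded (Qser k m).
Proof.
elim: m => [|m IH] /=; first exact: graded_Cser.
rewrite smulE saddE sscaleE; apply: gradedM; first exact: graded_Cser.
apply: gradedD; first exact: graded_sD.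
by rewrite rmorph_nat; apply: gradedM => //; apply: graded_nat.
Qed.

Lemma graded_Pser m : graded (Pser k m).
Proof.
rewrite /Pser sscaleE -mpolyCN; apply: gradedM; last exact: graded_Qser.
exact: graded_cst.
Qed.

End Weight.

(** * Kerov's polynomials *)

Section KerovPolynomial.
Variable K : nat.
Local Notation k := K.+1.
Local Notation QR := {mpoly rat[k]}.

(** The series R(t) without the terms beyond R_(k+1) t^(k+1). *)
Definition Rseries : series QR := fun n => if n is 0%N then 1 else Rvar k n.

Lemma Cser_Rseries : Cser k = sinv (Rseries - sD Rseries).
Proof.
congr sinv; apply: seriesP => -[|n].
  by rewrite ssubE !coefsB /sD /= !mulr0n.
by rewrite ssubE !coefsB /sD [sone _ _]/(0 : QR) sub0r /= mulrSr opprD addrCA subrr addr0.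
Qed.

Lemma RD0 : (Rseries - sD Rseries) 0%N = 1.
Proof. by rewrite coefsB /sD mulr0n subr0. Qed.

(** With P_0 = 1 the recursion (m + 1) P_(m+1) = C (D + m - 1) P_m holds for all
   m. *)
Definition Pfull m : series QR := if m is 0%N then 1 else Pser k m.

Lemma PfullS m : Pfull m.+1 *+ m.+1 =
  sinv (Rseries - sD Rseries) * (sD (Pfull m) + Pfull m *+ m - Pfull m).
Proof.
rewrite -Cser_Rseries; case: m => [|m] /=.
  have e1 : (1`!)%:R^-1 = 1 :> rat by rewrite invr1.
  rewrite mulr1n mulr0n addr0 sD1 sub0r mulrN1 /Pser sscaleE e1 mpolyC1.
  by rewrite rmorphN rmorph1 mulN1r.
have cE n : (- ((n.+1)`!%:R^-1 : rat)%:MP_[k]) *+ n.+1 = - ((n`!%:R^-1 : rat)%:MP_[k]).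
  rewrite mulNrn -mpolyCMn; congr (- _%:MP_[k]).
  rewrite factS natrM invfM -mulrnAl -[_^-1 *+ _]mulr_natr mulVf ?mul1r //.
  by rewrite pnatr_eq0.
rewrite /Pser !sscaleE -mulrnAl -rmorphMn cE /= sscaleE rmorph_nat.
rewrite smulE saddE sDM sD_cst mul0r add0r; ring.
Qed.

(** The sum over the partitions of d of m_la P_la / C, of weight k + 1 - d. *)
Definition degree_part d : QR :=
  \sum_(la <- parts_of d)
    (mhat k la)%:R * ((Rseries - sD Rseries) * \prod_(m <- la) Pfull m) (k.+1 - d)%N.

Definition shifted_product : QR :=
  ((Rseries - sD Rseries) * \prod_(j < k) shift_series Pfull j%:R) k.+1.

Lemma shifted_productE : shifted_product = \sum_(d < k.+2) degree_part d.
Proof. exact: prod_shift_series. Qed.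

Lemma sinvK (A : comNzRingType) (f : series A) : f 0%N = 1 -> sinv (sinv f) = f.
Proof. by move=> f0; apply: (mulsI (sinv0 f0)); rewrite mulVs // mulsV // sinv0. Qed.

Lemma kerov_sumE n : (2 * n <= k.+1)%N ->
  kerov_sum k n (k + 1 - 2 * n)%N = degree_part (2 * n).
Proof.
move=> le; rewrite /kerov_sum /degree_part addn1; apply: eq_big_seq => la.
rewrite mem_parts_of => /and3P[_ nla _].
rewrite /sscale; congr (_ * (_ : series _) _).
rewrite sdivE Cser_Rseries sinvK ?RD0 // mulrC; congr (_ * _).
by apply: eq_big_seq => m; case: m => // /(negP nla).
Qed.

Lemma graded_Pfull m : graded (Pfull m).
Proof. by case: m => [|m]; [apply: graded1 | apply: graded_Pser]. Qed.

Lemma graded_Rseries : graded Rseries.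
Proof.
case=> [|n]; last exact: (graded_Rvar k n.+1).
by rewrite /Rseries rmorph1 expr0 scale1r.
Qed.

Lemma weighted_degree_part d :
  weighted k (degree_part d) = degree_part d *: 'X^(k.+1 - d).
Proof.
rewrite /degree_part rmorph_sum scaler_suml; apply: eq_bigr => la _.
have gr : graded ((Rseries - sD Rseries) * \prod_(m <- la) Pfull m).
  apply: gradedM; last by apply: graded_prod => m; apply: graded_Pfull.
  by apply: gradedB; [|apply: graded_sD]; apply: graded_Rseries.
by rewrite rmorphM rmorph_nat gr !mulr_natl -scalerMnl.
Qed.

Variable Sigma : {mpoly int[k]}.
Hypothesis hSigma : is_kerov_poly Sigma.

(** k times the difference of the two sides of the formula for the whole Kerov
   polynomial; it will be shown to vanish on enough points. *)
Definition defect : QR := k%:R *: map_mpoly (intr : int -> rat) Sigma + shifted_product.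

Definition Rval (v : 'I_k -> rat) : series rat := smap (meval v) Rseries.

Lemma Rval0 v : Rval v 0%N = 1. Proof. exact: rmorph1. Qed.
Lemma Rval1 v : Rval v 1%N = 0. Proof. exact: rmorph0. Qed.
Lemma RvalS v (j : 'I_k) : Rval v j.+2 = v j.
Proof. by rewrite /Rval /smap /= valK mevalXU. Qed.

(** The hypothesis is a congruence because it will be applied to the truncation
   of an exact solution R. *)
Lemma eval_shifted_product v (b : 'I_k -> rat) :
  eqmods k.+2 ((Rval v + scst k%:R * svar rat) *
      \prod_i (Rval v - scst (b i + 1) * svar rat))
    (\prod_i (Rval v - scst (b i) * svar rat)) ->
  shifted_product.@[v] =
  (\prod_(j < k) (1 - scst j%:R * svar rat)
   * \prod_i ((1 - scst (b i + k%:R + k%:R) * svar rat)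
              * sinv (1 - scst (b i + k%:R) * svar rat))) k.+1.
Proof.
move=> h; pose P m := smap (meval v) (Pfull m).
rewrite (@shift_residue (Rval v) P (Rval0 v) _ _ _ _ _ h).
- rewrite /shifted_product -[LHS]/(smap (meval v) _ k.+1) rmorphM rmorphB /= smapD.
  rewrite rmorph_prod; congr ((_ * _ : series rat) _); apply: eq_bigr => j _.
  apply: seriesP => n; rewrite -[LHS]/(meval v (shift_series Pfull j%:R n)) /shift_series.
  rewrite rmorph_sum; apply: eq_bigr => m _.
  by rewrite rmorphM rmorphXn rmorph_nat.
- exact: rmorph1.
move=> m; rewrite -rmorphMn PfullS rmorphM rmorphB rmorphD /= rmorphMn smapV ?RD0 //.
by rewrite rmorphB /= !smapD.
Qed.

Local Notation ZB := {mpoly int[k]}.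
(** The corners of a diagram whose row lengths are indeterminates.  Specializing
   their free cumulants yields those of every partition with distinct rows, and
   shows that they are polynomials in the row lengths. *)
Definition xgen (i : 'I_k) : ZB := 'X_i - (K - i)%N%:R.

Section WithUniversal.
Variable RB : series ZB.
Hypothesis RB0 : RB 0%N = 1.
Hypothesis RB_fix : scomp (corner_ratio xgen) (svar ZB * sinv RB) = RB.
Hypothesis RB_inv : scomp (svar ZB * corner_ratio xgen) (svar ZB * sinv RB) = svar ZB.

(** The character formula, its conversion to a residue, and the change of
   variable x = R(t) / t, for a partition with k long distinct rows. *)
Lemma defect_partition (l : 'I_k -> nat) :
  (forall i j : 'I_k, (i < j)%N -> (l i < l j)%N) ->
  (forall i, (k + k <= l i)%N) ->
  defect.@[fun j => (map_mpoly (intr : int -> rat) (RB j.+2)).@[fun i => (l i)%:R]] = 0.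
Proof.
move=> l_incr l_ge.
have l_gt0 i : (0 < l i)%N by apply: leq_trans (l_ge i).
pose ev : {rmorphism ZB -> int} := meval (fun i => (l i)%:Z).
have evx c : ev (xgen c) = corner l c.
  by rewrite /corner /xgen [LHS]rmorphB rmorph_nat /= mevalXU natz.
pose R := smap ev RB.
have fc : free_cumulants (rows_part l) R.
  split=> [|n]; first by rewrite /R /smap RB0 rmorph1.
  rewrite (Hseries_rows_part l_incr l_gt0) sdivE.
  have -> : svar int * corner_ratio (corner l) = smap ev (svar ZB * corner_ratio xgen).
    rewrite rmorphM /= smapX smap_corner_ratio; congr (_ * corner_ratio _).
    by apply: boolp.funext => i; rewrite evx.
  have -> : svar int * sinv R = smap ev (svar ZB * sinv RB).
    by rewrite rmorphM /= smapX smapV.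
  by rewrite -smap_comp RB_inv smapX.
have [N [i [s [leN part spec ct nc]]]] := normalized_char_cycle l_incr l_ge.
have := hSigma leN part fc spec ct; rewrite nc => {nc} charE.
pose v (j : 'I_k) : rat := (R j.+2)%:~R.
have vE (j : 'I_k) : (map_mpoly (intr : int -> rat) (RB j.+2)).@[fun i => (l i)%:R] = v j.
  rewrite /v /R /smap /ev.
  have -> : map_mpoly (intr : int -> rat) (RB j.+2) =
    mmap ((@mpolyC k rat) \o (intr : int -> rat)) (fun i : 'I_k => 'X_i) (RB j.+2) by [].
  rewrite [LHS]rmorph_mmap -[RHS]/(intr _ : rat) [RHS]rmorph_mmap.
  apply: eq_mmap => [c|a] /=; first exact: mevalC.
  by rewrite mevalXU.
rewrite (_ : meval _ defect = meval v defect); last by apply: eq_mmap => // j; rewrite vE.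
have evq : (map_mpoly (intr : int -> rat) Sigma).@[v] = (Sigma.@[fun j => R j.+2])%:~R.
  have -> : map_mpoly (intr : int -> rat) Sigma =
    mmap ((@mpolyC k rat) \o (intr : int -> rat)) (fun i : 'I_k => 'X_i) Sigma by [].
  rewrite [LHS]rmorph_mmap [RHS]rmorph_mmap.
  apply: eq_mmap => [c|a] /=; first exact: mevalC.
  by rewrite mevalXU.
rewrite /defect mevalD mevalZ evq.
pose nu (c : 'I_k) : rat := (l c + c)%:R.
pose b c : rat := nu c - k%:R.
have bE c : b c + 1 = (corner l c)%:~R.
  rewrite /b /nu /corner rmorphB /= -!pmulrn.
  have -> : k%:R = (K - c)%:R + c%:R + 1 :> rat.
    by rewrite -natrD subnK ?natr1 // -ltnS.
  by rewrite natrD; ring.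
have eqn : cumulant_eqn (fun c => (corner l c)%:~R) (smap (intr : int -> rat) R) = 0.
  have := cumulant_eqnP RB0 RB_fix => /(congr1 (smap ev)) /(congr1 (smap (intr : int -> rat))).
  rewrite !rmorph0 !smap_cumulant_eqn => <-; congr cumulant_eqn.
  by apply: boolp.funext => c; rewrite /= evx.
have R10 : smap (intr : int -> rat) R 1%N = 0.
  by apply: cumulant_eqn_coef1 eqn; rewrite /R /smap RB0 !rmorph1.
have eqR : eqmods k.+2 (Rval v) (smap (intr : int -> rat) R).
  move=> [|[|j]] lt; first by rewrite Rval0 /R /smap RB0 !rmorph1.
    by rewrite Rval1 R10.
  by rewrite -[j.+2]/(Ordinal (lt : (j < k)%N)).+2 RvalS.
rewrite (@eval_shifted_product v b); last first.
  move=> n lt; apply/eqP; rewrite -subr_eq0 -coefsB.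
  transitivity (cumulant_eqn (fun c => (corner l c)%:~R) (Rval v) n == 0).
    rewrite /cumulant_eqn; congr (_ == _); congr ((_ * _ - _ : series rat) _).
      by apply: eq_bigr => c _; rewrite bE.
    by apply: eq_bigr => c _; rewrite -bE addrK.
  by rewrite (eqmods_cumulant_eqn _ eqR lt) eqn.
pose sq : seq rat := [seq (val j)%:R | j <- enum 'I_k] ++ [seq nu j + k%:R | j <- enum 'I_k].
have nu_inj : injective nu.
  by move=> c d /eqP; rewrite eqr_nat => /eqP /(shifted_row_inj l_incr).
have nu_n0 c : nu c != 0.
  by rewrite pnatr_eq0 -lt0n addn_gt0 l_gt0.
have szs : size sq = (k + k)%N by rewrite size_cat !size_map -enumT size_enum_ord.
have := frobenius_sum_residue nu_inj nu_n0 (ltn0Sn K) szs.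
have -> : (\prod_(a <- sq) (1 - scst a * svar rat)) *
    \prod_i sinv (1 - scst (nu i) * svar rat) =
  \prod_(j < k) (1 - scst j%:R * svar rat)
   * \prod_i ((1 - scst (b i + k%:R + k%:R) * svar rat)
              * sinv (1 - scst (b i + k%:R) * svar rat)).
  rewrite big_split /= mulrA /sq big_cat /= !big_map -!enumT !big_enum /=.
  have bk c : b c + k%:R = nu c by rewrite /b subrK.
  congr (_ * _ * _); apply: eq_bigr => c _; by rewrite bk.
move=> <-.
pose T : rat := \sum_c ((l c + c) ^_ k)%:R *
       (\prod_(j < k | j != c) ((l c + c)%:R - k%:R - (l j + j)%:R))
       / \prod_(j < k | j != c) ((l c + c)%:R - (l j + j)%:R).
have SigT : (Sigma.@[fun j => R j.+2])%:~R = T :> rat.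
  apply: (fmorph_inj (ratr : {rmorphism rat -> algC})); rewrite rmorph_int -charE /T.
  rewrite rmorph_sum; apply: eq_bigr => c _.
  rewrite [RHS]rmorphM [X in _ = _ * X]fmorphV [X in _ = X * _]rmorphM.
  rewrite [X in _ = X * _ / _]rmorph_nat [X in _ = _ * X / _]rmorph_prod.
  rewrite [X in _ = _ / X]rmorph_prod.
  by congr (_ * _ / _); apply: eq_bigr => j _; rewrite !raddfB /= !ratr_nat.
rewrite SigT /T mulr_sumr -big_split /= big1 // => c _.
have -> : \prod_(a <- sq) (nu c - a) = - k%:R * (((l c + c) ^_ k)%:R *
    (\prod_(j < k | j != c) ((l c + c)%:R - k%:R - (l j + j)%:R))).
  rewrite /sq big_cat /= !big_map -!enumT !big_enum /= [X in _ * X](bigD1 c) //=.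
  have -> : \prod_(i < k) (nu c - i%:R) = ((l c + c) ^_ k)%:R.
    rewrite ffact_prod natr_prod; apply: eq_bigr => j _; rewrite natrB //.
    apply: leq_trans (ltnW (ltn_ord j)) _; apply: leq_trans (leq_addr _ _).
    by apply: leq_trans (l_ge c); apply: leq_addr.
  rewrite (_ : nu c - (nu c + k%:R) = - k%:R); last by ring.
  rewrite mulrCA; congr (_ * (_ * _)); apply: eq_bigr => j _.
  by rewrite /nu; ring.
by rewrite !mulNr -!mulrA subrr.
Qed.

(** As a polynomial in the row lengths the defect vanishes on partitions, hence
   on all algebraic row lengths; and some of these have the free cumulants r. *)
Lemma defect_natr (r : 'I_k -> nat) : defect.@[fun j => (r j)%:R] = 0.
Proof.
pose Q : QR := mmap (@mpolyC k rat)
  (fun j : 'I_k => map_mpoly (intr : int -> rat) (RB j.+2)) defect.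
have mapQ (S : comNzRingType) (f : {rmorphism rat -> S}) (v : 'I_k -> S) :
    mmap f v Q = mmap f (fun j : 'I_k => mmap (f \o (intr : int -> rat)) v (RB j.+2)) defect.
  rewrite /Q [LHS]rmorph_mmap; apply: eq_mmap => [c|j] /=; first exact: mmapC.
  have -> : map_mpoly (intr : int -> rat) (RB j.+2) =
    mmap ((@mpolyC k rat) \o (intr : int -> rat)) (fun i : 'I_k => 'X_i) (RB j.+2) by [].
  rewrite [LHS]rmorph_mmap; apply: eq_mmap => [c|i] /=; first exact: mmapC.
  by rewrite mmapX mmap1U.
pose toC : {rmorphism rat -> algC} := ratr.
have Q0 : forall v : 'I_k -> algC, mmap toC v Q = 0.
  apply: (@mpoly_density _ _ toC (k + k)) => l l_incr l_ge; rewrite mapQ.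
  have := defect_partition l_incr l_ge => /(congr1 toC); rewrite rmorph0 => <-.
  rewrite [RHS]rmorph_mmap; apply: eq_mmap => // j /=.
  have -> : map_mpoly (intr : int -> rat) (RB j.+2) =
    mmap ((@mpolyC k rat) \o (intr : int -> rat)) (fun i : 'I_k => 'X_i) (RB j.+2) by [].
  rewrite [X in _ = toC X]rmorph_mmap [RHS]rmorph_mmap.
  apply: eq_mmap => [c|i] /=; first by rewrite mevalC.
  by rewrite mevalXU rmorph_nat.
pose R := smap toC (Rval (fun j => (r j)%:R)).
have R0 : R 0%N = 1 by rewrite /R /smap Rval0 rmorph1.
have R1 : R 1%N = 0 by rewrite /R /smap Rval1 rmorph0.
have nC m : m.+1%:R != 0 :> algC by rewrite pnatr_eq0.
have [x eqx] := @cumulant_eqn_onto algC nC k R R0 R1.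
pose v (i : 'I_k) : algC := x i + (K - i)%N%:R.
pose g : {rmorphism ZB -> algC} := mmap (toC \o (intr : int -> rat)) v.
have eqRB : cumulant_eqn x (smap g RB) = 0.
  have := cumulant_eqnP RB0 RB_fix => /(congr1 (smap g)); rewrite rmorph0 => <-.
  rewrite smap_cumulant_eqn; congr cumulant_eqn; apply: boolp.funext => i.
  by rewrite /xgen rmorphB rmorph_nat /= [X in X - _]mmapX mmap1U /v addrK.
have e : eqmods k.+2 (smap g RB) R.
  have g0 : smap g RB 0%N = 1 by rewrite /smap RB0 rmorph1.
  by apply: (cumulant_eqn_uniq g0 R0 (x := x)) => n lt; rewrite eqRB eqx.
have := Q0 v; rewrite mapQ => q0.
apply: (fmorph_inj toC); rewrite rmorph0 -q0 [LHS]rmorph_mmap.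
apply: eq_mmap => // j; rewrite -[RHS]/(smap g RB j.+2) e; last exact: ltn_ord j.
by rewrite /R /smap RvalS.
Qed.

End WithUniversal.

Lemma defect0 : defect = 0.
Proof.
have [RB [RB0 RB_fix RB_inv]] := exists_cumulants (corner_ratio0 xgen).
have := @mpoly_density k QR (@mpolyC k rat) 0 defect.
move=> /(_ _ (fun i : 'I_k => 'X_i)) <-.
  have -> : mmap (@mpolyC k rat) (fun i : 'I_k => 'X_i) defect =
      defect \mPo [tuple 'X_i | i < k].
    by apply: eq_mmap => // i; rewrite tnth_mktuple.
  by rewrite comp_mpoly_id.
move=> l _ _; rewrite -(rmorph0 (@mpolyC k rat)) -(defect_natr RB0 RB_fix RB_inv l).
rewrite [RHS]rmorph_mmap; apply: eq_mmap => // i /=; by rewrite rmorph_nat.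
Qed.

Lemma kerov_poly_sum :
  map_mpoly (intr : int -> rat) Sigma = - (k%:R^-1 : rat) *: \sum_(d < k.+2) degree_part d.
Proof.
have k0 : k%:R != 0 :> rat by rewrite pnatr_eq0.
apply: (scalerI k0); rewrite scaleNr scalerN scalerA divff // scale1r -shifted_productE.
by apply/eqP; rewrite -addr_eq0 -/defect defect0.
Qed.

End KerovPolynomial.

Theorem theorem2p1 (n k : nat) (hn : (1 <= n)%N) (hk : (2 * n - 1 <= k)%N)
    (Sigma : {mpoly int[k]}) (hSigma : is_kerov_poly Sigma) :
  map_mpoly (intr : int -> rat) (weight_part (k + 1 - 2 * n) Sigma) =
  - (k%:R^-1 : rat) *: kerov_sum k n (k + 1 - 2 * n)%N.
Proof.
case: k hk Sigma hSigma => [|K] hk Sigma hSigma; first by lia.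
have le : (2 * n <= K.+2)%N by lia.
rewrite map_weight_part kerov_sumE // (kerov_poly_sum hSigma).
rewrite -mul_mpolyC rmorphM /= [X in X * _]mmapC /= mul_polyC coefZ mul_mpolyC.
congr (_ *: _); rewrite rmorph_sum coef_sum addn1.
have lt : (2 * n < K.+3)%N by [].
rewrite (bigD1 (Ordinal lt)) //= weighted_degree_part coefZ coefXn eqxx mulr1.
rewrite big1 ?addr0 // => d; rewrite -val_eqE /= => dn.
rewrite weighted_degree_part coefZ coefXn; case: eqP => [e|_]; last by rewrite mulr0.
by move: dn; have := ltn_ord d; move: e; lia.
Qed.
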